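(* Let $\mathcal{G}$ be a connected noncompact metric graph with finitely many edges and vertices. Let $Q=\bigoplus_{e\in\mathcal{E}}Q_e=Q^*\in L^1(\mathcal{G};\mathbb{C}^{m\times m})$ and $x_eQ_e\in L^1(e;\mathbb{C}^{m\times m})$ for each $e\in\mathcal{E}$. Then for any $\alpha:\mathcal{V}\to\mathbb{C}^{m\times m}$ with $\alpha(v)=\alpha(v)^*$, $v\in\mathcal{V}$, the Hamiltonian ${\bf H}_{\alpha,Q}$ satisfies $$\kappa_-({\bf H}_{\alpha,Q})\le\sum_{e\in\mathcal{E}}\left[\int_e x_e\cdot\mathrm{tr}(Q_{e,-}(x))\,dx\right]+m|\mathcal{V}|,$$ where $[a]$ denotes the integer part of $a\in\mathbb{R}$.
   Context: Let $m\ge1$. $\mathcal{G}=(\mathcal{V},\mathcal{E})$ is a connected noncompact metric graph with finitely many vertices $\mathcal{V}$ ($|\mathcal{V}|$ is their number) and edges $\mathcal{E}$ (at least one lead), without loops and multiple edges. Each lead $e$ is identified with $[0,\infty)$, the point $0$ being a vertex; each finite edge $e$ of length $|e|\in(0,\infty)$ is identified with $(0,|e|)$, the endpoints being its vertices; $x_e$ is the corresponding coordinate on $e$. $L^2(\mathcal{G};\mathbb{C}^m)=\bigoplus_{e}L^2(e;\mathbb{C}^m)$. $Q_e(x)=Q_e(x)^*$ for a.e. $x$. $Q_{e,-}(x)\ge0$ denotes the negative part of the Hermitian matrix $Q_e(x)$: $Q_{e,-}(x)=-P_-(x)Q_e(x)$, with $P_-(x)$ the spectral projection of $Q_e(x)$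 on its negative spectrum. $A_{\max}=\bigoplus_e A_{e,\max}$, where $A_{e,\max}f=-f''+Q_ef$ on $\{f\in L^2(e;\mathbb{C}^m): f,f'\in AC_{\rm loc}(e;\mathbb{C}^m),\ -f''+Q_ef\in L^2(e;\mathbb{C}^m)\}$. $\mathcal{E}_v$ is the set of edges incident to $v$, and $f'_e(v)$ is the derivative of $f_e$ at $v$ in the outgoing direction ($f_e'(0+)$ if $v$ corresponds to $x=0$, $-f_e'(|e|-)$ if $v$ corresponds to $x=|e|$). ${\bf H}_{\alpha,Q}$ is the (self-adjoint) restriction of $A_{\max}$ to those $f\in\mathrm{dom}(A_{\max})$ which at each $v\in\mathcal{V}$ are continuous and satisfy $\sum_{e\in\mathcal{E}_v}f'_e(v)=\alpha(v)f(v)$. For $T=T^*$, $\kappa_-(T)=\dim E_T(-\infty,0)$, with $E_T$ the spectral measure of $T$. *)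

(* Defs.v *)
From HB Require Import structures.
From mathcomp Require Import all_boot all_order all_algebra.
From mathcomp Require Import complex.
From mathcomp Require Import all_classical all_reals all_analysis.

Set Implicit Arguments.
Unset Strict Implicit.
Unset Printing Implicit Defensive.

Import Order.TTheory GRing.Theory Num.Theory.
Import numFieldNormedType.Exports.

Local Open Scope classical_set_scope.
Local Open Scope ring_scope.
Local Open Scope complex_scope.

(* For a lead, [far e = None]; for a finite edge, [far e = Some (v, l)], where
   l = |e| and the coordinate x_e runs from src e (x = 0) to v (x = l). *)
Definition adjacent (R : realType) (V E : finType) (src : E -> V)
    (far : E -> option (V * R)) : rel V :=
  fun u v => [exists e, if far e is Some (w, _)
    then ((src e == u) && (w == v)) || ((src e == v) && (w == u)) else false].

Record metric_graph (R : realType) := MetricGraph {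
  vertex : finType;
  edge : finType;
  src : edge -> vertex;
  far : edge -> option (vertex * R);
  length_gt0 : forall e v l, far e = Some (v, l) -> 0 < l;
  no_loops : forall e v l, far e = Some (v, l) -> src e <> v;
  no_multiple_edges : forall e1 e2 v1 v2 l1 l2,
    far e1 = Some (v1, l1) -> far e2 = Some (v2, l2) ->
    [set src e1; v1]%SET = [set src e2; v2]%SET -> e1 = e2;
  connected_graph : forall u v, connect (adjacent src far) u v;
  noncompact_graph : exists e, far e = None }.

Arguments src {R} {m}.
Arguments far {R} {m}.

Section Graph.
Variables (R : realType) (G : metric_graph R).

(* Leads are taken open at 0 as well, values and derivatives at a vertex being
   one-sided limits; for Q_e in L^1 the end 0 is regular, so that AC_loc on
   ]0, +oo[ and on [0, +oo[ give the same maximal operator. *)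
Definition edge_set (e : edge G) : set R :=
  if far e is Some (_, l) then `]0, l[%classic else `]0, +oo[%classic.

Definition incident (e : edge G) (v : vertex G) : bool :=
  (src e == v) || (if far e is Some (w, _) then w == v else false).

End Graph.

Section ComplexValued.
Variable R : realType.
Local Notation C := R[i].
Local Notation mu := (@lebesgue_measure R).

Definition both_parts (P : (R -> R) -> Prop) (h : R -> C) : Prop :=
  P (fun x => complex.Re (h x)) /\ P (fun x => complex.Im (h x)).

Definition cintegral (D : set R) (h : R -> C) : C :=
  (\int[mu]_(x in D) complex.Re (h x)) +i* (\int[mu]_(x in D) complex.Im (h x)).

Definition abs_continuous (a b : R) (h : R -> R) : Prop :=
  forall eps : R, 0 < eps -> exists2 delta : R, 0 < delta &
    forall (n : nat) (u v : 'I_n -> R),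
      (forall i, [/\ a <= u i, u i <= v i & v i <= b]) ->
      trivIset setT (fun i => `]u i, v i[%classic) ->
      \sum_i (v i - u i) < delta ->
      \sum_i `|h (v i) - h (u i)| < eps.

Variable m : nat.

Definition cdot (u v : 'cV[C]_m) : C := \sum_i u i 0 * (v i 0)^*.

Definition coordinatewise (P : (R -> R) -> Prop) (h : R -> 'cV[C]_m) : Prop :=
  forall i, both_parts P (fun x => h x i 0).

Definition AC_loc (D : set R) (h : R -> 'cV[C]_m) : Prop :=
  forall a b, `[a, b]%classic `<=` D -> coordinatewise (abs_continuous a b) h.

Definition cderive (h : R -> 'cV[C]_m) : R -> 'cV[C]_m := fun x =>
  \col_i (derive1 (fun t => complex.Re (h t i 0)) x
          +i* derive1 (fun t => complex.Im (h t i 0)) x).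

Definition ccvg (F : set_system R) (h : R -> 'cV[C]_m) (c : 'cV[C]_m) : Prop :=
  forall i, (complex.Re (h x i 0) @[x --> F] --> complex.Re (c i 0)) /\
            (complex.Im (h x i 0) @[x --> F] --> complex.Im (c i 0)).

Definition L1_mx (D : set R) (M : R -> 'M[C]_m) : Prop :=
  forall i j,
    both_parts (fun h => mu.-integrable D (EFin \o h)) (fun x => M x i j).

(* With A = U^-1 diag(d) U for U unitary, this is the spectral projection of A
   on its negative spectrum. *)
Definition neg_proj (A : 'M[C]_m) : 'M[C]_m :=
  invmx (spectralmx A)
    *m diag_mx (\row_j ((spectral_diag A 0 j < 0)%R)%:R) *m spectralmx A.

Definition neg_part (A : 'M[C]_m) : 'M[C]_m := - (neg_proj A *m A).

End ComplexValued.

Section L2.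
Variables (R : realType) (m : nat) (G : metric_graph R).
Local Notation C := R[i].
Local Notation mu := (@lebesgue_measure R).

(* Elements of L^2(G; C^m) are represented by functions, with [ae_eq] as their
   equality; the values of f e outside [edge_set e] are irrelevant. *)
Definition gfun := edge G -> R -> 'cV[C]_m.

Implicit Types f g : gfun.

Definition gae_eq f g : Prop :=
  forall e, {ae mu, forall x, edge_set e x -> f e x = g e x}.

Definition L2 f : Prop := forall e,
  coordinatewise (measurable_fun (edge_set e)) (f e) /\
  (\int[mu]_(x in edge_set e) (complex.Re (cdot (f e x) (f e x)))%:E < +oo)%E.

Definition inner f g : C :=
  \sum_e cintegral (edge_set e) (fun x => cdot (f e x) (g e x)).

Definition lin_indep (n : nat) (s : 'I_n -> gfun) : Prop :=
  forall c : 'I_n -> C,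
    gae_eq (fun e x => \sum_i c i *: s i e x) (fun _ _ => 0) ->
    forall i, c i = 0.

(* +oo when infinite *)
Definition dimension (S : set gfun) : \bar R :=
  ereal_sup [set n%:R%:E | n in
    [set n | exists2 s : 'I_n -> gfun, forall i, S (s i) & lin_indep s]].

(* An operator in L^2(G; C^m) is given by its graph. [spectral_measure T E]
   states that E is a projection-valued measure on the Borel sets of R with
   T = \int lambda dE(lambda), that is, nu_f := <E(.) f, f> being a measure,
   dom T = { f | \int lambda^2 dnu_f < oo } and
   <T f, f> = \int lambda dnu_f on dom T
   (this determines T by polarization). *)
Record spectral_measure (T : gfun -> gfun -> Prop)
    (E : set R -> gfun -> gfun) : Prop := SpectralMeasure {
  spectral_L2 : forall B f, measurable B -> L2 f -> L2 (E B f);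
  spectral_ae : forall B f g, measurable B -> L2 f -> L2 g ->
    gae_eq f g -> gae_eq (E B f) (E B g);
  spectral_linear : forall B (a : C) f g, measurable B -> L2 f -> L2 g ->
    gae_eq (E B (fun e x => a *: f e x + g e x))
           (fun e x => a *: E B f e x + E B g e x);
  spectral_selfadjoint : forall B f g, measurable B -> L2 f -> L2 g ->
    inner (E B f) g = inner f (E B g);
  (* for A = B: idempotence *)
  spectral_setI : forall A B f, measurable A -> measurable B -> L2 f ->
    gae_eq (E (A `&` B) f) (E A (E B f));
  spectral_setT : forall f, L2 f -> gae_eq (E setT f) f;
  spectral_integral : forall f, L2 f ->
    exists nu : {measure set (measurableTypeR R) -> \bar R},
      [/\ forall B, measurable B -> nu B = (complex.Re (inner (E B f) f))%:E,
          (exists g, T f g) <-> (\int[nu]_x (x ^+ 2)%:E < +oo)%E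
        & forall g, T f g -> inner g f = (\int[nu]_x x)%:C] }.

(* kappa_- = dim E(-oo, 0) *)
Definition kappa_minus (E : set R -> gfun -> gfun) : \bar R :=
  dimension [set f | L2 f /\ gae_eq (E `]-oo, 0[%classic f) f].

Definition A_max (Q : edge G -> R -> 'M[C]_m) f g : Prop :=
  [/\ L2 f, forall e, AC_loc (edge_set e) (f e),
      forall e, AC_loc (edge_set e) (cderive (f e)), L2 g
    & gae_eq g (fun e x => - cderive (cderive (f e)) x + Q e x *m f e x)].

(* The limit of f e at the end v of e, resp. the derivative of f e at v in the
   outgoing direction; nothing is required when e is not incident to v. *)
Definition end_value f (e : edge G) (v : vertex G) (c : 'cV[C]_m) : Prop :=
  (src e = v -> ccvg 0^'+ (f e) c) /\
  (forall l, far e = Some (v, l) -> ccvg l^'- (f e) c).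

Definition end_derivative f (e : edge G) (v : vertex G) (d : 'cV[C]_m) : Prop :=
  (src e = v -> ccvg 0^'+ (cderive (f e)) d) /\
  (forall l, far e = Some (v, l) ->
    ccvg l^'- (fun x => - cderive (f e) x) d).

Definition vertex_condition (alpha : vertex G -> 'M[C]_m) f : Prop :=
  forall v, exists (c : 'cV[C]_m) (d : edge G -> 'cV[C]_m),
    [/\ forall e, end_value f e v c, forall e, end_derivative f e v (d e)
      & \sum_(e | incident e v) d e = alpha v *m c].

Definition hamiltonian (alpha : vertex G -> 'M[C]_m)
    (Q : edge G -> R -> 'M[C]_m) f g : Prop :=
  L2 f /\ exists f0 : gfun,
    [/\ gae_eq f f0, A_max Q f0 g & vertex_condition alpha f0].

End L2.

(* Main.v *)
Require Import Defs.
From HB Require Import structures.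
From mathcomp Require Import all_boot all_order all_algebra finmap.
From mathcomp Require Import complex.
From mathcomp Require Import all_classical all_reals all_analysis measurable_realfun.
From mathcomp Require Import ring lra.

(** Let n linearly independent functions lie in the range of E(]-oo, 0[).
    Cutting the spectrum off at -N for a large N keeps them independent
    ([window_injective]) and moves them into the domain of the Hamiltonian H,
    where <H f, f> < 0 on their span apart from 0 ([negative_family]).
    Requiring f to vanish at every vertex costs at most m dimensions per vertex
    and decouples the edges: no boundary term, hence no alpha, is left in the
    integration by parts, and <H f, f> is at least the sum over the edges of
    the integrals of |f'|^2 + <Q f, f> ([edge_energy]). What remains is a
    count on each edge, with zero boundary values: up to as many linear
    conditions on f as the integer part of the integral of x tr Q_-, the
    contribution of the edge is nonnegative ([edge_bound]). If fewer conditions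
    than dimensions were imposed in all, some f <> 0 would satisfy them, and
    <H f, f> would be both negative and nonnegative
    ([negative_dimension_le]).

    The count on an edge is a finite-dimensional form of the
    Birman-Schwinger argument. As f vanishes at 0, |f(x)|^2 is at most x times
    the integral of |f'|^2: evaluation at x has norm at most sqrt x for the
    Dirichlet inner product. For a Dirichlet-orthonormal family w_1, ..., w_k
    Bessel's inequality therefore bounds the sum of the |<w_i(x), z>|^2 by
    x |z|^2 ([bessel]), and taking for z the eigenvectors of Q(x) with negative
    eigenvalues gives
      sum_i - <Q(x) w_i(x), w_i(x)> <= x tr Q_-(x)
    ([neg_part_trace_ge]). If moreover the integral of - <Q w_i, w_i> exceeds 1
    for each i, then k is at most the integral of x tr Q_-. Choose such a family
    with k maximal: a function orthogonal to it whose potential energy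
    outweighed its Dirichlet energy would, once normalised, extend the family
    ([greedy_orthonormal]).

    The analysis lies in the energy inequality [dirichlet_energy], since
    nothing is known beforehand about the integrability of f' and of <Q f, f>
    near the end of a lead. On ]0, b] the identity
    |f'|^2 + <Q f, f> - <- f'' + Q f, f> = Re <f', f>' can be integrated, by the
    fundamental theorem of calculus for absolutely continuous functions
    ([abs_continuous_FTC], a consequence of the Radon-Nikodym theorem). The
    pointwise bound and the integrability of x |Q| let half of the Dirichlet
    energy absorb the potential term far out, and on a lead the flux Re <f', f>
    cannot stay above a positive number, as |f|^2 would then be nondecreasing
    and not integrable. *)

Import Order.TTheory GRing.Theory Num.Theory.
Import numFieldNormedType.Exports.
Local Open Scope classical_set_scope.
Local Open Scope ring_scope.
Local Open Scope complex_scope.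
Set Implicit Arguments.
Unset Strict Implicit.
Unset Printing Implicit Defensive.

(** * Absolutely continuous functions and total variation *)

Section AbsCont.
Variable R : realType.
Implicit Types (h : R -> R) (a b : R).

(** Refinements of a family of intervals are indexed by dependent pairs rather
    than by an initial segment of the integers. *)
Lemma abs_continuous_fin h a b (eps : R) : abs_continuous a b h -> 0 < eps ->
  exists2 delta : R, 0 < delta & forall (I : finType) (u v : I -> R),
    (forall i, [/\ a <= u i, u i <= v i & v i <= b]) ->
    trivIset setT (fun i => `]u i, v i[%classic) ->
    \sum_i (v i - u i) < delta -> \sum_i `|h (v i) - h (u i)| < eps.
Proof.
move=> ach eps0; have [delta d0 H] := ach _ eps0.
exists delta => // I u v uv tuv suv.
have := H #|I| (u \o enum_val) (v \o enum_val) (fun i => uv (enum_val i)).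
have bij : {on [pred i | true], bijective (@enum_val I predT)}.
  exact/onW_bij/enum_val_bij.
move: suv; rewrite (reindex _ bij) [X in _ -> _ -> X < _](reindex _ bij).
move=> suv; apply => // i j _ _ /= ne.
by apply: enum_val_inj; apply: tuv.
Qed.

(** Cutting disjoint intervals into smaller ones keeps them disjoint and of the
    same total length. This passes the smallness of increments on to
    variations along arbitrary partitions, hence to total variations. *)
Lemma abs_continuous_partition h a b (eps : R) :
  abs_continuous a b h -> 0 < eps ->
  exists2 delta : R, 0 < delta & forall (n : nat) (u v : 'I_n -> R),
    (forall i, [/\ a <= u i, u i <= v i & v i <= b]) ->
    trivIset setT (fun i => `]u i, v i[%classic) ->
    \sum_i (v i - u i) < delta ->
    forall s : 'I_n -> seq R, (forall i, itv_partition (u i) (v i) (s i)) ->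
    \sum_i variation (u i) (v i) h (s i) < eps.
Proof.
move=> ach eps0; have [delta d0 H] := abs_continuous_fin ach eps0.
exists delta => // n u v uv tuv suv s ps.
pose x (i : 'I_n) (j : nat) := nth (v i) (u i :: s i) j.
have x0 i : x i 0%N = u i by [].
have xl i : x i (size (s i)) = v i.
  by rewrite /x -[RHS](eqP (ps i).2) (last_nth (v i)).
have xlt i j k : (j < k)%N -> (k <= size (s i))%N -> x i j < x i k.
  move=> jk ks; have sor : sorted <%R (u i :: s i) := (ps i).1.
  by rewrite (lt_sorted_ltn_nth _ sor) ?inE ?ltnS//= (leq_trans (ltnW jk)).
have xle i j k : (j <= k)%N -> (k <= size (s i))%N -> x i j <= x i k.
  by rewrite leq_eqVlt => /predU1P[->//|jk ks]; exact/ltW/xlt.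
pose U (p : {i : 'I_n & 'I_(size (s i))}) := x (tag p) (tagged p).
pose V (p : {i : 'I_n & 'I_(size (s i))}) := x (tag p) (tagged p).+1.
have -> : \sum_i variation (u i) (v i) h (s i) = \sum_p `|h (V p) - h (U p)|.
  rewrite /variation; under eq_bigr do rewrite big_mkord.
  rewrite (@sig_big_dep _ _ _ _ _ xpredT (fun _ => xpredT)
    (fun i (j : 'I_(size (s i))) => `|h (x i j.+1) - h (x i j)|)) //=.
apply: H.
- case=> i j; have [aui uivi vib] := uv i; split.
  + by apply: (le_trans aui); rewrite -(x0 i); apply: xle => //; exact/ltnW.
  + exact: xle.
  + by apply: le_trans vib; rewrite -(xl i); apply: xle.
- move=> [i j] [i' j'] _ _ [z []]; rewrite /U /V /= !in_itv/=.
  move=> /andP[z1 z2] /andP[z3 z4].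
  have ii' : i = i'.
    apply: tuv => //; exists z; split => /=; rewrite in_itv/=; apply/andP; split.
    + by apply: le_lt_trans z1; rewrite -(x0 i); apply: xle => //; exact/ltnW.
    + by apply: (lt_le_trans z2); rewrite -(xl i); apply: xle.
    + by apply: le_lt_trans z3; rewrite -(x0 i'); apply: xle => //; exact/ltnW.
    + by apply: (lt_le_trans z4); rewrite -(xl i'); apply: xle.
  move: j' z3 z4; rewrite -ii' => j' z3 z4; congr existT.
  have disj (k l : 'I_(size (s i))) : z < x i k.+1 -> x i l < z -> (l <= k)%N.
    move=> zk lz; rewrite leqNgt; apply/negP => kl.
    have := xle i _ _ kl (ltnW (ltn_ord l)).
    by apply/negP; rewrite -ltNge (lt_trans lz).
  by apply/val_inj/anti_leq; rewrite (disj j j')//= (disj j' j).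
- rewrite -(@sig_big_dep _ _ _ _ _ xpredT (fun _ => xpredT)
    (fun i (j : 'I_(size (s i))) => x i j.+1 - x i j)) /=.
  rewrite (le_lt_trans _ suv)// ler_sum// => i _.
  rewrite -(big_mkord xpredT (fun j => x i j.+1 - x i j)).
  by rewrite telescope_sumr// xl x0.
Qed.

Lemma abs_continuousW h a b a' b' : a <= a' -> b' <= b ->
  abs_continuous a b h -> abs_continuous a' b' h.
Proof.
move=> aa bb H eps eps0; have [d d0 Hd] := H _ eps0; exists d => // n u v uv.
by apply: Hd => i; have [? ? ?] := uv i; split=> //; lra.
Qed.

(** Each total variation is nearly attained along one partition; sharing an
    error eps / 2 among the intervals reduces the claim to
    [abs_continuous_partition]. *)
Lemma abs_continuous_TV_small h a b (eps : R) : abs_continuous a b h ->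
  0 < eps -> exists2 delta : R, 0 < delta & forall u v,
    a <= u -> u <= v -> v <= b -> v - u < delta ->
    (total_variation u v h <= eps%:E)%E.
Proof.
move=> ach eps0; have [delta d0 H] := abs_continuous_partition ach eps0.
exists delta => // u v au uv vb vu; apply: ge_ereal_sup => _ [_ [s ps <-] <-].
have := H 1%N (fun=> u) (fun=> v) _ _ _ (fun=> s) _.
rewrite !big_ord1 lee_fin => Hs; apply/ltW/Hs => //.
by move=> i j _ _ _; rewrite !ord1.
Qed.

(** Intervals shorter than delta have total variation at most 1, and finitely
    many of them cover the interval from a to b. *)
(** Each total variation is nearly attained along one partition; sharing an
    error eps / 2 among the intervals reduces the claim to
    [abs_continuous_partition]. *)
Lemma abs_continuous_TV_fin h a b : a <= b -> abs_continuous a b h ->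
  (total_variation a b h < +oo)%E.
Proof.
move=> ab ach; have [delta d0 H] := abs_continuous_TV_small ach ltr01.
have step k x : a <= x -> x <= b -> x - a <= k%:R * (delta / 2) ->
    (total_variation a x h < +oo)%E.
  elim: k x => [|k IH] x ax xb.
    rewrite mul0r subr_le0 => xa.
    have -> : x = a by apply: le_anti; rewrite xa ax.
    by rewrite total_variationxx.
  rewrite -natr1 mulrDl mul1r => xk.
  have [xd|xd] := leP (x - delta / 2) a.
    by rewrite (le_lt_trans (H a x _ _ _ _)) ?ltry//; lra.
  rewrite (@total_variationD _ a x (x - delta / 2)); [|lra..].
  rewrite lte_add_pinfty//; first by apply: IH; lra.
  by rewrite (le_lt_trans (H _ x _ _ _ _)) ?ltry//; lra.
apply: (step (Num.bound ((b - a) / (delta / 2)))) => //.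
rewrite -ler_pdivrMr ?divr_gt0//; apply/ltW; rewrite archi_boundP//.
by rewrite divr_ge0 ?subr_ge0// divr_ge0// ltW.
Qed.

(** Each total variation is nearly attained along one partition; sharing an
    error eps / 2 among the intervals reduces the claim to
    [abs_continuous_partition]. *)
Lemma abs_continuous_TV h a b : a <= b -> abs_continuous a b h ->
  abs_continuous a b (fun x => fine (total_variation a x h)).
Proof.
move=> ab ach eps eps0; have e20 : 0 < eps / 2 by rewrite divr_gt0.
have [delta d0 H] := abs_continuous_partition ach e20.
have TVfin u v : a <= u -> u <= v -> v <= b ->
    total_variation u v h \is a fin_num.
  move=> au uv vb; rewrite ge0_fin_numE; last exact: total_variation_ge0.
  apply: le_lt_trans (abs_continuous_TV_fin ab ach).
  rewrite (total_variationD h (le_trans au uv) vb) (total_variationD h au uv).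
  apply: (@le_trans _ _ (total_variation a u h + total_variation u v h)%E).
    by rewrite leeDr// total_variation_ge0.
  by rewrite leeDl// total_variation_ge0.
exists delta => // n u v uv tuv suv.
(* n.+1 shares instead of n, since n may be 0 *)
have n0 : 0 < eps / 2 / n.+1%:R by rewrite divr_gt0.
have /choice[s ps] : forall i, exists s, itv_partition (u i) (v i) s /\
    fine (total_variation (u i) (v i) h) - eps / 2 / n.+1%:R <=
    variation (u i) (v i) h s.
  move=> i; have [aui uivi vib] := uv i.
  have [_ [_ [s ps <-] <-]] := ub_ereal_sup_adherent n0 (TVfin _ _ aui uivi vib).
  rewrite -/(total_variation _ _ _) -[X in (X - _)%E]fineK; last exact: TVfin.
  by rewrite -EFinB lte_fin => /ltW ?; exists s.
have := H n u v uv tuv suv s (fun i => (ps i).1) => Hs.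
apply: (@le_lt_trans _ _
    (\sum_i (variation (u i) (v i) h (s i) + eps / 2 / n.+1%:R))).
  apply: ler_sum => i _; have [aui uivi vib] := uv i.
  rewrite (total_variationD h aui uivi) fineD ?TVfin//; last lra.
  rewrite addrAC subrr add0r ger0_norm; last first.
    by rewrite fine_ge0// total_variation_ge0.
  by rewrite -lerBlDr (ps i).2.
rewrite big_split/= sumr_const card_ord -[X in _ + X]mulr_natr [X in _ < X]splitr.
rewrite ltr_leD// -mulrA ger_pMr// mulrC ler_pdivrMr// mul1r ler_nat.
exact: leqnSn.
Qed.

Lemma abs_continuousZ h a b (c : R) : abs_continuous a b h ->
  abs_continuous a b (fun x => c * h x).
Proof.
move=> H eps eps0; have c0 : 0 < `|c| + 1 by have := normr_ge0 c; lra.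
have [delta d0 Hd] := H _ (divr_gt0 eps0 c0).
exists delta => // n u v uv tuv suv; have := Hd n u v uv tuv suv.
rewrite ltr_pdivlMr//; apply: le_lt_trans.
rewrite mulr_suml ler_sum// => i _; rewrite -mulrBr normrM mulrC.
by rewrite ler_wpM2l// lerDl.
Qed.

Lemma abs_continuousD h k a b : abs_continuous a b h -> abs_continuous a b k ->
  abs_continuous a b (fun x => h x + k x).
Proof.
move=> H K eps eps0; have e20 : 0 < eps / 2 by rewrite divr_gt0.
have [d1 d10 H1] := H _ e20; have [d2 d20 H2] := K _ e20.
exists (Num.min d1 d2) => [|n u v uv tuv]; first by rewrite lt_min d10.
rewrite lt_min => /andP[s1 s2]; rewrite [eps]splitr.
apply: le_lt_trans (ltrD (H1 n u v uv tuv s1) (H2 n u v uv tuv s2)).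
rewrite -big_split/= ler_sum// => i _.
by rewrite opprD addrACA ler_normD.
Qed.

Lemma abs_continuousB h k a b : abs_continuous a b h -> abs_continuous a b k ->
  abs_continuous a b (fun x => h x - k x).
Proof.
move=> H K; have := abs_continuousD H (abs_continuousZ (-1) K).
by under eq_fun do rewrite mulN1r.
Qed.

Lemma abs_continuous_dist h a b (eps : R) : abs_continuous a b h -> 0 < eps ->
  exists2 delta : R, 0 < delta & forall x y, a <= x <= b -> a <= y <= b ->
    `|x - y| < delta -> `|h x - h y| < eps.
Proof.
move=> H eps0; have [delta d0 Hd] := H _ eps0; exists delta => //.
have main x y : x <= y -> a <= x <= b -> a <= y <= b ->
    `|x - y| < delta -> `|h x - h y| < eps.
  move=> xy /andP[ax xb] /andP[ay yb]; rewrite distrC ger0_norm ?subr_ge0// => xyd.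
  have := Hd 1%N (fun=> x) (fun=> y); rewrite !big_ord1 distrC; apply => //.
  by move=> i j _ _ _; rewrite !ord1.
move=> x y xab yab xyd; have [xy|/ltW yx] := leP x y; first exact: main.
by rewrite distrC; apply: main => //; rewrite distrC.
Qed.

Lemma abs_continuous_bounded h a b : a <= b -> abs_continuous a b h ->
  exists M, forall x, a <= x <= b -> `|h x| <= M.
Proof.
move=> ab ach; exists (`|h a| + fine (total_variation a b h)) => x /andP[ax xb].
rewrite -(subrK (h a) (h x)) addrC (le_trans (ler_normD _ _))// lerD2l.
rewrite -lee_fin fineK; last first.
  by rewrite ge0_fin_numE ?total_variation_ge0// abs_continuous_TV_fin.
rewrite (total_variationD h ax xb) (le_trans (total_variation_ge h ax))//.
by rewrite leeDl// total_variation_ge0.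
Qed.

Lemma abs_continuousM h k a b : a <= b ->
  abs_continuous a b h -> abs_continuous a b k ->
  abs_continuous a b (fun x => h x * k x).
Proof.
move=> ab H K eps eps0.
have [M1 HM1] := abs_continuous_bounded ab H.
have [M2 HM2] := abs_continuous_bounded ab K.
pose M := `|M1| + `|M2| + 1.
have M0 : 0 < M by rewrite /M; have := normr_ge0 M1; have := normr_ge0 M2; lra.
have e20 : 0 < eps / 2 / M by rewrite !divr_gt0.
have [d1 d10 H1] := H _ e20; have [d2 d20 H2] := K _ e20.
exists (Num.min d1 d2) => [|n u v uv tuv]; first by rewrite lt_min d10.
rewrite lt_min => /andP[s1 s2].
have := ltrD (H1 n u v uv tuv s1) (H2 n u v uv tuv s2).
have -> : eps / 2 / M + eps / 2 / M = eps / M by field; lra.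
rewrite ltr_pdivlMr//; apply: le_lt_trans.
rewrite -big_split/= mulr_suml ler_sum// => i _; have [aui uivi vib] := uv i.
have -> : h (v i) * k (v i) - h (u i) * k (u i) =
  (h (v i) - h (u i)) * k (v i) + h (u i) * (k (v i) - k (u i)) by ring.
rewrite (le_trans (ler_normD _ _))// !normrM mulrDl lerD//.
  rewrite ler_wpM2l// (le_trans (HM2 _ _)); last by rewrite /M; have := ler_norm M2; have := normr_ge0 M1; lra.
    by [].
  by apply/andP; split; lra.
rewrite mulrC ler_wpM2l// (le_trans (HM1 _ _)); last by rewrite /M; have := ler_norm M1; have := normr_ge0 M2; lra.
  by [].
by apply/andP; split; lra.
Qed.

End AbsCont.

(** * The fundamental theorem of calculus for absolutely continuous functions *)

Section Density.
Variable R : realType.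
Implicit Types (h : R -> R) (a b : R).
Local Notation mu := (@lebesgue_measure R).

(** Absolute continuity is tested on disjoint intervals, whereas the covers
    that define an outer measure may overlap: a finite union of half-open
    intervals is here a disjoint one, the same for all measures. *)
Lemma ocitv_bigsetU (A : nat -> set R) N : (forall k, ocitv (A k)) ->
  exists (I : finType) (u v : I -> R),
  [/\ forall i, u i < v i, trivIset setT (fun i => `]u i, v i]%classic) &
    forall nu : {measure set (measurableTypeR R) -> \bar R},
      nu (\big[setU/set0]_(k < N) A k) = (\sum_i nu `]u i, v i]%classic)%E].
Proof.
move=> Ao; pose X : set (ocitv_type R) := \big[setU/set0]_(k < N) A k.
have mX : R.-ocitv.-ring.-measurable X.
  rewrite /X; apply: (@bigsetU_measurable _ (SetRing.type (ocitv_type R))).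
  by move=> k _; apply: SetRing.measurable_subring; exact: Ao.
have [B [finB Bn0 tB mB XB]] := SetRing.ring_finite_set mX.
pose S := fset_set B.
have SB : [set` S] = B by exact: fset_setK.
have BS (i : S) : B (val i) by rewrite -SB /=; exact: valP.
have /choice[w Hw] : forall i : S, exists w : R * R, w.1 < w.2 /\ val i = `]w.1, w.2]%classic.
  move=> i; have := mB _ (mem_set (BS i)) => /ocitvP[i0|[w w12 iw]].
    by have /set0P := Bn0 _ (BS i); rewrite i0 eqxx.
  by exists w.
exists S, (fun i => (w i).1), (fun i => (w i).2); split=> [i|i j _ _ [z [zi zj]]|nu].
- by have [] := Hw i.
- apply: val_inj; apply: tB => //; exists z.
  by split; [rewrite (Hw i).2|rewrite (Hw j).2].
- rewrite -/X XB (_ : \bigcup_(i in B) i = \bigcup_(i in [set` S]) i); last by rewrite SB.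
  rewrite bigcup_fset measure_fbigsetU; last 2 first.
  + move=> i iS; have := mB i; rewrite inE -SB => /(_ iS) /ocitvP[->//|[y y12 ->]].
    exact: measurable_itv.
  + by rewrite SB.
  by rewrite big_seq_fsetE/=; apply: eq_bigr => i _; rewrite (Hw i).2.
Qed.

Lemma lebesgue_stieltjes_ocitv (F : cumulative R R) (A : set R) : ocitv A ->
  lebesgue_stieltjes_measure F A = wlength F A.
Proof. by move=> oA; exact: (@measurable_mu_extE _ _ _ (wlength F)). Qed.

(** A null set is covered by half-open intervals of total length less than
    delta. By absolute continuity the F-measure of each finite subunion is at
    most eps, and by continuity from below so is that of the whole cover. *)
Lemma lebesgue_stieltjes_dominated (F : cumulative R R) :
  (forall eps : R, 0 < eps -> exists2 delta : R, 0 < delta &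
    forall (I : finType) (u v : I -> R), (forall i, u i <= v i) ->
      trivIset setT (fun i => `]u i, v i[%classic) ->
      \sum_i (v i - u i) < delta -> \sum_i (F (v i) - F (u i)) < eps) ->
  lebesgue_stieltjes_measure F `<< mu.
Proof.
move=> HF; apply/null_content_dominatesP => A mA A0.
apply/eqP; rewrite -measure_le0; apply/lee_addgt0Pr => eps eps0; rewrite add0e.
have [delta d0 Hd] := HF _ eps0.
have [C [mC AC sumC]] : exists C : (set (ocitv_type R))^nat,
    [/\ forall k, ocitv (C k), A `<=` \bigcup_k C k &
    (\sum_(k <oo) wlength idfun (C k) < delta%:E)%E].
  have /ereal_inf_lt[_ [C AC <-]] : (mu A < delta%:E)%E by rewrite A0 lte_fin.
  by move=> Cd; exists C; case: AC.
pose X N := \big[setU/set0]_(k < N) C k.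
have mCk k : measurable (C k : set (measurableTypeR R)).
  by have /ocitvP[->//|[w _ ->]] := mC k; exact: measurable_itv.
have mX N : measurable (X N : set (measurableTypeR R)).
  exact: bigsetU_measurable.
have XE : \bigcup_N X N.+1 = \bigcup_k C k.
  exact: bigcup_bigsetU_bigcup.
have Xle N : (lebesgue_stieltjes_measure F (X N) <= eps%:E)%E.
  have [I [u [v [uv tuv nuE]]]] := ocitv_bigsetU N mC.
  have FE (G : cumulative R R) : lebesgue_stieltjes_measure G (X N) =
      (\sum_i (G (v i) - G (u i)))%:E.
    rewrite nuE -sumEFin; apply: eq_bigr => i _.
    transitivity (wlength G `]u i, v i]).
      exact/lebesgue_stieltjes_ocitv/is_ocitv.
    by rewrite wlength_itv_bnd ?ltW.
  rewrite FE lee_fin; apply/ltW/Hd => [i||]; first exact: ltW.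
    by move=> i j _ _ [z [zi zj]]; apply: tuv => //; exists z; split; exact: subset_itv_oo_oc.
  have := FE idfun; rewrite -lte_fin /= => <-.
  apply: le_lt_trans sumC.
  apply: (le_trans (Boole_inequality _ (fun k _ => mCk k))).
  rewrite -(big_mkord xpredT (fun k => lebesgue_stieltjes_measure idfun (C k))).
  rewrite (eq_bigr (fun k => wlength idfun (C k))) => [|k _]; last first.
    exact: lebesgue_stieltjes_ocitv.
  exact: nneseries_lim_ge.
apply: (@le_trans _ _ (lebesgue_stieltjes_measure F (\bigcup_N X N.+1))).
  by rewrite le_measure ?inE//; [exact: bigcup_measurable|rewrite XE].
have cvX := @nondecreasing_cvg_mu _ _ _ (lebesgue_stieltjes_measure F)
  (fun N => X N.+1) (fun N => mX N.+1) (bigcup_measurable (fun k _ => mX k.+1)) _.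
rewrite -(cvg_lim _ (cvX _))//.
  apply: lime_le.
    by apply/cvg_ex; eexists; apply: cvX => m n mn; apply/subsetPset; exact: subset_bigsetU.
  apply: nearW => N; exact: Xle.
by move=> m n mn; apply/subsetPset; exact: subset_bigsetU.
Qed.
(** Composing with x |-> max a (min x b) extends a function from the interval
    between a and b to the whole line, constantly outside. This map is
    nondecreasing and 1-Lipschitz, so monotonicity and absolute continuity
    survive the extension. *)
Lemma clip_bounds a b (x : R) : a <= b -> a <= Num.max a (Num.min x b) <= b.
Proof. by move=> ab; rewrite le_max lexx ge_max ab ge_min lexx orbT. Qed.

Lemma clip_id a b (x : R) : a <= x <= b -> Num.max a (Num.min x b) = x.
Proof. by move=> /andP[ax xb]; rewrite min_l// max_r. Qed.

Lemma le_clip a b (x y : R) : x <= y ->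
  Num.max a (Num.min x b) <= Num.max a (Num.min y b).
Proof. by move=> xy; rewrite le_max2// le_min2. Qed.

Lemma clip_lip a b (x y : R) : x <= y ->
  Num.max a (Num.min y b) - Num.max a (Num.min x b) <= y - x.
Proof.
move=> xy; rewrite /Num.max /Num.min; repeat case: ifPn; rewrite -?leNgt; lra.
Qed.

(** Absolute continuity makes the Lebesgue-Stieltjes measure of h dominated by
    the Lebesgue measure; rho is its Radon-Nikodym density. *)
Lemma nondecreasing_abs_continuous_density h a b : a <= b ->
  {in `[a, b] &, nondecreasing_fun h} -> abs_continuous a b h ->
  exists2 rho : R -> R, mu.-integrable setT (EFin \o rho) &
    forall x, a <= x <= b -> h x - h a = \int[mu]_(t in `]a, x]) rho t.
Proof.
move=> ab ndh ach; pose F (x : R) := h (Num.max a (Num.min x b)).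
have inab x : Num.max a (Num.min x b) \in `[a, b].
  by rewrite in_itv/=; exact: clip_bounds.
have ndF : {homo F : x y / x <= y} by move=> x y xy; apply: ndh => //; exact: le_clip.
have acF eps : 0 < eps -> exists2 delta : R, 0 < delta &
    forall (I : finType) (u v : I -> R), (forall i, u i <= v i) ->
      trivIset setT (fun i => `]u i, v i[%classic) ->
      \sum_i (v i - u i) < delta -> \sum_i (F (v i) - F (u i)) < eps.
  move=> eps0; have [delta d0 Hd] := abs_continuous_fin ach eps0.
  exists delta => // I u v uv tuv suv.
  apply: le_lt_trans (Hd I (fun i => Num.max a (Num.min (u i) b))
      (fun i => Num.max a (Num.min (v i) b)) _ _ _).
  - by apply: ler_sum => i _; exact: ler_norm.
  - move=> i; split; last 1 first.
    + by have /andP[] := clip_bounds (v i) ab.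
    + by have /andP[] := clip_bounds (u i) ab.
    + exact: le_clip.
  - move=> i j _ _ [z [/= zi zj]]; apply: tuv => //; exists z; split => /=.
    + move: zi; rewrite !in_itv/= => /andP[]; rewrite gt_max => /andP[az].
      by rewrite gt_min lt_max lt_min (lt_gtF az)/= => /orP[->/andP[->]//|bz /andP[_]]; rewrite (lt_gtF bz).
    + move: zj; rewrite !in_itv/= => /andP[]; rewrite gt_max => /andP[az].
      by rewrite gt_min lt_max lt_min (lt_gtF az)/= => /orP[->/andP[->]//|bz /andP[_]]; rewrite (lt_gtF bz).
  - by apply: le_lt_trans suv; apply: ler_sum => i _; exact: clip_lip.
have cF : continuous F.
  move=> x; apply/cvgrPdist_lt => e e0.
  have [d d0 Hd] := abs_continuous_dist ach e0.
  near=> y; apply: Hd; [exact: clip_bounds|exact: clip_bounds|].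
  apply: (@le_lt_trans _ _ `|x - y|); last by near: y; exact: cvgr_dist_lt.
  have [xy|/ltW yx] := leP x y.
    by rewrite distrC [leRHS]distrC !ger0_norm ?subr_ge0 ?le_clip//; exact: clip_lip.
  by rewrite !ger0_norm ?subr_ge0 ?le_clip//; exact: clip_lip.
have rcF : right_continuous F by exact: right_continuousW.
pose C := isCumulative.Build R _ R F ndF rcF.
pose G : cumulative R R := HB.pack F C.
have dom : lebesgue_stieltjes_measure G `<< mu.
  exact: lebesgue_stieltjes_dominated.
have nuE x y : x <= y -> lebesgue_stieltjes_measure G `]x, y] = (F y - F x)%:E.
  move=> xy; transitivity (wlength G `]x, y]).
    exact/lebesgue_stieltjes_ocitv/is_ocitv.
  by rewrite wlength_itv_bnd.
have mab : measurable (`]a, b]%classic : set (measurableTypeR R)) by exact: measurable_itv.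
have nufin : (lebesgue_stieltjes_measure G `]a, b] < +oo)%E by rewrite nuE// ltry.
(* the restriction to ]a, b] is a finite measure *)
pose nu := mfrestr mab nufin.
have domnu : nu `<< mu.
  apply/null_content_dominatesP => A mA A0.
  have /null_content_dominatesP domG := dom.
  apply/eqP; rewrite /nu/= /mfrestr/= /mrestr/= -measure_le0 -(domG _ mA A0).
  by rewrite le_measure ?inE//; exact: measurableI.
have [f [f0 ffin intf nuf]] := radon_nikodym_sigma_finite domnu.
have intff : mu.-integrable setT (EFin \o (fine \o f)).
  by apply: eq_integrable intf => // x _ /=; rewrite fineK.
exists (fine \o f) => // x /andP[ax xb].
rewrite /Rintegral; have /= -> : (\int[mu]_(t in `]a, x]) (fine (f t))%:E = nu `]a, x]%classic)%E.
  rewrite [RHS](nuf `]a, x]%classic); last exact: measurable_itv.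
  by apply: eq_integral => t _; rewrite fineK.
rewrite /nu/= /mfrestr/= /mrestr/= setIidl ?nuE//=; last exact: subset_itvl.
by rewrite /F !clip_id ?ax ?xb ?lexx ?ab.
Unshelve. all: by end_near. Qed.

(** Jordan decomposition: h = T - (T - h), where the total variation T and
    T - h are nondecreasing, and absolutely continuous by [abs_continuous_TV]. *)
Lemma abs_continuous_density h a b : a <= b -> abs_continuous a b h ->
  exists2 rho : R -> R, mu.-integrable setT (EFin \o rho) &
    forall x, a <= x <= b -> h x - h a = \int[mu]_(t in `]a, x]) rho t.
Proof.
move=> ab ach; pose T x := fine (total_variation a x h).
have acT : abs_continuous a b T by exact: abs_continuous_TV.
have TVfin u v : a <= u -> u <= v -> v <= b ->
    total_variation u v h \is a fin_num.
  move=> au uv vb; rewrite ge0_fin_numE; last exact: total_variation_ge0.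
  exact: (abs_continuous_TV_fin uv (abs_continuousW au vb ach)).
have TD x y : a <= x -> x <= y -> y <= b -> `|h y - h x| <= T y - T x.
  move=> ax xy yb; rewrite /T (total_variationD h ax xy) fineD ?TVfin//; last lra.
  by rewrite addrAC subrr add0r -lee_fin fineK ?TVfin// total_variation_ge.
have [r1 i1 H1] : exists2 rho : R -> R, mu.-integrable setT (EFin \o rho) &
    forall x, a <= x <= b -> T x - T a = \int[mu]_(t in `]a, x]) rho t.
  apply: nondecreasing_abs_continuous_density => // x y.
  rewrite !in_itv/= => /andP[ax xb] /andP[ay yb] xy.
  by rewrite -subr_ge0 (le_trans _ (TD _ _ ax xy yb)).
have [r2 i2 H2] : exists2 rho : R -> R, mu.-integrable setT (EFin \o rho) &
    forall x, a <= x <= b -> (T x - h x) - (T a - h a) = \int[mu]_(t in `]a, x]) rho t.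
  apply: (@nondecreasing_abs_continuous_density (fun x => T x - h x)) => //; last exact: abs_continuousB.
  move=> x y; rewrite !in_itv/= => /andP[ax xb] /andP[ay yb] xy.
  have := TD _ _ ax xy yb; have := ler_norm (h y - h x); lra.
have intS f x : mu.-integrable setT (EFin \o f) -> mu.-integrable `]a, x] (EFin \o f).
  by apply: integrableS => //.
exists (fun x => r1 x - r2 x) => [|x xab].
  by have := integrableB measurableT i1 i2; apply: eq_integrable => // x _ /=.
rewrite RintegralB//; [|exact: intS..].
by rewrite -H1// -H2//; lra.
Qed.

(** By Lebesgue's differentiation theorem the density of
    [abs_continuous_density] is the derivative almost everywhere. *)
Lemma abs_continuous_FTC h a b : a <= b -> abs_continuous a b h ->
  exists rho : R -> R, [/\ mu.-integrable setT (EFin \o rho),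
    forall x y, a <= x -> x <= y -> y <= b ->
      h y - h x = \int[mu]_(t in `]x, y]) rho t &
    {ae mu, forall x, a < x < b -> derivable h x 1 /\ derive1 h x = rho x}].
Proof.
move=> ab ach; have [rho irho Hrho] := abs_continuous_density ab ach.
have intS (A : set R) : measurable A -> mu.-integrable A (EFin \o rho).
  by move=> mA; exact: integrableS irho.
exists rho; split => // [x y ax xy yb|].
  have := @Rintegral_itvB _ rho (BRight a) (BRight y) x (intS _ (measurable_itv _)).
  move=> <-//; rewrite -!Hrho; lra.
have loc : locally_integrable [set: R] rho.
  by apply: open_integrable_locally => //; exact: openT.
have := @FTC1 _ rho (BRight a) (fun y => intS _ (measurable_itv _)) loc.
apply: (@filterS _ _ (ae_filter_ringOfSetsType mu)) => x H /andP[ax xb].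
have [dF F'] := H ax.
have near_eq : {near x, (fun y => \int[mu]_(t in `]a, y]) rho t + h a) =1 h}.
  near=> y; rewrite -Hrho; first by rewrite subrK.
  apply/andP; split; apply/ltW; near: y; [exact: lt_nbhsr|exact: lt_nbhsl].
have dFh : derivable (fun y => \int[mu]_(t in `]a, y]) rho t + h a) x 1.
  exact: derivableD.
split.
  exact: near_eq_derivable dFh.
rewrite -F' !derive1E; have <- := near_eq_derive _ near_eq.
rewrite deriveD//= derive_cst addr0//.
Unshelve. all: by end_near. Qed.

End Density.

(** * Calculus and integration on the line *)

Section Tools.
Variable R : realType.
Implicit Types (h : R -> R) (a b : R).
Local Notation mu := (@lebesgue_measure R).

Lemma open_itv_cc (D : set R) x : open D -> D x ->
  exists a b, [/\ a < x, x < b & `[a, b] `<=` D].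
Proof.
move=> oD Dx; have /nbhs_ballP[e /= e0 eD] : nbhs x D by exact: open_nbhs_nbhs.
exists (x - e / 2), (x + e / 2); split; [lra|lra|].
move=> y /=; rewrite in_itv/= => /andP[y1 y2]; apply: eD.
by rewrite /ball/= ltr_distlC; apply/andP; split; lra.
Qed.

Lemma abs_continuous_loc_continuous (D : set R) h : open D ->
  (forall a b, `[a, b]%classic `<=` D -> abs_continuous a b h) ->
  forall x, D x -> {for x, continuous h}.
Proof.
move=> oD ach x Dx; have [a [b [ax xb abD]]] := open_itv_cc oD Dx.
apply/cvgrPdist_lt => e e0.
have [d d0 Hd] := abs_continuous_dist (ach _ _ abD) e0.
near=> y; apply: Hd.
- by apply/andP; split; apply/ltW.
- by apply/andP; split; apply/ltW; near: y; [exact: lt_nbhsr|exact: lt_nbhsl].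
- by near: y; exact: cvgr_dist_lt.
Unshelve. all: by end_near. Qed.

Lemma continuous_integrable_cc (D : set R) h a b :
  (forall x, D x -> {for x, continuous h}) -> `[a, b]%classic `<=` D ->
  mu.-integrable `[a, b] (EFin \o h).
Proof.
move=> ch abD; apply: continuous_compact_integrable; first exact: segment_compact.
by apply: continuous_in_subspaceT => x /set_mem xab; apply: ch; exact: abD.
Qed.

Lemma continuous_measurable_on (D : set R) h : open D ->
  (forall x, D x -> {for x, continuous h}) -> measurable_fun D h.
Proof.
move=> oD ch; apply: open_continuous_measurable_fun => //.
by move=> x /set_mem; exact: ch.
Qed.

(** Absolute continuity yields differentiability almost everywhere only. Here h
    is moreover the integral of [derive1 h], which is continuous, and so h is
    differentiable everywhere. *)
Lemma abs_continuous_loc_derive (D : set R) h : open D ->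
  (forall a b, `[a, b]%classic `<=` D -> abs_continuous a b h) ->
  (forall a b, `[a, b]%classic `<=` D -> abs_continuous a b (derive1 h)) ->
  forall x, D x -> is_derive x (1 : R) h (derive1 h x).
Proof.
move=> oD ach ach' x Dx; have [a [b [ax xb abD]]] := open_itv_cc oD Dx.
have cd := abs_continuous_loc_continuous oD ach'.
have ab : a <= b by lra.
have [rho [irho Hrho aerho]] := abs_continuous_FTC ab (ach _ _ abD).
have icc := continuous_integrable_cc cd abD.
have ioc y : y <= b -> mu.-integrable `]a, y] (EFin \o derive1 h).
  move=> yb; apply: integrableS icc => // z/=; rewrite !in_itv/= => /andP[az zy].
  by rewrite (ltW az) (le_trans zy).
have Fh y : a < y -> y < b -> \int[mu]_(t in `]a, y]) derive1 h t + h a = h y.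
  move=> ay yb; rewrite -(subrK (h a) (h y)) (Hrho a y) ?lexx ?ltW//; congr (_ + _).
  rewrite /Rintegral; congr fine; apply: ae_eq_integral => //.
  - by case/integrableP : (ioc y (ltW yb)).
  - have : mu.-integrable `]a, y] (EFin \o rho) by exact: integrableS irho.
    by case/integrableP.
  - apply: (@filterS _ _ (ae_filter_ringOfSetsType mu) _ _ _ aerho) => z H /=.
    rewrite in_itv/= => /andP[az zy]; congr EFin.
    by have [|_ ->] := H; first by rewrite az (le_lt_trans zy).
have ax' : (BRight a < BRight x)%O by rewrite bnd_simp.
have [dF F'] := @continuous_FTC1 _ (derive1 h) (BRight a) x b xb (ioc b (lexx _)) ax' (cd _ Dx).
have near_eq : \near x, (\int[mu]_(t in `]a, x]) derive1 h t + h a) = h x.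
  by near=> y; apply: Fh; near: y; [exact: lt_nbhsr|exact: lt_nbhsl].
apply: near_eq_is_derive near_eq _.
have : is_derive x (1 : R) (fun y => \int[mu]_(t in `]a, y]) derive1 h t) (derive1 h x).
  by rewrite -F' derive1E; exact: DeriveDef.
by move=> dd; rewrite -[X in is_derive _ _ _ X]addr0; apply: is_deriveD.
Unshelve. all: by end_near. Qed.

Lemma derive_FTC (D : set R) h h' a b : open D ->
  (forall x, D x -> is_derive x (1 : R) h (h' x)) ->
  (forall x, D x -> {for x, continuous h'}) -> a < b -> `[a, b]%classic `<=` D ->
  h b - h a = \int[mu]_(t in `]a, b]) h' t.
Proof.
move=> oD dh ch' ab abD.
have ch x : D x -> {for x, continuous h}.
  move=> Dx; apply: differentiable_continuous; apply/derivable1_diffP.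
  by have [] := dh x Dx.
have Da : D a by apply: abD; rewrite /= in_itv/= lexx ltW.
have Db : D b by apply: abD; rewrite /= in_itv/= lexx ltW.
rewrite /Rintegral integral_itv_obnd_cbnd; last first.
  apply/measurable_EFinP; apply: measurable_funS (continuous_measurable_on oD ch') => //.
    exact: open_measurable.
  by apply: subset_trans abD; exact: subset_itv_oc_cc.
rewrite (@continuous_FTC2 _ h' h)//.
- apply: continuous_in_subspaceT => x /set_mem xab; apply: ch'; exact: abD.
- split.
  + move=> x xab; have Dx : D x by apply: abD; apply: subset_itv_oo_cc.
    by have [] := dh x Dx.
  + exact/cvg_at_right_filter/ch.
  + exact/cvg_at_left_filter/ch.
- move=> x xab; have Dx : D x by apply: abD; apply: subset_itv_oo_cc.
  by rewrite derive1E; have [_ ->] := dh x Dx.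
Qed.

End Tools.

Section RealIntegral.
Context d (T : measurableType d) (R : realType) (mu : {measure set T -> \bar R}).

(** Cauchy-Schwarz against the constant 1, from the nonnegativity of the
    integral of (L f - I)^2, where I is the integral of f. *)
Lemma Rintegral_sqr_le (A : set T) (L : R) (f : T -> R) :
  measurable A -> mu A = L%:E -> 0 < L -> mu.-integrable A (EFin \o f) ->
  mu.-integrable A (EFin \o (fun x => f x ^+ 2)) ->
  (\int[mu]_(x in A) f x) ^+ 2 <= L * \int[mu]_(x in A) (f x ^+ 2).
Proof.
move=> mA muA L0 if_ if2; set I := \int[mu]_(x in A) f x.
set J := \int[mu]_(x in A) (f x ^+ 2).
have ic c : mu.-integrable A (EFin \o cst c).
  apply: measurable_bounded_integrable => //.
    by rewrite muA ltry.
  by exists `|c|; split => // M cM x _ /=; exact: ltW.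
have iZ c g : mu.-integrable A (EFin \o g) -> mu.-integrable A (EFin \o (fun x => c * g x)).
  by move=> ig; have := integrableZl mA c ig; apply: eq_integrable.
have : 0 <= \int[mu]_(x in A) (L ^+ 2 * f x ^+ 2 + ((- (2 * L * I)) * f x + I ^+ 2)).
  apply: Rintegral_ge0 => x _.
  rewrite (_ : _ + _ = (L * f x - I) ^+ 2) ?sqr_ge0//; ring.
rewrite RintegralD//; [|exact: iZ|]; last first.
  by have := integrableD mA (iZ (- (2 * L * I)) _ if_) (ic (I ^+ 2)); apply: eq_integrable.
rewrite RintegralD//; [|exact: iZ|exact: ic].
have -> : \int[mu]_(x in A) (I ^+ 2) = I ^+ 2 * L.
  by rewrite Rintegral_cst// muA.
rewrite !RintegralZl// -/I -/J => H.
have : 0 <= L * (L * J - I ^+ 2) by move: H; congr (_ <= _); ring.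
by rewrite pmulr_rge0// subr_ge0.
Qed.

Lemma dominated_integrable (D : set T) (f g : T -> R) : measurable D ->
  measurable_fun D f -> (forall x, D x -> `|f x| <= g x) ->
  mu.-integrable D (EFin \o g) -> mu.-integrable D (EFin \o f).
Proof.
move=> mD mf fg ig; apply: (le_integrable _ _ _ ig) => //.
  exact/measurable_EFinP.
by move=> x Dx /=; rewrite lee_fin (le_trans (fg x Dx))// ler_norm.
Qed.

Lemma Rintegral_subset (A B : set T) (f : T -> R) : measurable A ->
  measurable B -> A `<=` B -> mu.-integrable B (EFin \o f) ->
  (forall x, B x -> 0 <= f x) ->
  \int[mu]_(x in A) f x <= \int[mu]_(x in B) f x.
Proof.
move=> mA mB AB iB f0; have iA : mu.-integrable A (EFin \o f) by exact: integrableS iB.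
apply: fine_le; [exact: integrable_fin_num|exact: integrable_fin_num|].
apply: ge0_subset_integral => //; first by case/integrableP: iB.
Qed.

Lemma Rintegral_setD (A B : set T) (f : T -> R) : measurable A ->
  measurable B -> A `<=` B -> mu.-integrable B (EFin \o f) ->
  \int[mu]_(x in B) f x = \int[mu]_(x in A) f x + \int[mu]_(x in B `\` A) f x.
Proof.
move=> mA mB AB iB; rewrite -[in LHS](setDUK AB) Rintegral_setU//.
- exact: measurableD.
- by rewrite setDUK.
- exact/disj_set2P/setDIK.
Qed.

(** Dominated convergence for |F| restricted to the complement of A n, which
    vanishes eventually at each point. *)
Lemma integrable_tail (D : set T) (F : T -> R) (A : nat -> set T) (eps : R) :
  measurable D -> mu.-integrable D (EFin \o F) ->
  (forall n, measurable (A n)) ->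
  (forall x, D x -> \forall n \near \oo, A n x) -> 0 < eps ->
  \forall n \near \oo, \int[mu]_(x in D `\` A n) `|F x| <= eps.
Proof.
move=> mD iF mA DA eps0.
pose g n := (EFin \o (fun x => `|F x|)) \_ (~` A n).
have mF : measurable_fun D (EFin \o (fun x => `|F x|)).
  by apply/measurable_EFinP/measurableT_comp => //; apply/measurable_EFinP; case/integrableP: iF.
have mg n : measurable_fun D (g n).
  apply/measurable_restrict => //; first exact: measurableC.
  by apply: measurable_funS mF => //; exact: subIsetl.
have ig : mu.-integrable D (EFin \o (fun x => `|F x|)).
  by have := integrable_abse iF; apply: eq_integrable.
have gbd n x : (`|g n x| <= (EFin \o (fun x => `|F x|%R)) x)%E.
  by rewrite /g patchE; case: ifPn => _ /=; rewrite ?normr_id ?normr0 lee_fin.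
have g0 : \forall x \ae mu, D x -> g x0 x @[x0 --> \oo] --> cst 0%E x.
  apply: aeW => x Dx; apply: cvg_near_cst; apply: filterS (DA x Dx) => n Anx.
  by rewrite /g patchE memNset//=; exact.
have [_ _ cv] := @dominated_convergence _ _ _ mu D mD g (cst 0%E) _ mg
  (measurable_cst _) g0 ig (aeW _ (fun x n _ => gbd n x)).
rewrite integral0 in cv.
move: cv => /fine_cvgP[_ /cvgr0_norm_le] /(_ eps eps0).
apply: filterS => n /=.
rewrite /g -integral_mkcondr -setDE => H; apply: le_trans H.
by rewrite /Rintegral ler_norm.
Qed.

End RealIntegral.

(** * The energy inequality for functions vanishing at 0 *)

(** The arithmetic of [P_bounded]: p is the Dirichlet energy and s the
    potential term, the part sa2 of which is absorbed in half of p. *)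
Lemma absorb_half (R : realType) (p g s sa sa1 sa2 c Ga e : R) : p + s - g = e -> e <= 1 ->
  g <= Ga -> - s <= sa -> sa1 <= c -> sa2 <= p * (1 / 2) -> sa = sa1 + sa2 ->
  p <= 2 * (1 + Ga + c).
Proof. lra. Qed.

Section Energy.
Variable R : realType.
Local Notation mu := (@lebesgue_measure R).

Lemma abs_continuous_sum (I : Type) (s : seq I) (h : I -> R -> R) a b :
  (forall i, abs_continuous a b (h i)) ->
  abs_continuous a b (fun x => \sum_(i <- s) h i x).
Proof.
move=> ach; elim: s => [|i s IH].
  move=> e e0; exists 1 => // n u v _ _ _.
  by rewrite big1// => j _; rewrite !big_nil subrr normr0.
by under eq_fun do rewrite big_cons; exact: (abs_continuousD (ach i) IH).
Qed.

Lemma is_derive_fun_sum (I : Type) (s : seq I) (h h' : I -> R -> R) (x : R) :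
  (forall i, is_derive x (1 : R) (h i) (h' i x)) ->
  is_derive x (1 : R) (fun y => \sum_(i <- s) h i y) (\sum_(i <- s) h' i x).
Proof.
move=> dh; elim: s => [|i s IH].
  by rewrite big_nil; under eq_fun do rewrite big_nil; exact: is_derive_cst.
by rewrite big_cons; under eq_fun do rewrite big_cons; exact: is_deriveD (dh i) IH.
Qed.

Lemma cvg_fun_sum (I : Type) (s : seq I) (h : I -> R -> R) (l : I -> R)
    (F : set_system R) : Filter F ->
  (forall i, h i x @[x --> F] --> l i) ->
  \sum_(i <- s) h i x @[x --> F] --> \sum_(i <- s) l i.
Proof.
move=> FF ch; elim: s => [|i s IH].
  by rewrite big_nil; under eq_fun do rewrite big_nil; exact: cvg_cst.
by rewrite big_cons; under eq_fun do rewrite big_cons; exact: cvgD.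
Qed.

Lemma continuous_fun_sum (I : Type) (s : seq I) (h : I -> R -> R) (x : R) :
  (forall i, {for x, continuous (h i)}) ->
  {for x, continuous (fun y => \sum_(i <- s) h i y)}.
Proof. by move=> ch; exact: (@cvg_fun_sum _ s h (h ^~ x) (nbhs x)). Qed.

Variables (D : set R) (B : nat -> R).
Hypotheses (oD : open D) (D_gt0 : forall x, D x -> 0 < x)
  (D_down : forall x y, D x -> 0 < y -> y <= x -> D y)
  (DB : forall n, D (B n)) (ndB : {homo B : n p / (n <= p)%N >-> n <= p})
  (D_le_B : forall x, D x -> \forall n \near \oo, x <= B n).

Let mD : measurable (D : set (measurableTypeR R)).
Proof. exact: open_measurable. Qed.

Let moc a b : measurable (`]a, b]%classic : set (measurableTypeR R)).
Proof. exact: measurable_itv. Qed.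

Lemma edge_cc a b : 0 < a -> D b -> `[a, b]%classic `<=` D.
Proof.
move=> a0 Db x /=; rewrite in_itv/= => /andP[ax xb].
by apply: (D_down Db) => //; exact: lt_le_trans ax.
Qed.

Lemma edge_oc b : D b -> `]0, b]%classic `<=` D.
Proof.
by move=> Db x /=; rewrite in_itv/= => /andP[x0 xb]; exact: (D_down Db).
Qed.

(* D is ]0, L[ with L finite or not, exhausted from the left by the ]0, B n].
   The phi k and the pi k are the real coordinates of a vector-valued function
   f and of f'; sigma and gamma stand for Re <Q f, f> and Re <g, f>, where
   g = - f'' + Q f, and W dominates Q. By flux_le the flux q = Re <f', f> is
   small, at least from above, at points arbitrarily close to L. *)
Variables (K : finType) (phi pi : K -> R -> R) (sigma gamma W : R -> R).
Hypotheses
  (dphi : forall k x, D x -> is_derive x (1 : R) (phi k) (pi k x))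
  (acphi : forall k a b, `[a, b]%classic `<=` D -> abs_continuous a b (phi k))
  (acpi : forall k a b, `[a, b]%classic `<=` D -> abs_continuous a b (pi k))
  (dpi : {ae mu, forall x, D x -> (forall k, derivable (pi k) x 1) ->
     \sum_k derive1 (pi k) x * phi k x = sigma x - gamma x})
  (igamma : mu.-integrable D (EFin \o gamma))
  (msigma : measurable_fun D sigma)
  (sigma_le : forall x, D x -> `|sigma x| <= W x * \sum_k phi k x ^+ 2)
  (W_ge0 : forall x, D x -> 0 <= W x)
  (iW : mu.-integrable D (EFin \o (fun x => x * W x)))
  (phi0 : forall k, phi k x @[x --> (0:R)^'+] --> (0 : R))
  (pi0 : forall k, exists l : R, pi k x @[x --> (0:R)^'+] --> l)
  (flux_le : forall X eps : R, D X -> 0 < eps -> exists b,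
     [/\ D b, X <= b & \sum_k phi k b * pi k b <= eps]).

Let S x := \sum_k pi k x ^+ 2.
Let q x := \sum_k phi k x * pi k x.
Let P x := \int[mu]_(t in `]0, x]) S t.

Lemma pi_continuous k x : D x -> {for x, continuous (pi k)}.
Proof. exact: (abs_continuous_loc_continuous oD (@acpi k)). Qed.

Lemma sqr_pi_continuous k x : D x -> {for x, continuous (fun y => pi k y ^+ 2)}.
Proof. by move=> Dx; apply: continuousM; exact: pi_continuous. Qed.

Lemma S_continuous x : D x -> {for x, continuous S}.
Proof. by move=> Dx; apply: continuous_fun_sum => k; exact: sqr_pi_continuous. Qed.

Lemma S_ge0 x : 0 <= S x.
Proof. by apply: sumr_ge0 => k _; exact: sqr_ge0. Qed.

(** Near 0 because f' has a limit there, elsewhere by continuity. *)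
Lemma pi_bounded k b : D b -> exists M, forall x, 0 < x -> x <= b -> `|pi k x| <= M.
Proof.
move=> Db; have [l pil] := pi0 k.
have : \forall x \near (0:R)^'+, `|l - pi k x| < 1 by exact: cvgr_dist_lt.
move=> [d /= d0 Hd].
pose c := Num.min (d / 2) b.
have c0 : 0 < c by rewrite lt_min divr_gt0//=; exact: D_gt0.
have [|M HM] := abs_continuous_bounded _ (acpi k (edge_cc c0 Db)).
  by rewrite ge_min lexx orbT.
exists (Num.max M (`|l| + 1)) => x x0 xb; rewrite le_max.
have [cx|xc] := leP c x; first by rewrite HM// cx.
apply/orP; right; have := Hd x _ x0.
rewrite /ball/= sub0r normrN gtr0_norm// => H.
have {}H : `|l - pi k x| < 1.
  by apply: H; apply: (lt_le_trans xc); rewrite ge_min; apply/orP; left; lra.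
have := ler_distD l (pi k x) 0; rewrite !subr0 distrC; lra.
Qed.

Lemma integrable_sqr_pi k b : D b -> mu.-integrable `]0, b] (EFin \o (fun x => pi k x ^+ 2)).
Proof.
move=> Db; have mufin : (mu `]0%R, b]%classic < +oo)%E.
  by rewrite lebesgue_measure_itv/=; case: ifPn => _; rewrite ?ltry// -EFinB ltry.
apply: measurable_bounded_integrable.
- exact: measurable_itv.
- exact: mufin.
- have mm : measurable_fun (`]0, b]%classic : set R) (fun x => pi k x ^+ 2).
    apply: measurable_funS (continuous_measurable_on oD (@sqr_pi_continuous k)) => //.
    exact: edge_oc.
  exact: mm.
- have [M HM] := pi_bounded k Db.
  exists (M ^+ 2); split; first exact: num_real.
  move=> N MN x; rewrite /= in_itv/= => /andP[x0 xb].
  rewrite ger0_norm ?sqr_ge0// (le_trans _ (ltW MN))// -[leLHS]ger0_norm ?sqr_ge0//.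
  by rewrite normrX lerXn2r ?nnegrE// ?HM// (le_trans _ (HM x x0 xb)).
Qed.

Lemma integrable_pi a b k : 0 < a -> D b -> mu.-integrable `]a, b] (EFin \o pi k).
Proof.
move=> a0 Db; have := continuous_integrable_cc (@pi_continuous k) (edge_cc a0 Db).
by apply: integrableS => //; exact: subset_itv_oc_cc.
Qed.

Lemma integrable_S b : D b -> mu.-integrable `]0, b] (EFin \o S).
Proof.
move=> Db; rewrite /S.
suff H s : mu.-integrable `]0, b] (EFin \o (fun x => \sum_(k <- s) pi k x ^+ 2)) by exact: H.
elim: s => [|k s IH].
  have := integrable0 mu `]0, b]; apply: eq_integrable => // x _ /=.
  by rewrite big_nil.
have := integrableD (moc 0 b) (integrable_sqr_pi k Db) IH.
by apply: eq_integrable => // x _ /=; rewrite big_cons EFinD.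
Qed.

Lemma P_sum b : D b -> P b = \sum_k \int[mu]_(t in `]0, b]) (pi k t ^+ 2).
Proof.
move=> Db; rewrite /P /S.
suff [_ H] : mu.-integrable `]0, b] (EFin \o (fun x => \sum_(k <- index_enum K) pi k x ^+ 2)) /\
    \int[mu]_(t in `]0, b]) (\sum_(k <- index_enum K) pi k t ^+ 2) =
    \sum_(k <- index_enum K) \int[mu]_(t in `]0, b]) (pi k t ^+ 2) by exact: H.
elim: (index_enum K) => [|k s [IH1 IH2]].
  split; last by under eq_Rintegral do rewrite big_nil; rewrite big_nil Rintegral_cst// mul0r.
  have := integrable0 mu `]0, b]; apply: eq_integrable => // x _ /=.
  by rewrite big_nil.
split.
  have := integrableD (moc 0 b) (integrable_sqr_pi k Db) IH1.
  by apply: eq_integrable => // x _ /=; rewrite big_cons EFinD.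
rewrite big_cons -IH2 -RintegralD//; last exact: integrable_sqr_pi.
by apply: eq_Rintegral => t _; rewrite big_cons.
Qed.

Lemma P_ge0 b : 0 <= P b.
Proof. by apply: Rintegral_ge0 => x _; exact: S_ge0. Qed.

Lemma P_nd a b : a <= b -> D b -> P a <= P b.
Proof.
move=> ab Db; apply: Rintegral_subset => //.
- exact: subset_itvl.
- exact: integrable_S.
- by move=> x _; exact: S_ge0.
Qed.

(** As phi k vanishes at 0, phi k x is the integral of pi k up to x, and
    Cauchy-Schwarz gives the factor x. The integrals start at a > 0, which then
    tends to 0, because 0 lies outside D. *)
Lemma sqr_phi_le x : D x -> \sum_k phi k x ^+ 2 <= x * P x.
Proof.
move=> Dx; rewrite P_sum// mulr_sumr; apply: ler_sum => k _.
have x0 := D_gt0 Dx.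
have cv : (phi k x - phi k a) ^+ 2 @[a --> (0:R)^'+] --> phi k x ^+ 2.
  have cv0 : phi k x - phi k a @[a --> (0:R)^'+] --> phi k x - 0.
    by apply: cvgB => //; exact: cvg_cst.
  rewrite subr0 in cv0.
  exact: (cvg_comp _ _ cv0 (@exprn_continuous R 2 (phi k x))).
apply: (cvgr_to_le cv); near=> a.
have a0 : 0 < a by near: a; exact: nbhs_right_gt.
have ax : a < x by near: a; exact: nbhs_right_lt.
have xa0 : 0 < x - a by rewrite subr_gt0.
rewrite (derive_FTC oD (@dphi k) (@pi_continuous k) ax (edge_cc a0 Dx)).
have sub : `]a, x]%classic `<=` `]0, x]%classic by apply: subset_itvr; rewrite bnd_simp ltW.
have i2 : mu.-integrable `]a, x] (EFin \o (fun x => pi k x ^+ 2)).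
  exact: integrableS (moc 0 x) (moc a x) sub (integrable_sqr_pi k Dx).
have mua : mu `]a, x]%classic = (x - a)%:E.
  by rewrite lebesgue_measure_itv/= lte_fin ax EFinB.
have := Rintegral_sqr_le (moc a x) mua xa0 (integrable_pi k a0 Dx) i2.
move=> /le_trans; apply; apply: ler_pM.
- exact: ltW.
- by apply: Rintegral_ge0 => y _; exact: sqr_ge0.
- lra.
- apply: Rintegral_subset => //; first exact: integrable_sqr_pi.
  by move=> y _; exact: sqr_ge0.
Unshelve. all: by end_near. Qed.

(** The origin of the weight x: |<Q f, f>| <= W |f|^2 <= W x P by
    [sqr_phi_le]. *)
Lemma sigma_le_P x b : D b -> 0 < x -> x <= b -> `|sigma x| <= P b * (x * W x).
Proof.
move=> Db x0 xb; have Dx := D_down Db x0 xb.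
apply: (le_trans (sigma_le Dx)); rewrite mulrC [leRHS]mulrA.
rewrite ler_wpM2r ?W_ge0// (le_trans (sqr_phi_le Dx))// mulrC.
by rewrite ler_wpM2r ?(ltW x0)// P_nd.
Qed.

Lemma integrable_xW_sub (A : set R) : measurable (A : set (measurableTypeR R)) -> A `<=` D ->
  mu.-integrable A (EFin \o (fun x => x * W x)).
Proof. by move=> mA AD; exact: integrableS mD mA AD iW. Qed.

Lemma integrable_gamma_sub (A : set R) : measurable (A : set (measurableTypeR R)) -> A `<=` D ->
  mu.-integrable A (EFin \o gamma).
Proof. by move=> mA AD; exact: integrableS mD mA AD igamma. Qed.

Lemma integrable_ZxW_sub (A : set R) c : measurable (A : set (measurableTypeR R)) -> A `<=` D ->
  mu.-integrable A (EFin \o (fun x => c * (x * W x))).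
Proof.
move=> mA AD; have := integrableZl mA c (integrable_xW_sub mA AD).
by apply: eq_integrable.
Qed.

Lemma integrable_sigma_sub (A : set R) c :
  measurable (A : set (measurableTypeR R)) -> A `<=` D ->
  (forall x, A x -> `|sigma x| <= c * (x * W x)) ->
  mu.-integrable A (EFin \o sigma).
Proof.
move=> mA AD sc; apply: (dominated_integrable mA _ sc) => //; last exact: integrable_ZxW_sub.
exact: measurable_funS mD AD msigma.
Qed.

Lemma integrable_sigma b : D b -> mu.-integrable `]0, b] (EFin \o sigma).
Proof.
move=> Db; apply: (@integrable_sigma_sub _ (P b)) => //; first exact: edge_oc.
by move=> x /=; rewrite in_itv/= => /andP[x0 xb]; exact: sigma_le_P.
Qed.

Let G x := S x + sigma x - gamma x.

Lemma integrable_G (A : set R) : measurable (A : set (measurableTypeR R)) ->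
  A `<=` D -> mu.-integrable A (EFin \o S) -> mu.-integrable A (EFin \o sigma) ->
  mu.-integrable A (EFin \o G) /\ \int[mu]_(x in A) G x =
    \int[mu]_(x in A) S x + \int[mu]_(x in A) sigma x - \int[mu]_(x in A) gamma x.
Proof.
move=> mA AD iS isg; have ig := integrable_gamma_sub mA AD.
have iSs : mu.-integrable A (EFin \o (fun x => S x + sigma x)).
  by have := integrableD mA iS isg; apply: eq_integrable.
split; first by have := integrableB mA iSs ig; apply: eq_integrable.
by rewrite RintegralB// RintegralD.
Qed.

(** Almost everywhere q' = |f'|^2 + Re <f'', f>, which is G by the differential
    equation, and q is absolutely continuous. *)
Lemma energy_cc a b : 0 < a -> a < b -> D b ->
  \int[mu]_(x in `]a, b]) G x = q b - q a.
Proof.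
move=> a0 ab Db; have [c [b' [cb bb' bD]]] := open_itv_cc oD Db.
have Db' : D b' by apply: bD; rewrite /= in_itv/= lexx ltW// (lt_trans cb).
have abD : `[a, b']%classic `<=` D by exact: edge_cc.
have ab' : a <= b' by rewrite ltW// (lt_trans ab).
have acq : abs_continuous a b' q.
  by apply: abs_continuous_sum => k; apply: abs_continuousM => //; [exact: acphi|exact: acpi].
have [rho [irho Hrho aerho]] := abs_continuous_FTC ab' acq.
have aeder : {ae mu, forall x, forall k, a < x < b' -> derivable (pi k) x 1}.
  apply: (@filter_forall _ K _ _ (ae_filter_ringOfSetsType mu)) => k.
  have [r [_ _]] := abs_continuous_FTC ab' (@acpi k _ _ abD).
  by apply: (@filterS _ _ (ae_filter_ringOfSetsType mu)) => x H /H[].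
have subD : `]a, b]%classic `<=` `]0, b]%classic.
  by apply: subset_itvr; rewrite bnd_simp ltW.
have subD2 := subset_trans subD (edge_oc Db).
have [iG _] := integrable_G (moc a b) subD2
  (integrableS (moc 0 b) (moc a b) subD (integrable_S Db))
  (integrableS (moc 0 b) (moc a b) subD (integrable_sigma Db)).
rewrite (Hrho a b)// ?ltW//.
have irhoS : mu.-integrable `]a, b] (EFin \o rho) by exact: integrableS irho.
rewrite /Rintegral; congr fine; apply: ae_eq_integral => //.
- by case/integrableP : iG.
- by case/integrableP : irhoS.
apply: (@filterS3 _ _ (ae_filter_ringOfSetsType mu) _ _ _ _ _ aerho aeder dpi).
move=> x Hr Hd Hp /=; rewrite in_itv/= => /andP[ax xb]; congr EFin.
have axb' : a < x < b' by rewrite ax (le_lt_trans xb).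
have Dx : D x by apply: subD2; rewrite /= in_itv/= ax.
have [_ <-] := Hr axb'.
have dq : is_derive x (1 : R) q (\sum_k (phi k x * derive1 (pi k) x + pi k x * pi k x)).
  apply: (@is_derive_fun_sum _ _ (fun k x => phi k x * pi k x)
    (fun k x => phi k x * derive1 (pi k) x + pi k x * pi k x)) => k.
  have dpik : is_derive x (1 : R) (pi k) (derive1 (pi k) x).
    by rewrite derive1E; apply: DeriveDef => //; exact: Hd.
  exact: is_deriveM (dphi k Dx) dpik.
rewrite derive1E (derive_val (f := q)) big_split/= /G -(addrA (S x)) -Hp//; last first.
  by move=> k; exact: Hd.
by rewrite addrC; congr (_ + _); apply: eq_bigr => k _; rewrite mulrC.
Qed.

Lemma q_cvg0 : q x @[x --> (0:R)^'+] --> (0 : R).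
Proof.
have /choice[l Hl] := pi0.
have : q x @[x --> (0:R)^'+] --> \sum_(k : K) 0 * l k.
  apply: (@cvg_fun_sum _ _ (fun k x => phi k x * pi k x) (fun k => 0 * l k)) => k.
  exact: cvgM (phi0 k) (Hl k).
by rewrite big1// => k _; rewrite mul0r.
Qed.

(** The flux q tends to 0 at 0, where f vanishes and f' stays bounded. *)
Lemma energy_oc b : D b -> \int[mu]_(x in `]0, b]) G x = q b.
Proof.
move=> Db; have b0 := D_gt0 Db.
have [iG _] := integrable_G (moc 0 b) (edge_oc Db) (integrable_S Db) (integrable_sigma Db).
apply/eqP; rewrite -subr_eq0 -normr_le0; apply/ler_addgt0Pr => e e0; rewrite add0r.
have e20 : 0 < e / 2 by rewrite divr_gt0.
pose c n : R := b * n.+1%:R^-1 / 2.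
have c0 n : 0 < c n by rewrite !mulr_gt0// invr_gt0.
have cb n : c n < b.
  rewrite /c -mulrA gtr_pMr// mulrC ltr_pdivrMl// mulr1.
  by rewrite (@le_lt_trans _ _ 1) ?ltr1n// invf_le1 ?ler1n.
have cto0 x : 0 < x -> \forall n \near \oo, c n < x.
  move=> x0; have xb0 : 0 < x / b by rewrite divr_gt0.
  near=> n; have : n.+1%:R^-1 < x / b.
    by near: n; exact: (near_infty_natSinv_lt (PosNum xb0)).
  rewrite ltr_pdivlMr// mulrC /c => H.
  by rewrite (le_lt_trans _ H)// ler_pdivrMr// ler_peMr ?ler1n// mulr_ge0// ltW.
have tail := integrable_tail (moc 0 b) iG (fun n => moc (c n) b) _ e20.
have [d /= d0 Hd] : \forall x \near (0:R)^'+, `|q x| <= e / 2.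
  exact: cvgr0_norm_le q_cvg0 _ e20.
near \oo => n.
have qc : `|q (c n)| <= e / 2.
  apply: Hd => //; rewrite /ball/= sub0r normrN gtr0_norm//.
  by near: n; exact: cto0.
have sub : `]c n, b]%classic `<=` `]0, b]%classic.
  by apply: subset_itvr; rewrite bnd_simp ltW.
have T : \int[mu]_(x in `]0, b] `\` `]c n, b]) `|G x| <= e / 2.
  near: n; apply: tail => x /=; rewrite in_itv/= => /andP[x0 xb].
  by near=> n; rewrite in_itv/= xb andbT; near: n; exact: cto0.
rewrite (Rintegral_setD (moc (c n) b) (moc 0 b) sub iG) energy_cc//.
rewrite addrAC (addrAC (q b)) subrr add0r.
have mdiff := measurableD (moc 0 b) (moc (c n) b).
have := le_normr_Rintegral mdiff (integrableS (moc 0 b) mdiff (@subDsetl _ _ _) iG).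
have := ler_normD (- q (c n)) (\int[mu]_(x in `]0, b] `\` `]c n, b]) G x).
rewrite normrN; lra.
Unshelve. all: by end_near. Qed.

(** In the energy identity on ]0, b1] the potential term beyond B n is at most
    P b1 times the integral of x W there, which is at most 1/2 for a suitable
    n, and can be absorbed; the part on ]0, B n] is bounded independently of
    b1. *)
Lemma P_bounded : exists C, forall b, D b -> P b <= C.
Proof.
have W0 x : D x -> 0 <= x * W x by move=> Dx; rewrite mulr_ge0 ?W_ge0// ltW// D_gt0.
have [n Hn] : exists n, \int[mu]_(x in D `\` `]0, B n]) `|x * W x| <= 1 / 2.
  have := integrable_tail mD iW (fun n => moc 0 (B n)) _ (divr_gt0 ltr01 (ltr0n R 2)).
  case=> [x Dx|N _ HN]; last by exists N; apply: HN => /=.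
  by apply: filterS (D_le_B Dx) => n xB; rewrite /= in_itv/= D_gt0.
pose w := \int[mu]_(x in D) (x * W x); pose Ga := \int[mu]_(x in D) `|gamma x|.
(* 1 bounds the flux at b1, Ga the term in gamma, P (B n) * w the potential
   term on ]0, B n] *)
exists (2 * (1 + Ga + P (B n) * w)) => b Db.
have Dm : D (Num.max b (B n)) by rewrite /Num.max; case: ifP.
have [b1 [Db1 bb1 qb1]] := flux_le Dm ltr01.
have bb1' : b <= b1 by rewrite (le_trans _ bb1)// le_max lexx.
have Bb1 : B n <= b1 by rewrite (le_trans _ bb1)// le_max lexx orbT.
apply: (le_trans (P_nd bb1' Db1)).
have is1 := integrable_sigma Db1; have sb1 := edge_oc Db1; have sbB := edge_oc (DB n).
have [_] := integrable_G (moc 0 b1) sb1 (integrable_S Db1) is1.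
rewrite energy_oc// -/(P b1) => E.
have isa : mu.-integrable `]0, b1] (EFin \o (fun x => `|sigma x|)).
  by have := integrable_abse is1; apply: eq_integrable.
have iga : mu.-integrable D (EFin \o (fun x => `|gamma x|)).
  by have := integrable_abse igamma; apply: eq_integrable.
have iwa : mu.-integrable D (EFin \o (fun x => `|x * W x|)).
  by have := integrable_abse iW; apply: eq_integrable.
have g1 : \int[mu]_(x in `]0, b1]) gamma x <= Ga.
  apply: le_trans (ler_norm _) _; apply: le_trans (le_normr_Rintegral (moc _ _) (integrable_gamma_sub (moc _ _) sb1)) _.
  by apply: Rintegral_subset.
have s1 : - (\int[mu]_(x in `]0, b1]) sigma x) <= \int[mu]_(x in `]0, b1]) `|sigma x|.
  by apply: le_trans (ler_norm _) _; rewrite normrN; exact: le_normr_Rintegral.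
have sub : `]0, B n]%classic `<=` `]0, b1]%classic by exact: subset_itvl.
have mdiff := measurableD (moc 0 b1) (moc 0 (B n)).
have mdiff' := measurableD mD (moc 0 (B n)).
have s2 : \int[mu]_(x in `]0, B n]) `|sigma x| <= P (B n) * w.
  apply: (@le_trans _ _ (\int[mu]_(x in `]0, B n]) (P (B n) * (x * W x)))).
    apply: le_Rintegral => //; [exact: integrableS isa|exact: integrable_ZxW_sub|].
    by move=> x /=; rewrite in_itv/= => /andP[x0 xb]; exact: sigma_le_P.
  rewrite RintegralZl//; last exact: integrable_xW_sub.
  rewrite ler_wpM2l ?P_ge0//; apply: Rintegral_subset => //.
have sdD : `]0, b1] `\` `]0, B n] `<=` D.
  by move=> x [xb _]; exact: sb1.
have s3 : \int[mu]_(x in `]0, b1] `\` `]0, B n]) `|sigma x| <= P b1 * (1 / 2).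
  apply: (@le_trans _ _ (\int[mu]_(x in `]0, b1] `\` `]0, B n]) (P b1 * (x * W x)))).
    apply: le_Rintegral => //; [exact: integrableS isa|apply: integrable_ZxW_sub => //; exact: subset_trans sb1|].
    by move=> x [/=]; rewrite in_itv/= => /andP[x0 xb] _; exact: sigma_le_P.
  rewrite RintegralZl//; last by apply: integrable_xW_sub => //; exact: subset_trans sb1.
  rewrite ler_wpM2l ?P_ge0//; apply: le_trans Hn.
  apply: (@le_trans _ _ (\int[mu]_(x in `]0, b1] `\` `]0, B n]) `|x * W x|)).
    apply: le_Rintegral => //; [|exact: integrableS mD mdiff sdD iwa|].
      by apply: integrable_xW_sub => //; exact: subset_trans sb1.
    by move=> x _; exact: ler_norm.
  apply: Rintegral_subset => //; last exact: integrableS iwa.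
  exact: setSD.
exact: absorb_half (esym E) qb1 g1 s1 s2 s3 (Rintegral_setD (moc 0 (B n)) (moc 0 b1) sub isa).
Qed.

Lemma integrable_S_edge : mu.-integrable D (EFin \o S).
Proof.
have [C HC] := P_bounded.
have mS : measurable_fun D S by exact: continuous_measurable_on S_continuous.
pose A n : set (measurableTypeR R) := `]0, B n]%classic.
have DE : \bigcup_n A n = D.
  apply/seteqP; split=> [x [n _]|x Dx]; first exact: edge_oc.
  by have [N _ HN] := D_le_B Dx; exists N => //; rewrite /A/= in_itv/= D_gt0// HN/=.
apply/integrableP; split; first exact/measurable_EFinP.
have cv : (\int[mu]_(x in A n) (S x)%:E)%E @[n --> \oo] -->
    (\int[mu]_(x in \bigcup_n A n) (S x)%:E)%E.
  apply: (@ge0_nondecreasing_set_cvg_integral _ _ _ A) => //.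
  - by move=> n p np; apply/subsetPset; apply: subset_itvl; rewrite bnd_simp; exact: ndB.
  - by move=> n; exact: moc.
  - by move=> n; case/integrableP: (integrable_S (DB n)).
  - by move=> n x _; rewrite lee_fin S_ge0.
have -> : (\int[mu]_(x in D) `|(EFin \o S) x| = \int[mu]_(x in D) (S x)%:E)%E.
  by apply: eq_integral => x _ /=; rewrite ger0_norm ?S_ge0.
rewrite -DE -(cvg_lim _ cv)//; apply: (@le_lt_trans _ _ C%:E); last exact: ltry.
apply: lime_le; first by apply/cvg_ex; eexists; exact: cv.
apply: nearW => n; have := integrable_fin_num (moc 0 (B n)) (integrable_S (DB n)).
by move=> /fineK <-; rewrite lee_fin; exact: HC.
Qed.

(** Let b tend to the right end in [energy_oc] through points where the flux q
    is small. As these fluxes are only bounded from above, an inequality is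
    obtained, in the direction that bounds the form <g, f> from below. *)
Theorem dirichlet_energy :
  [/\ mu.-integrable D (EFin \o S), mu.-integrable D (EFin \o sigma),
    \int[mu]_(x in D) S x + \int[mu]_(x in D) sigma x <= \int[mu]_(x in D) gamma x &
    forall x, D x -> \sum_k phi k x ^+ 2 <= x * \int[mu]_(t in D) S t].
Proof.
have iS := integrable_S_edge; have [C HC] := P_bounded.
have isg : mu.-integrable D (EFin \o sigma).
  apply: (@integrable_sigma_sub _ C) => // x Dx.
  apply: (le_trans (sigma_le_P Dx (D_gt0 Dx) (lexx x))).
  by rewrite ler_wpM2r ?HC// mulr_ge0 ?W_ge0// ltW// D_gt0.
split => // [|x Dx]; last first.
  apply: (le_trans (sqr_phi_le Dx)); rewrite ler_wpM2l ?(ltW (D_gt0 Dx))//.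
  by apply: Rintegral_subset => //; [exact: edge_oc|move=> y _; exact: S_ge0].
have [iG EG] := integrable_G mD (@subset_refl _ D) iS isg.
rewrite -subr_le0 -EG; apply/ler_addgt0Pr => e e0; rewrite add0r.
have e20 : 0 < e / 2 by rewrite divr_gt0.
have [n Hn] : exists n, \int[mu]_(x in D `\` `]0, B n]) `|G x| <= e / 2.
  have := integrable_tail mD iG (fun n => moc 0 (B n)) _ e20.
  case=> [x Dx|N _ HN]; last by exists N; apply: HN => /=.
  by apply: filterS (D_le_B Dx) => n xB; rewrite /= in_itv/= D_gt0.
have [b [Db Bb qb]] := flux_le (DB n) e20.
have sb := edge_oc Db.
have mdiff := measurableD mD (moc 0 b).
have mdiff' := measurableD mD (moc 0 (B n)).
have iGa : mu.-integrable D (EFin \o (fun x => `|G x|)).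
  by have := integrable_abse iG; apply: eq_integrable.
rewrite (Rintegral_setD (moc 0 b) mD sb iG) energy_oc//.
have t1 : \int[mu]_(x in D `\` `]0, b]) G x <= \int[mu]_(x in D `\` `]0, b]) `|G x|.
  apply: le_trans (ler_norm _) _; apply: le_normr_Rintegral => //.
  by exact: integrableS iG.
have t2 : \int[mu]_(x in D `\` `]0, b]) `|G x| <= \int[mu]_(x in D `\` `]0, B n]) `|G x|.
  apply: Rintegral_subset => //; last exact: integrableS iGa.
  by apply: setDS; exact: subset_itvl.
by rewrite [leRHS]splitr; apply: lerD => //; exact: le_trans t1 (le_trans t2 Hn).
Qed.

End Energy.

(** * Linear algebra: Bessel inequality, negative parts, maximal orthonormal families *)

Section KernelRows.
Variables (F : fieldType).

(** The rows of K span the common kernel of the functionals l; each functional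
    lowers the dimension by at most one. *)
Lemma kernel_rows n (I : finType) (l : I -> 'cV[F]_n) :
  exists r (K : 'M[F]_(r, n)),
    [/\ row_free K, (n <= r + #|I|)%N & forall i, K *m l i = 0].
Proof.
pose M := \matrix_(j < n, i < #|I|) l (enum_val i) j 0.
exists (\rank (kermx M)), (row_base (kermx M)); split.
- exact: row_base_free.
- by rewrite mxrank_ker addnC -leq_subLR leq_sub2l// rank_leq_col.
- move=> i; have : row_base (kermx M) *m M = 0.
    by apply/sub_kermxP; rewrite eq_row_base.
  move=> KM0; apply/matrixP => a b; rewrite ord1.
  transitivity ((row_base (kermx M) *m M) a (enum_rank i)).
    by rewrite mxE [RHS]mxE; apply: eq_bigr => j _; rewrite !mxE enum_rankK.
  by rewrite KM0 !mxE.
Qed.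

End KernelRows.

Section HermitianAlgebra.
Variable C : numClosedFieldType.
Local Open Scope sesquilinear_scope.

(** Over an arbitrary closed field, where the theory of [dotmx] applies; [cdot]
    is the instance at R[i]. *)
Definition dotC m (u v : 'cV[C]_m) : C := \sum_i u i 0 * Num.conj (v i 0).

Lemma dotC_dotmx m (u v : 'cV[C]_m) : dotC u v = dotmx u^T v^T.
Proof. by rewrite dotmxE !mxE; apply: eq_bigr => i _; rewrite !mxE. Qed.

Lemma dotCC m (u v : 'cV[C]_m) : Num.conj (dotC u v) = dotC v u.
Proof.
rewrite /dotC rmorph_sum; apply: eq_bigr => i _.
by rewrite rmorphM/= conjCK mulrC.
Qed.

Lemma dotC_sqr m (u : 'cV[C]_m) : dotC u u = \sum_i `|u i 0| ^+ 2.
Proof. by apply: eq_bigr => i _; rewrite normCK. Qed.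

Lemma dotC_ge0 m (u : 'cV[C]_m) : 0 <= dotC u u.
Proof. by rewrite dotC_sqr sumr_ge0// => i _; rewrite exprn_ge0. Qed.

Lemma dotC_CauchySchwarz m (u v : 'cV[C]_m) :
  `|dotC u v| ^+ 2 <= dotC u u * dotC v v.
Proof. by rewrite !dotC_dotmx; apply: (CauchySchwarz (dotmx (n := m))). Qed.

(** M is the Gram matrix of a form for which the evaluation ev has norm at most
    sqrt x, and w an M-orthonormal family. Put a i = <ev (w i), xi> and
    s = sum_i |a i|^2. The combination c of the w i with coefficients the
    conjugates of the a i has M-square s and satisfies <ev c, xi> = s, whence
    s^2 <= x s |xi|^2 by Cauchy-Schwarz. *)
Lemma bessel m r k (M : 'M[C]_r) (ev : 'M[C]_(m, r)) (x : C) (w : 'I_k -> 'rV[C]_r) :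
  0 <= x ->
  (forall c, dotC (ev *m c^T) (ev *m c^T) <= x * (c *m M *m c^t*) 0 0) ->
  (forall i j, (w i *m M *m (w j)^t*) 0 0 = (i == j)%:R) ->
  forall xi, \sum_i `|dotC (ev *m (w i)^T) xi| ^+ 2 <= x * dotC xi xi.
Proof.
move=> x0 evM wM xi; pose a i := dotC (ev *m (w i)^T) xi.
pose s := \sum_i `|a i| ^+ 2; pose c := \sum_i Num.conj (a i) *: w i.
have s0 : 0 <= s by rewrite sumr_ge0// => i _; rewrite exprn_ge0.
have Dc : (c *m M *m c^t*) 0 0 = s.
  rewrite /c !mulmx_suml summxE; apply: eq_bigr => i _.
  rewrite linear_sum/= map_mx_sum mulmx_sumr summxE (bigD1 i)//= big1 => [|j ji].
    rewrite linearZ/= map_mxZ -!scalemxAl -scalemxAr.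
    by rewrite addr0 mxE [X in _ * X]mxE wM eqxx mulr1/= conjCK mulrC -normCK.
  rewrite linearZ/= map_mxZ -!scalemxAl -scalemxAr.
  by rewrite [LHS]mxE [X in _ * X]mxE wM eq_sym (negPf ji) !mulr0.
have dc : dotC (ev *m c^T) xi = s.
  rewrite /dotC /c linear_sum/= mulmx_sumr.
  under eq_bigr do rewrite summxE mulr_suml.
  rewrite exchange_big/=; apply: eq_bigr => i _.
  under eq_bigr do rewrite linearZ/= -scalemxAr mxE -mulrA.
  by rewrite -mulr_sumr -/(dotC _ _) -/(a i) mulrC -normCK.
have := dotC_CauchySchwarz (ev *m c^T) xi; rewrite dc ger0_norm// => H.
have {}H : s * s <= s * (x * dotC xi xi).
  rewrite -expr2 (le_trans H)// mulrCA mulrA -Dc.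
  by rewrite ler_wpM2r ?dotC_ge0//; exact: evM.
change (s <= x * dotC xi xi).
have [s00|sn0] := eqVneq s 0; first by rewrite s00 mulr_ge0// dotC_ge0.
by rewrite -(ler_pM2l (x := s))// lt_neqAle eq_sym sn0.
Qed.

Section Spectral.
Variables (m : nat) (A : 'M[C]_m).
Hypothesis Aherm : A \is hermsymmx.
Let d := spectral_diag A.
Let U := spectralmx A.

Let d_real j : d 0 j \is Num.real.
Proof. exact: (mxOverP (hermitian_spectral_diag_real Aherm)). Qed.

Let AE : A = U^t* *m diag_mx d *m U.
Proof.
have /hermitian_normalmx /orthomx_spectralP AE := Aherm.
by rewrite {1}AE invmx_unitary// spectral_unitarymx.
Qed.

Let UU : U *m U^t* = 1%:M.
Proof. exact/unitarymxP/spectral_unitarymx. Qed.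

Let xi j : 'cV[C]_m := \col_k Num.conj (U j k).

Let dotC_xi i j : dotC (xi i) (xi j) = (i == j)%:R.
Proof.
have /matrixP/(_ j i) := UU; rewrite !mxE eq_sym => <-.
by apply: eq_bigr => k _; rewrite !mxE conjCK mulrC.
Qed.

Let Umul (u : 'cV[C]_m) j : (U *m u) j 0 = dotC u (xi j).
Proof. by rewrite mxE; apply: eq_bigr => k _; rewrite !mxE conjCK mulrC. Qed.

(** [neg_part], over an arbitrary closed field. *)
Definition spec_neg_part := - (invmx (spectralmx A)
    *m diag_mx (\row_j ((spectral_diag A 0 j < 0)%R)%:R) *m spectralmx A *m A).

Lemma tr_neg_partE : \tr spec_neg_part = \sum_j (if d 0 j < 0 then - d 0 j else 0).
Proof.
rewrite /spec_neg_part -/d -/U raddfN/= {1}AE invmx_unitary ?spectral_unitarymx//.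
rewrite -!mulmxA [U *m (_ *m _)]mulmxA UU mul1mx mxtrace_mulC -!mulmxA UU mulmx1.
rewrite mulmx_diag mxtrace_diag -sumrN; apply: eq_bigr => j _.
by rewrite !mxE; case: ifP => _; rewrite ?mul1r ?mul0r ?oppr0.
Qed.

Lemma quad_spectral (u : 'cV[C]_m) :
  dotC (A *m u) u = \sum_j d 0 j * `|dotC u (xi j)| ^+ 2.
Proof.
transitivity ((u^t* *m A *m u) 0 0).
  by rewrite -mulmxA mxE; apply: eq_bigr => i _; rewrite !mxE mulrC.
rewrite AE -!mulmxA mulmxA.
have -> : u^t* *m U^t* = (U *m u)^t* by rewrite trmx_mul map_mxM.
rewrite !mxE; apply: eq_bigr => j _.
rewrite mul_diag_mx !mxE -/(dotC _ _) normCK -Umul !mxE.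
by rewrite mulrCA; congr (_ * _); exact: mulrC.
Qed.

(** In an eigenbasis xi of A, - <A u, u> is the sum of the - d_j |<u, xi j>|^2.
    Terms with d_j >= 0 are dropped; for d_j < 0 the hypothesis at z = xi j
    bounds the sum of the |<u i, xi j>|^2 by x. *)
Lemma neg_part_trace_ge (I : finType) (u : I -> 'cV[C]_m) (x : C) :
  (forall z, \sum_i `|dotC (u i) z| ^+ 2 <= x * dotC z z) ->
  \sum_i - dotC (A *m u i) (u i) <= x * \tr spec_neg_part.
Proof.
move=> bes; rewrite tr_neg_partE mulr_sumr.
under eq_bigr do rewrite quad_spectral -sumrN.
rewrite exchange_big/=; apply: ler_sum => j _.
have s0 : 0 <= \sum_i `|dotC (u i) (xi j)| ^+ 2.
  by rewrite sumr_ge0// => i _; rewrite exprn_ge0.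
under eq_bigr do rewrite -mulNr.
rewrite -mulr_sumr; case: ifPn => [dj|].
  rewrite mulrC ler_wpM2r ?oppr_ge0 ?(ltW dj)//.
  by rewrite (le_trans (bes _))// dotC_xi eqxx mulr1.
rewrite -real_leNgt ?real0 ?d_real// => dj.
by rewrite mulr0 mulr_le0_ge0// oppr_le0.
Qed.

Lemma tr_neg_part_ge0 : 0 <= \tr spec_neg_part.
Proof.
by rewrite tr_neg_partE sumr_ge0// => j _; case: ifP => // /ltW; rewrite oppr_ge0.
Qed.

(** An eigenvalue d_j is <A xi, xi> for a unit eigenvector xi, whose entries
    have modulus at most 1. *)
Lemma tr_neg_part_le : \tr spec_neg_part <= m%:R * \sum_k \sum_l `|A k l|.
Proof.
rewrite tr_neg_partE.
have U1 j k : `|U j k| <= 1.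
  rewrite -(expr_le1 (n := 2))//.
  have H : \sum_i `|xi j i 0| ^+ 2 = 1 by rewrite -dotC_sqr dotC_xi eqxx.
  by rewrite -[leRHS]H (bigD1 k)//= mxE norm_conjC lerDl sumr_ge0//.
have dE j : d 0 j = \sum_k \sum_l U j k * A k l * Num.conj (U j l).
  have : U *m A *m U^t* = diag_mx d.
    by rewrite AE !mulmxA UU mul1mx -mulmxA UU mulmx1.
  move=> /matrixP/(_ j j); rewrite !mxE eqxx mulr1n => <-.
  rewrite exchange_big/=; apply: eq_bigr => l _.
  by rewrite !mxE mulr_suml.
have dle j : `|d 0 j| <= \sum_k \sum_l `|A k l|.
  rewrite dE (le_trans (ler_norm_sum _ _ _))// ler_sum// => k _.
  rewrite (le_trans (ler_norm_sum _ _ _))// ler_sum// => l _.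
  rewrite !normrM norm_conjC mulrC -[leRHS]mul1r mulrA.
  rewrite ler_pM// -[leRHS]mul1r ler_pM//.
apply: (@le_trans _ _ (\sum_(j < m) \sum_k \sum_l `|A k l|)); last first.
  by rewrite sumr_const card_ord mulr_natl.
apply: ler_sum => j _; case: ifP => [dj|_]; last first.
  by rewrite sumr_ge0// => k _; rewrite sumr_ge0.
by rewrite -ltr0_norm// (le_trans _ (dle j)).
Qed.

End Spectral.
End HermitianAlgebra.

Section Greedy.
Variables (R : realType) (r : nat) (M : 'M[R[i]]_r).
Local Open Scope sesquilinear_scope.
Local Notation D c c' := ((c *m M *m c'^t*) 0 0).

Lemma hermitian_form_conj (c c' : 'rV[R[i]]_r) : M^t* = M -> Num.conj (D c c') = D c' c.
Proof.
move=> Mh; transitivity ((c *m M *m c'^t*)^t* 0 0); first by rewrite !mxE.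
by rewrite trmx_mul map_mxM trmxCK trmx_mul map_mxM Mh mulmxA.
Qed.

Variables (beta : 'rV[R[i]]_r -> R) (N : nat).
Hypotheses (Mh : M^t* = M)
  (betaZ : forall (t : R) c, beta (t%:C *: c) = t ^+ 2 * beta c)
  (D_gt0 : forall c, complex.Re (D c c) < beta c -> 0 < complex.Re (D c c))
  (bounded : forall k (w : 'I_k -> 'rV[R[i]]_r),
    (forall i j, D (w i) (w j) = (i == j)%:R) -> (forall i, 1 < beta (w i)) ->
    (k <= N)%N).

(** Take a D-orthonormal family with beta > 1 on each member, of maximal
    length. If D c c < beta c for some c orthogonal to it, then D c c > 0, and
    c / sqrt (D c c) extends the family. *)
Lemma greedy_orthonormal : exists k (w : 'I_k -> 'rV[R[i]]_r), (k <= N)%N /\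
  forall c, (forall i, D c (w i) = 0) -> beta c <= complex.Re (D c c).
Proof.
pose good k := exists w : 'I_k -> 'rV[R[i]]_r,
  (forall i j, D (w i) (w j) = (i == j)%:R) /\ (forall i, 1 < beta (w i)).
have good0 : exists k, `[< good k >].
  by exists 0%N; apply/asboolP; exists (fun=> 0); split=> [[]|[]].
have goodN k : `[< good k >] -> (k <= N)%N.
  by move=> /asboolP[w [w1 w2]]; exact: bounded w1 w2.
case: (ex_maxnP good0 goodN) => k /asboolP[w [w1 w2]] kmax.
exists k, w; split => [|c cw]; first exact: bounded w1 w2.
rewrite leNgt; apply/negP => Dc; have Dc0 := D_gt0 Dc.
suff : `[< good k.+1 >] by move=> /kmax; rewrite ltnn.
apply/asboolP; pose t : R := (Num.sqrt (complex.Re (D c c)))^-1.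
have t2 : t ^+ 2 = (complex.Re (D c c))^-1 by rewrite exprVn sqr_sqrtr// ltW.
have Dreal : D c c = (complex.Re (D c c))%:C.
  have := hermitian_form_conj c c Mh; case: (D c c) => a b /= [] ba.
  by have -> : b = 0 by lra.
have DZl u v : D (t%:C *: u) v = t%:C * D u v.
  by rewrite -!scalemxAl mxE.
have DZr u v : D u (t%:C *: v) = t%:C * D u v.
  rewrite linearZ/= map_mxZ -scalemxAr mxE; congr (_ * _).
  exact: conjc_real.
exists (fun i => if unlift ord_max i is Some j then w j else t%:C *: c); split.
- move=> i j; case: unliftP => [i' ->|->]; case: unliftP => [j' ->|->].
  + by rewrite w1 (inj_eq lift_inj).
  + rewrite DZr -hermitian_form_conj// cw conjC0 mulr0.
    by rewrite eq_sym (negPf (neq_lift _ _)).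
  + by rewrite DZl cw mulr0 (negPf (neq_lift _ _)).
  + rewrite DZl DZr mulrA Dreal eqxx -rmorphM -rmorphM/= -expr2 t2 mulVf//.
    by rewrite gt_eqF.
- move=> i; case: unliftP => [i' _|_]; first exact: w2.
  by rewrite betaZ t2 ltr_pdivlMl// mulr1.
Qed.

End Greedy.

(** * Comparison of integrals without measurability *)

Section LowerIntegral.
Context d (T : measurableType d) (R : realType) (mu : {measure set T -> \bar R}).
Import HBNNSimple.
Local Open Scope ereal_scope.

(** The integral of a nonnegative function is a supremum over the simple
    functions below it, hence monotone even where measurability fails; the
    exceptional null set is removed from the simple functions. *)
Lemma ge0_ae_le_integral (D : set T) (f g : T -> \bar R) :
  (forall x, D x -> 0 <= f x) -> (forall x, D x -> 0 <= g x) ->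
  {ae mu, forall x, D x -> f x <= g x} ->
  \int[mu]_(x in D) f x <= \int[mu]_(x in D) g x.
Proof.
move=> f0 g0 [N [mN N0 fgN]]; rewrite !ge0_integralE//.
apply: ge_ereal_sup => _ [h /= hf <-]; apply: ereal_sup_ubound => /=.
(* h restricted to ~` N lies below g everywhere *)
exists (proj_nnsfun h (measurableC mN)) => [x|].
  rewrite /= mindicE; case: (boolP (x \in ~` N)) => [xN|_]; last first.
    by rewrite mulr0 patchE; case: ifPn => // /set_mem/g0.
  rewrite mulr1; apply: (le_trans (hf x)); rewrite !patchE.
  case: ifPn => // /set_mem Dx; apply: contrapT => fg.
  by move/set_mem: xN; apply; apply: fgN => /(_ Dx).
have E (k : {nnsfun T >-> R}) : sintegral mu k = \int[mu]_(x in setT) (k x)%:E.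
  by rewrite integral_nnsfun// patch_setT.
rewrite !E; apply: ae_eq_integral => //.
- exact/measurable_EFinP.
- exact/measurable_EFinP.
exists N; split => // x /= H; apply: contrapT => Nx; apply: H => _.
by rewrite /= mindicE mem_set// mulr1.
Qed.

(** Meant for Phi = x tr Q_-, which involves a choice of eigenbases of Q(x) at
    every x, so that its measurability is not at hand. Its integral is finite
    because Phi lies between 0 and an integrable function. *)
Lemma ae_le_Rintegral (D : set T) (h Phi w : T -> R) : measurable D ->
  mu.-integrable D (EFin \o h) -> mu.-integrable D (EFin \o w) ->
  {ae mu, forall x, D x -> [/\ h x <= Phi x, 0 <= Phi x & Phi x <= w x]%R} ->
  (\int[mu]_(x in D) h x <= \int[mu]_(x in D) Phi x)%R.
Proof.
move=> mD ih iw H.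
have neg0 : \int[mu]_(x in D) ((EFin \o Phi) ^\- x) = 0.
  apply/eqP; rewrite eq_le integral_ge0// andbT.
  rewrite -(integral0 mu D); apply: ge0_ae_le_integral => //.
  apply: (@filterS _ _ (ae_filter_ringOfSetsType mu) _ _ _ H) => x Hx Dx.
  have [_ Phi0 _] := Hx Dx.
  by rewrite funenegE /= -EFin_max lee_fin ge_max lexx andbT oppr_le0.
have posw : \int[mu]_(x in D) ((EFin \o Phi) ^\+ x) <= \int[mu]_(x in D) (`|w x|%R)%:E.
  apply: ge0_ae_le_integral => //.
  apply: (@filterS _ _ (ae_filter_ringOfSetsType mu) _ _ _ H) => x Hx Dx.
  have [_ Phi0 Phiw] := Hx Dx.
  by rewrite ?funeposE /= -EFin_max lee_fin ge_max normr_ge0 andbT (le_trans Phiw) ?ler_norm.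
have wfin : \int[mu]_(x in D) (`|w x|%R)%:E < +oo by case/integrableP : iw.
have E : \int[mu]_(x in D) (Phi x)%:E = \int[mu]_(x in D) ((EFin \o Phi) ^\+ x).
  by rewrite [LHS](integralE mu D (EFin \o Phi)) neg0 sube0.
rewrite /Rintegral E; apply: fine_le.
- exact: integrable_fin_num.
- by rewrite ge0_fin_numE ?(le_lt_trans posw)//; exact: integral_ge0.
apply: (@le_trans _ _ (\int[mu]_(x in D) ((EFin \o h) ^\+ x))).
  rewrite [leLHS](integralE mu D (EFin \o h)) leeBlDr//.
    by rewrite leeDl// integral_ge0.
  rewrite ge0_fin_numE; last exact: integral_ge0.
  exact: integral_funeneg_lt_pinfty.
apply: ge0_ae_le_integral => //.
apply: (@filterS _ _ (ae_filter_ringOfSetsType mu) _ _ _ H) => x Hx Dx.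
have [hPhi _ _] := Hx Dx.
by rewrite ?funeposE /= -!EFin_max lee_fin le_max2.
Qed.

End LowerIntegral.

(** * Integrals of complex-valued functions *)

Section Parts.
Variable R : realType.
Local Notation C := R[i].
Local Notation mu := (@lebesgue_measure R).

Lemma cRe_add (x y : C) : complex.Re (x + y) = complex.Re x + complex.Re y.
Proof. by case: x y => [a b] [c d]. Qed.

Lemma cIm_add (x y : C) : complex.Im (x + y) = complex.Im x + complex.Im y.
Proof. by case: x y => [a b] [c d]. Qed.

Lemma cRe_mul (x y : C) : complex.Re (x * y) =
  complex.Re x * complex.Re y - complex.Im x * complex.Im y.
Proof. by case: x y => [a b] [c d]. Qed.

Lemma cIm_mul (x y : C) : complex.Im (x * y) =
  complex.Re x * complex.Im y + complex.Im x * complex.Re y.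
Proof. by case: x y => [a b] [c d]. Qed.

Lemma cRe_sum (I : Type) (s : seq I) (F : I -> C) :
  complex.Re (\sum_(i <- s) F i) = \sum_(i <- s) complex.Re (F i).
Proof. by apply: (big_morph (@complex.Re R)) => // x y; exact: cRe_add. Qed.

Lemma cIm_sum (I : Type) (s : seq I) (F : I -> C) :
  complex.Im (\sum_(i <- s) F i) = \sum_(i <- s) complex.Im (F i).
Proof. by apply: (big_morph (@complex.Im R)) => // x y; exact: cIm_add. Qed.

Lemma cRe_conj (x : C) : complex.Re (x^*) = complex.Re x.
Proof. by case: x. Qed.

Lemma cIm_conj (x : C) : complex.Im (x^*) = - complex.Im x.
Proof. by case: x. Qed.

Variable D : set R.
Let mD_ty := measurable (D : set (measurableTypeR R)).

Definition cmeas (h : R -> C) := both_parts (measurable_fun D) h.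

Definition cint (h : R -> C) :=
  both_parts (fun h => mu.-integrable D (EFin \o h)) h.

Lemma cmeasD h k : cmeas h -> cmeas k -> cmeas (fun x => h x + k x).
Proof.
move=> [h1 h2] [k1 k2]; split.
  by under eq_fun do rewrite cRe_add; exact: measurable_funD.
by under eq_fun do rewrite cIm_add; exact: measurable_funD.
Qed.

Lemma cmeasM h k : cmeas h -> cmeas k -> cmeas (fun x => h x * k x).
Proof.
move=> [h1 h2] [k1 k2]; split.
  by under eq_fun do rewrite cRe_mul; apply: measurable_funB; exact: measurable_funM.
by under eq_fun do rewrite cIm_mul; apply: measurable_funD; exact: measurable_funM.
Qed.

Lemma cmeas_conj h : cmeas h -> cmeas (fun x => (h x)^*).
Proof.
move=> [h1 h2]; split; first by under eq_fun do rewrite cRe_conj.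
by under eq_fun do rewrite cIm_conj; exact: measurableT_comp.
Qed.

Lemma cmeas_cst c : cmeas (fun=> c).
Proof. by split; exact: measurable_cst. Qed.

Lemma cmeas_sum (I : Type) (s : seq I) (F : I -> R -> C) :
  (forall i, cmeas (F i)) -> cmeas (fun x => \sum_(i <- s) F i x).
Proof.
move=> cF; elim: s => [|i s IH].
  by under eq_fun do rewrite big_nil; exact: cmeas_cst.
by under eq_fun do rewrite big_cons; exact: cmeasD.
Qed.

Lemma cint_cmeas h : cint h -> cmeas h.
Proof.
by move=> [/integrableP[/measurable_EFinP h1 _] /integrableP[/measurable_EFinP h2 _]].
Qed.

Hypothesis mD : mD_ty.

Lemma cintD h k : cint h -> cint k -> cint (fun x => h x + k x).
Proof.
move=> [h1 h2] [k1 k2]; split.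
  by have := integrableD mD h1 k1; apply: eq_integrable => // x _ /=; rewrite cRe_add.
by have := integrableD mD h2 k2; apply: eq_integrable => // x _ /=; rewrite cIm_add.
Qed.

Lemma integrable_linear2 (f g : R -> R) (a b : R) :
  mu.-integrable D (EFin \o f) -> mu.-integrable D (EFin \o g) ->
  mu.-integrable D (EFin \o (fun x => a * f x + b * g x)) /\
  \int[mu]_(x in D) (a * f x + b * g x) =
    a * \int[mu]_(x in D) f x + b * \int[mu]_(x in D) g x.
Proof.
move=> fi gi; have fa : mu.-integrable D (EFin \o (fun x => a * f x)).
  by have := integrableZl mD a fi; apply: eq_integrable.
have gb : mu.-integrable D (EFin \o (fun x => b * g x)).
  by have := integrableZl mD b gi; apply: eq_integrable.
split; first by have := integrableD mD fa gb; apply: eq_integrable.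
by rewrite RintegralD// !RintegralZl.
Qed.

Lemma cintZ c h : cint h -> cint (fun x => c * h x) /\
  cintegral D (fun x => c * h x) = c * cintegral D h.
Proof.
move=> [h1 h2].
have [i1 e1] := integrable_linear2 (complex.Re c) (- complex.Im c) h1 h2.
have [i2 e2] := integrable_linear2 (complex.Re c) (complex.Im c) h2 h1.
have r1 x : complex.Re (c * h x) =
    complex.Re c * complex.Re (h x) + (- complex.Im c) * complex.Im (h x).
  by rewrite cRe_mul mulNr.
have r2 x : complex.Im (c * h x) =
    complex.Re c * complex.Im (h x) + complex.Im c * complex.Re (h x).
  by rewrite cIm_mul.
split; first split.
- by apply: eq_integrable i1 => // x _ /=; rewrite r1.
- by apply: eq_integrable i2 => // x _ /=; rewrite r2.
rewrite /cintegral; under eq_Rintegral do rewrite r1.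
under [X in _ +i* X]eq_Rintegral do rewrite r2.
rewrite e1 e2; apply/eqP; rewrite eq_complex cRe_mul cIm_mul /= mulNr.
by rewrite !eqxx.
Qed.

Lemma cintegralD h k : cint h -> cint k ->
  cintegral D (fun x => h x + k x) = cintegral D h + cintegral D k.
Proof.
move=> [h1 h2] [k1 k2]; rewrite /cintegral.
under eq_Rintegral do rewrite cRe_add.
under [X in _ +i* X]eq_Rintegral do rewrite cIm_add.
by rewrite !RintegralD.
Qed.

Lemma cint_sum (I : Type) (s : seq I) (F : I -> R -> C) :
  (forall i, cint (F i)) -> cint (fun x => \sum_(i <- s) F i x) /\
  cintegral D (fun x => \sum_(i <- s) F i x) = \sum_(i <- s) cintegral D (F i).
Proof.
move=> cF; elim: s => [|i s [IH1 IH2]].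
  have E : (fun x : R => \sum_(i <- [::]) F i x) = (fun=> 0).
    by apply/funext => x; rewrite big_nil.
  rewrite E big_nil; split; first by split; exact: integrable0.
  by rewrite /cintegral !Rintegral_cst//= !mul0r.
have E : (fun x : R => \sum_(j <- i :: s) F j x) = (fun x => F i x + \sum_(j <- s) F j x).
  by apply/funext => x; rewrite big_cons.
by rewrite E big_cons -IH2; split; [exact: cintD|exact: cintegralD].
Qed.

Lemma eq_cintegral (h k : R -> C) : (forall x, D x -> h x = k x) ->
  cintegral D h = cintegral D k.
Proof.
move=> hk; rewrite /cintegral; congr (_ +i* _);
  by apply: eq_Rintegral => x /set_mem/hk ->.
Qed.

Lemma cintegral_conj h : cint h -> cintegral D (fun x => (h x)^*) = (cintegral D h)^*.
Proof.
move=> [h1 h2]; rewrite /cintegral.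
under eq_Rintegral do rewrite cRe_conj.
under [X in _ +i* X]eq_Rintegral do rewrite cIm_conj -mulN1r.
by rewrite RintegralZl// mulN1r.
Qed.

Lemma integrable_prod (f g : R -> R) : measurable_fun D f -> measurable_fun D g ->
  mu.-integrable D (EFin \o (fun x => f x ^+ 2)) ->
  mu.-integrable D (EFin \o (fun x => g x ^+ 2)) ->
  mu.-integrable D (EFin \o (fun x => f x * g x)).
Proof.
move=> mf mg f2 g2; have [i _] := integrable_linear2 1 1 f2 g2.
apply: (dominated_integrable mD _ _ i); first exact: measurable_funM.
move=> x _; rewrite !mul1r ler_norml.
have := sqr_ge0 (f x + g x); have := sqr_ge0 (f x - g x).
have := sqr_ge0 (f x); have := sqr_ge0 (g x).
by rewrite sqrrB sqrrD => *; apply/andP; split; lra.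
Qed.

Variable m : nat.
Implicit Types f g : R -> 'cV[C]_m.

(** Square integrability coordinate by coordinate, in which form it combines
    well; [L2_csqint] relates it to [L2]. *)
Definition csqint f := forall i, cmeas (fun x => f x i 0) /\
  both_parts (fun h => mu.-integrable D (EFin \o (fun x => h x ^+ 2))) (fun x => f x i 0).

Lemma Re_cdot_sqr (u : 'cV[C]_m) : complex.Re (cdot u u) =
  \sum_i (complex.Re (u i 0) ^+ 2 + complex.Im (u i 0) ^+ 2).
Proof.
rewrite cRe_sum; apply: eq_bigr => i _.
by rewrite cRe_mul cRe_conj cIm_conj mulrN opprK.
Qed.

Lemma csqintP f : coordinatewise (measurable_fun D) f ->
  (\int[mu]_(x in D) (complex.Re (cdot (f x) (f x)))%:E < +oo)%E -> csqint f.
Proof.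
move=> mf fin.
have mcdot : measurable_fun D (fun x => complex.Re (cdot (f x) (f x))).
  have : cmeas (fun x => cdot (f x) (f x)).
    by apply: cmeas_sum => i; apply: cmeasM; [exact: mf|apply: cmeas_conj; exact: mf].
  by case.
have iS : mu.-integrable D (EFin \o (fun x => complex.Re (cdot (f x) (f x)))).
  apply/integrableP; split; first exact/measurable_EFinP.
  suff -> : (\int[mu]_(x in D) `|(EFin \o (fun x => complex.Re (cdot (f x) (f x)))) x| =
    \int[mu]_(x in D) (complex.Re (cdot (f x) (f x)))%:E)%E by [].
  apply: eq_integral => x _ /=.
  rewrite ger0_norm// Re_cdot_sqr sumr_ge0// => i _.
  by rewrite addr_ge0// sqr_ge0.
move=> i; split; first exact: mf.
have le x : complex.Re (f x i 0) ^+ 2 + complex.Im (f x i 0) ^+ 2 <= complex.Re (cdot (f x) (f x)).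
  rewrite Re_cdot_sqr (bigD1 i)//= lerDl sumr_ge0// => j _.
  by rewrite addr_ge0// sqr_ge0.
have [mf1 mf2] := mf i.
split; apply: (dominated_integrable mD _ _ iS).
- exact: measurable_funX.
- by move=> x _; rewrite ger0_norm ?sqr_ge0// (le_trans _ (le x))// lerDl sqr_ge0.
- exact: measurable_funX.
- by move=> x _; rewrite ger0_norm ?sqr_ge0// (le_trans _ (le x))// lerDr sqr_ge0.
Qed.

Lemma cint_cdot f g : csqint f -> csqint g -> cint (fun x => cdot (f x) (g x)).
Proof.
move=> cf cg; have [] // := @cint_sum _ (index_enum 'I_m)
  (fun i x => f x i 0 * (g x i 0)^*) _ => i.
have [[mf1 mf2] [f1 f2]] := cf i; have [[mg1 mg2] [g1 g2]] := cg i.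
have P a b (ma : measurable_fun D a) (mb : measurable_fun D b) := integrable_prod ma mb.
split.
  have [H _] := integrable_linear2 1 1 (P _ _ mf1 mg1 f1 g1) (P _ _ mf2 mg2 f2 g2).
  by apply: eq_integrable H => // x _ /=; rewrite cRe_mul cRe_conj cIm_conj mulrN opprK !mul1r.
have [H _] := integrable_linear2 (-1) 1 (P _ _ mf1 mg2 f1 g2) (P _ _ mf2 mg1 f2 g1).
by apply: eq_integrable H => // x _ /=; rewrite cIm_mul cRe_conj cIm_conj mulrN mulN1r mul1r.
Qed.

End Parts.

(** * The energy inequality on an edge *)

Section Components.
Variables (R : realType) (m : nat).
Local Notation C := R[i].
Implicit Types f g : R -> 'cV[C]_m.

Definition part (z : C) (b : bool) : R := if b then complex.Im z else complex.Re z.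
(** The real coordinates of a C^m-valued function, to which the real-valued
    calculus applies. *)
Definition rcoord f (k : 'I_m * bool) (x : R) : R := part (f x k.1 0) k.2.

Lemma Re_cdot (u v : 'cV[C]_m) : complex.Re (cdot u v) =
  \sum_(k : 'I_m * bool) part (u k.1 0) k.2 * part (v k.1 0) k.2.
Proof.
rewrite cRe_sum -(pair_big xpredT xpredT (fun i b => part (u i 0) b * part (v i 0) b))/=.
apply: eq_bigr => i _; rewrite big_bool/= addrC.
by rewrite cRe_mul cRe_conj cIm_conj mulrN opprK.
Qed.

Lemma Re_cdot_rcoord f x : complex.Re (cdot (f x) (f x)) = \sum_k rcoord f k x ^+ 2.
Proof. by rewrite Re_cdot; apply: eq_bigr => k _; rewrite expr2. Qed.

Lemma rcoord_cderive f k : rcoord (cderive f) k = derive1 (rcoord f k).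
Proof. by apply/funext => x; rewrite /rcoord; case: k => i []; rewrite /= mxE. Qed.

Lemma rcoord_AC (D : set R) f : AC_loc D f -> forall k a b, `[a, b]%classic `<=` D ->
  abs_continuous a b (rcoord f k).
Proof. by move=> H [i []] a b /H/(_ i)[]. Qed.

Lemma rcoord_cvg (F : set_system R) f c : ccvg F f c -> forall k,
  rcoord f k x @[x --> F] --> part (c k.1 0) k.2.
Proof. by move=> H [i []]; have [] := H i. Qed.

End Components.

Section EdgeGeometry.
Variables (R : realType) (G : metric_graph R) (e : edge G).
Let D := edge_set e.

Lemma edge_set_open : open D.
Proof. by rewrite /D /edge_set; case: (far e) => [[v l]|]; exact: interval_open. Qed.

Lemma edge_set_gt0 x : D x -> 0 < x.
Proof.
rewrite /D /edge_set; case: (far e) => [[v l]|] /=; rewrite in_itv/=.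
  by move=> /andP[].
by rewrite andbT.
Qed.

Lemma edge_set_down x y : D x -> 0 < y -> y <= x -> D y.
Proof.
rewrite /D /edge_set; case: (far e) => [[v l]|] /=; rewrite !in_itv/=.
  by move=> /andP[x0 xl] -> yx; rewrite (le_lt_trans yx).
by move=> _ ->.
Qed.

Lemma edge_set_exhaustion : exists B : nat -> R, [/\ forall n, D (B n),
  {homo B : n p / (n <= p)%N >-> n <= p} &
  forall x, D x -> \forall n \near \oo, x <= B n].
Proof.
rewrite /D /edge_set; case E : (far e) => [[v l]|].
  have l0 := length_gt0 E.
  exists (fun n => l - l / n.+2%:R); split => [n|n p np|x].
  - rewrite /= in_itv/= subr_gt0 ltr_pdivrMr// ltr_pMr// ltr1n/=.
    by rewrite ltrBlDr ltrDl divr_gt0.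
  - by rewrite lerB// ler_pM2l// lef_pV2 ?posrE// ler_nat.
  - rewrite /= in_itv/= => /andP[x0 xl].
    have d0 : 0 < (l - x) / l by rewrite divr_gt0// subr_gt0.
    near=> n; rewrite lerBrDr -lerBrDl.
    have : n.+1%:R^-1 < (l - x) / l.
      by near: n; exact: (near_infty_natSinv_lt (PosNum d0)).
    rewrite ltr_pdivlMr// => /ltW; apply: le_trans.
    by rewrite mulrC ler_pM2r// lef_pV2 ?posrE// ler_nat.
exists (fun n => n.+1%:R); split => [n|n p np|x].
- by rewrite /= in_itv/= ltr0n.
- by rewrite ler_nat.
- move=> _; near=> n; apply: (@le_trans _ _ n%:R); last by rewrite ler_nat.
  by near: n; exact: nbhs_infty_ger.
Unshelve. all: by end_near. Qed.

End EdgeGeometry.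

Section SingleEdge.
Variables (R : realType) (m : nat) (G : metric_graph R) (e : edge G).
Local Notation C := R[i].
Local Notation mu := (@lebesgue_measure R).
Local Notation D := (edge_set e).
Variable Qe : R -> 'M[C]_m.

(** A function f of the domain of the Hamiltonian, with zero values at the
    vertices, as seen from the edge e; g is the image of f. *)
Record dirichlet_edge (f g : R -> 'cV[C]_m) : Prop := DirichletEdge {
  de_sqf : csqint D f;
  de_sqg : csqint D g;
  de_AC : AC_loc D f;
  de_AC' : AC_loc D (cderive f);
  de_eq : {ae mu, forall x, D x -> g x = - cderive (cderive f) x + Qe x *m f x};
  de_0 : ccvg 0^'+ f 0;
  de_0' : exists d, ccvg 0^'+ (cderive f) d;
  de_l : forall v l, far e = Some (v, l) ->
    ccvg l^'- f 0 /\ exists d, ccvg l^'- (fun x => - cderive f x) d }.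

Hypotheses (Q_L1 : L1_mx D Qe) (xQ_L1 : L1_mx D (fun x => x%:C *: Qe x)).

Let oD : open D.
Proof. exact: edge_set_open. Qed.
Let mD : measurable (D : set (measurableTypeR R)).
Proof. exact: open_measurable. Qed.

Let W x := \sum_i \sum_j (`|complex.Re (Qe x i j)| + `|complex.Im (Qe x i j)|).

Lemma sum_entries_ge0 x : 0 <= W x.
Proof. by do 2!apply: sumr_ge0 => ? _; rewrite addr_ge0. Qed.

Lemma integrable_xW : mu.-integrable D (EFin \o (fun x => x * W x)).
Proof.
have isum (I : finType) (F : I -> R -> R) : (forall i, mu.-integrable D (EFin \o F i)) ->
    mu.-integrable D (EFin \o (fun x => \sum_i F i x)).
  move=> iF; have := @integrable_sum _ _ _ mu D mD I (index_enum I) xpredT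
    (fun i => EFin \o F i) (fun i _ => iF i).
  by apply: eq_integrable => // x _ /=; rewrite -sumEFin.
have iabs (F : R -> R) : mu.-integrable D (EFin \o F) ->
    mu.-integrable D (EFin \o (fun x => `|F x|)).
  by move=> iF; have := integrable_abse iF; apply: eq_integrable.
have i1 i j : mu.-integrable D (EFin \o (fun x =>
    `|complex.Re (x%:C * Qe x i j)| + `|complex.Im (x%:C * Qe x i j)|)).
  have [r1 r2] := xQ_L1 i j.
  have := integrableD mD (iabs _ r1) (iabs _ r2).
  by apply: eq_integrable => // x _ /=; rewrite mxE.
have := isum _ _ (fun i => isum _ _ (fun j => i1 i j)).
apply: eq_integrable => // x /set_mem/edge_set_gt0 x0 /=; congr EFin.
rewrite mulr_sumr; apply: eq_bigr => i _; rewrite mulr_sumr; apply: eq_bigr => j _.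
by rewrite cRe_mul cIm_mul /= !mul0r subr0 addr0 !normrM gtr0_norm// mulrDr.
Qed.

Lemma abs_quadratic_le (u : 'cV[C]_m) x :
  `|complex.Re (cdot (Qe x *m u) u)| <= W x * complex.Re (cdot u u).
Proof.
rewrite cRe_sum mulr_suml (le_trans (ler_norm_sum _ _ _))// ler_sum// => i _.
rewrite mxE mulr_suml cRe_sum mulr_suml (le_trans (ler_norm_sum _ _ _))//.
apply: ler_sum => j _; rewrite -mulrA cRe_mul.
set N := complex.Re (cdot u u).
have le k : complex.Re (u k 0) ^+ 2 + complex.Im (u k 0) ^+ 2 <= N.
  rewrite /N Re_cdot_sqr (bigD1 k)//= lerDl sumr_ge0// => l _.
  by rewrite addr_ge0// sqr_ge0.
have H1 : `|complex.Re (u j 0 * (u i 0)^*)| <= N.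
  rewrite cRe_mul cRe_conj cIm_conj ler_norml.
  have := le i; have := le j.
  have := sqr_ge0 (complex.Re (u j 0) - complex.Re (u i 0)).
  have := sqr_ge0 (complex.Im (u j 0) - complex.Im (u i 0)).
  have := sqr_ge0 (complex.Re (u j 0) + complex.Re (u i 0)).
  have := sqr_ge0 (complex.Im (u j 0) + complex.Im (u i 0)).
  by rewrite !sqrrB !sqrrD => *; apply/andP; split; lra.
have H2 : `|complex.Im (u j 0 * (u i 0)^*)| <= N.
  rewrite cIm_mul cRe_conj cIm_conj ler_norml.
  have := le i; have := le j.
  have := sqr_ge0 (complex.Re (u j 0) - complex.Im (u i 0)).
  have := sqr_ge0 (complex.Im (u j 0) - complex.Re (u i 0)).
  have := sqr_ge0 (complex.Re (u j 0) + complex.Im (u i 0)).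
  have := sqr_ge0 (complex.Im (u j 0) + complex.Re (u i 0)).
  by rewrite !sqrrB !sqrrD => *; apply/andP; split; lra.
rewrite (le_trans (ler_normB _ _))// !normrM mulrDl.
by apply: lerD; rewrite ler_wpM2l.
Qed.

Variables (f g : R -> 'cV[C]_m).
Hypothesis H : dirichlet_edge f g.
Let phi := rcoord f.
Let pi := rcoord (cderive f).

Lemma rcoord_derive k x : D x -> is_derive x (1 : R) (phi k) (pi k x).
Proof.
move=> Dx; rewrite /pi rcoord_cderive.
apply: (abs_continuous_loc_derive oD _ _ Dx).
  exact: rcoord_AC (de_AC H) k.
by rewrite -rcoord_cderive; exact: rcoord_AC (de_AC' H) k.
Qed.

Lemma rcoord_cderive_continuous k x : D x -> {for x, continuous (pi k)}.
Proof. exact: (abs_continuous_loc_continuous oD (rcoord_AC (de_AC' H) k)). Qed.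

Lemma rcoord_continuous k x : D x -> {for x, continuous (phi k)}.
Proof. exact: (abs_continuous_loc_continuous oD (rcoord_AC (de_AC H) k)). Qed.

(** Twice the flux is the derivative of |f|^2. If the flux exceeded eps from X
    on, then |f|^2 would be nondecreasing there; being integrable over a
    half-line, it would vanish at X, and with it the flux at X. *)
Lemma flux_lead (X eps : R) : far e = None -> D X -> 0 < eps -> exists b,
  [/\ D b, X <= b & \sum_k phi k b * pi k b <= eps].
Proof.
move=> efar DX eps0; apply: contrapT => nex.
have DE x : D x <-> 0 < x by rewrite /edge_set efar /= in_itv/= andbT.
have X0 : 0 < X by exact/DE.
have qgt b : X <= b -> eps < \sum_k phi k b * pi k b.
  move=> Xb; rewrite ltNge; apply/negP => qb; apply: nex; exists b; split => //.
  by apply/DE; exact: lt_le_trans Xb.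
pose h x := \sum_k phi k x ^+ 2.
have dh x : D x -> is_derive x (1 : R) h (2 * \sum_k phi k x * pi k x).
  move=> Dx; rewrite mulr_sumr.
  apply: (@is_derive_fun_sum _ _ _ (fun k x => phi k x ^+ 2)
    (fun k x => 2 * (phi k x * pi k x))) => k.
  have := is_deriveM (rcoord_derive k Dx) (rcoord_derive k Dx).
  by rewrite mulrDl mul1r.
have cq x : D x -> {for x, continuous (fun x => 2 * \sum_k phi k x * pi k x)}.
  move=> Dx; apply: continuousM; first exact: cst_continuous.
  apply: continuous_fun_sum => k; apply: continuousM.
    exact: rcoord_continuous.
  exact: rcoord_cderive_continuous.
have hX b : X <= b -> h X <= h b.
  rewrite le_eqVlt => /predU1P[->//|Xb].
  rewrite -subr_ge0 (derive_FTC oD dh cq Xb); last first.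
    by move=> y /=; rewrite in_itv/= => /andP[Xy _]; apply/DE; exact: lt_le_trans Xy.
  apply: Rintegral_ge0 => y /=; rewrite in_itv/= => /andP[Xy _].
  by rewrite mulr_ge0// ltW// (lt_trans eps0)// qgt// ltW.
have ih : mu.-integrable D (EFin \o h).
  have [ih _] := cint_cdot mD (de_sqf H) (de_sqf H).
  by apply: eq_integrable ih => // x _ /=; rewrite Re_cdot_rcoord.
pose I := \int[mu]_(x in D) h x.
have h0 x : 0 <= h x by apply: sumr_ge0 => k _; exact: sqr_ge0.
have le n : h X * n%:R <= I.
  pose A : set (measurableTypeR R) := `]X, X + n%:R]%classic.
  have mA : measurable A by exact: measurable_itv.
  have AD : A `<=` D.
    by move=> y; rewrite /A /= in_itv/= => /andP[Xy _]; apply/DE; exact: lt_trans Xy.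
  apply: le_trans (Rintegral_subset mA mD AD ih (fun x _ => h0 x)).
  have muA : mu A = n%:R%:E.
    rewrite /A lebesgue_measure_itv/= lte_fin ltrDl ltr0n.
    case: n {A mA AD} => [|n]; rewrite ?ltxx//.
    by rewrite /= -EFinB addrAC subrr add0r.
  have -> : h X * n%:R = \int[mu]_(x in A) (h X).
    rewrite Rintegral_cst//; congr (_ * _).
    by have : fine (mu A) = n%:R by rewrite muA.
  apply: le_Rintegral => //.
  - apply: measurable_bounded_integrable => //.
      have muAfin : (mu A < +oo)%E by rewrite muA ltry.
      exact: muAfin.
    exists (h X); split; first exact: num_real.
    by move=> M MX x _ /=; rewrite ger0_norm// ltW.
  - exact: integrableS mD mA AD ih.
  - by move=> y; rewrite /A /= in_itv/= => /andP[Xy _]; exact/hX/ltW.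
have hX0 : h X = 0.
  apply/eqP; rewrite eq_le h0 andbT leNgt; apply/negP => hXp.
  have := le (Num.bound (I / h X)); rewrite mulrC -ler_pdivlMr//.
  apply/negP; rewrite -ltNge archi_boundP// divr_ge0 ?(ltW hXp)//.
  by apply: Rintegral_ge0 => x _; exact: h0.
have := qgt X (lexx _); rewrite big1 => [|k _]; first by rewrite ltNge ltW.
move/eqP: hX0; rewrite psumr_eq0 => [/allP/(_ k)|j _]; last exact: sqr_ge0.
by rewrite mem_index_enum sqrf_eq0 => /(_ isT)/eqP ->; rewrite mul0r.
Qed.

(** At the far end f tends to 0 while f' has a limit. *)
Lemma flux_finite v l (X eps : R) : far e = Some (v, l) -> D X -> 0 < eps -> exists b,
  [/\ D b, X <= b & \sum_k phi k b * pi k b <= eps].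
Proof.
move=> efar DX eps0; have [fl [d dl]] := de_l H efar.
have cvq : \sum_k phi k x * pi k x @[x --> l^'-] --> \sum_k 0 * - part (d k.1 0) k.2.
  apply: (@cvg_fun_sum _ _ _ (fun k x => phi k x * pi k x)
    (fun k => 0 * - part (d k.1 0) k.2)) => k.
  apply: cvgM.
    have := @rcoord_cvg _ _ _ _ _ fl k; rewrite mxE.
    by case: (k) => i [].
  have E : pi k = (fun x => - rcoord (fun x => - cderive f x) k x).
    apply/funext => x; rewrite /pi /rcoord [in RHS]mxE; case: (k) => i [] /=;
      by case: (cderive f x i 0) => a b /=; rewrite opprK.
  by rewrite E; exact: cvgN (@rcoord_cvg _ _ _ _ _ dl k).
rewrite big1 in cvq; last by move=> k _; rewrite mul0r.
have lX : X < l by move: DX; rewrite /edge_set efar /= in_itv/= => /andP[].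
have Xgt0 : 0 < X by move: DX; rewrite /edge_set efar /= in_itv/= => /andP[].
near l^'- => b; exists b.
have Xb : X < b by near: b; exact: nbhs_left_gt.
split; last 2 first.
- exact: ltW.
- rewrite (le_trans (ler_norm _))// -normrN -[- _]sub0r.
  by near: b; exact: cvgr_dist_le cvq _ eps0.
rewrite /edge_set efar /= in_itv/= (lt_trans Xgt0)//=.
Unshelve. all: by end_near. Qed.

(** [dirichlet_energy] for the real coordinates of f, with sigma = Re <Q f, f>
    and gamma = Re <g, f>. *)
Lemma edge_energy :
  [/\ csqint D (cderive f),
    mu.-integrable D (EFin \o (fun x => complex.Re (cdot (Qe x *m f x) (f x)))),
    \int[mu]_(x in D) complex.Re (cdot (cderive f x) (cderive f x)) +
      \int[mu]_(x in D) complex.Re (cdot (Qe x *m f x) (f x)) <=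
      \int[mu]_(x in D) complex.Re (cdot (g x) (f x)) &
    forall x, D x -> complex.Re (cdot (f x) (f x)) <=
      x * \int[mu]_(t in D) complex.Re (cdot (cderive f t) (cderive f t))].
Proof.
have [B [DB ndB D_le_B]] := edge_set_exhaustion e.
have mf i : cmeas D (fun x => f x i 0) by have [] := de_sqf H i.
have msig : cmeas D (fun x => cdot (Qe x *m f x) (f x)).
  apply: cmeas_sum => i; apply: cmeasM; last exact: cmeas_conj.
  have -> : (fun x => (Qe x *m f x) i 0) = (fun x => \sum_j Qe x i j * f x j 0).
    by apply/funext => x; rewrite mxE.
  by apply: cmeas_sum => j; apply: cmeasM => //; exact/cint_cmeas/Q_L1.
have [igam _] := cint_cdot mD (de_sqg H) (de_sqf H).
have dpi : {ae mu, forall x, D x -> (forall k, derivable (pi k) x 1) ->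
    \sum_k derive1 (pi k) x * phi k x =
    complex.Re (cdot (Qe x *m f x) (f x)) - complex.Re (cdot (g x) (f x))}.
  apply: (@filterS _ _ (ae_filter_ringOfSetsType mu) _ _ _ (de_eq H)) => x gE Dx _.
  rewrite gE// !Re_cdot -sumrB; apply: eq_bigr => k _.
  rewrite -mulrBl; congr (_ * _); rewrite /pi -rcoord_cderive /rcoord.
  move: (cderive (cderive f) x) (Qe x *m f x) => u v.
  have -> : (- u + v) k.1 0 = - u k.1 0 + v k.1 0 by rewrite !mxE.
  by case: k (u k.1 0) (v k.1 0) => i [] [a b] [c d] /=; lra.
have sle x : D x -> `|complex.Re (cdot (Qe x *m f x) (f x))| <= W x * \sum_k phi k x ^+ 2.
  by move=> _; rewrite -Re_cdot_rcoord abs_quadratic_le.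
have phi0 k : phi k x @[x --> (0:R)^'+] --> (0:R).
  have := @rcoord_cvg _ _ _ _ _ (de_0 H) k; rewrite mxE.
  by case: k => i [].
have pi0 k : exists l : R, pi k x @[x --> (0:R)^'+] --> l.
  have [d Hd] := de_0' H; exists (part (d k.1 0) k.2).
  exact: (@rcoord_cvg _ _ _ _ _ Hd k).
have flux X eps : D X -> 0 < eps -> exists b,
    [/\ D b, X <= b & \sum_k phi k b * pi k b <= eps].
  move=> DX eps0; case efar : (far e) => [[v l]|].
    exact: flux_finite efar DX eps0.
  exact: flux_lead.
have [iS isig En Ptw] := dirichlet_energy oD (@edge_set_gt0 _ _ e) (@edge_set_down _ _ e)
  DB ndB D_le_B rcoord_derive (rcoord_AC (de_AC H)) (rcoord_AC (de_AC' H)) dpi igam msig.1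
  sle (fun x _ => sum_entries_ge0 x) integrable_xW phi0 pi0 flux.
have SE x : complex.Re (cdot (cderive f x) (cderive f x)) = \sum_k pi k x ^+ 2.
  by rewrite Re_cdot_rcoord.
have ESE : \int[mu]_(x in D) complex.Re (cdot (cderive f x) (cderive f x)) =
    \int[mu]_(x in D) \sum_k pi k x ^+ 2 by apply: eq_Rintegral => x _; rewrite SE.
rewrite ESE; split => // [|x Dx]; last by rewrite Re_cdot_rcoord; exact: Ptw.
have mpi k : measurable_fun D (pi k).
  exact: (continuous_measurable_on oD (@rcoord_cderive_continuous k)).
have mpi2 k : measurable_fun D (fun x => pi k x ^+ 2).
  by apply: measurable_funX; exact: mpi.
have ipi k : mu.-integrable D (EFin \o (fun x => pi k x ^+ 2)).
  apply: (dominated_integrable mD _ _ iS); first exact: mpi2.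
  move=> x _; rewrite ger0_norm ?sqr_ge0// (bigD1 k)//= lerDl sumr_ge0// => j _.
  exact: sqr_ge0.
move=> i; have := (mpi (i, false), mpi (i, true), (ipi (i, false), ipi (i, true))).
by rewrite /pi /rcoord /= => -[[m1 m2] [i1 i2]].
Qed.

End SingleEdge.

(** * Negative directions on an edge *)

Section RintegralSum.
Context d (T : measurableType d) (R : realType) (mu : {measure set T -> \bar R}).

Lemma Rintegral_sum (D : set T) (I : Type) (s : seq I) (F : I -> T -> R) :
  measurable D -> (forall i, mu.-integrable D (EFin \o F i)) ->
  mu.-integrable D (EFin \o (fun x => \sum_(i <- s) F i x)) /\
  \int[mu]_(x in D) (\sum_(i <- s) F i x) = \sum_(i <- s) \int[mu]_(x in D) F i x.
Proof.
move=> mD iF; have isum s' : mu.-integrable D (EFin \o (fun x => \sum_(i <- s') F i x)).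
  have := @integrable_sum _ _ _ mu D mD I s' xpredT
    (fun i => EFin \o F i) (fun i _ => iF i).
  by apply: eq_integrable => // x _ /=; rewrite -sumEFin.
split => //; elim: s => [|i s IH].
  rewrite big_nil (@eq_Rintegral _ _ _ _ _ (cst 0)); last by move=> x _; rewrite big_nil.
  by rewrite Rintegral_cst// mul0r.
rewrite big_cons -IH -RintegralD//.
by apply: eq_Rintegral => x _; rewrite big_cons.
Qed.

End RintegralSum.

Section EdgeFamily.
Variables (R : realType) (m : nat) (G : metric_graph R) (e : edge G).
Local Notation C := R[i].
Local Notation mu := (@lebesgue_measure R).
Local Notation D := (edge_set e).
Local Open Scope sesquilinear_scope.
(* The coefficient vector c parametrises functions fc c, linear in c on D, and
   their images gc c. *)
Variables (Qe : R -> 'M[C]_m) (r : nat) (fc gc : 'rV[C]_r -> R -> 'cV[C]_m).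
Hypotheses (Q_herm : {ae mu, forall x, D x -> Qe x \is hermsymmx})
  (Q_L1 : L1_mx D Qe) (xQ_L1 : L1_mx D (fun x => x%:C *: Qe x))
  (Hfg : forall c, dirichlet_edge e Qe (fc c) (gc c))
  (lin : forall c x, D x -> fc c x = \sum_i c 0 i *: fc (delta_mx 0 i) x).

Let mD : measurable (D : set (measurableTypeR R)).
Proof. by have oD : open D := @edge_set_open _ _ e; exact: open_measurable. Qed.

Let F i := fc (delta_mx 0 i).
Let P i := cderive (F i).

(** The family fc is linear in c on D only, which determines derivatives in D
    because D is open. *)
Lemma cderive_lin c x : D x -> cderive (fc c) x = \sum_i c 0 i *: P i x.
Proof.
move=> Dx; have nx : \near x, D x by apply: open_nbhs_nbhs; split => //; exact: edge_set_open.
have dF i k : is_derive x (1 : R) (rcoord (F i) k) (rcoord (P i) k x).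
  exact: (rcoord_derive (Hfg _)).
have key (k : 'I_m * bool) (A B : 'I_r -> R) (j j' : 'I_m * bool) :
    (forall y, D y -> rcoord (fc c) k y = \sum_i (A i * rcoord (F i) j y + B i * rcoord (F i) j' y)) ->
    rcoord (cderive (fc c)) k x = \sum_i (A i * rcoord (P i) j x + B i * rcoord (P i) j' x).
  move=> E; rewrite rcoord_cderive derive1E.
  have dsum : is_derive x (1 : R)
      (fun y => \sum_i (A i * rcoord (F i) j y + B i * rcoord (F i) j' y))
      (\sum_i (A i * rcoord (P i) j x + B i * rcoord (P i) j' x)).
    have H i : is_derive x (1 : R) (fun y => A i * rcoord (F i) j y + B i * rcoord (F i) j' y)
        (A i * rcoord (P i) j x + B i * rcoord (P i) j' x).
      exact: is_deriveD (is_deriveZ (A i) (dF i j)) (is_deriveZ (B i) (dF i j')).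
    exact: (@is_derive_fun_sum _ _ _
      (fun i y => A i * rcoord (F i) j y + B i * rcoord (F i) j' y)
      (fun i x => A i * rcoord (P i) j x + B i * rcoord (P i) j' x) _ H).
  have -> : 'D_1 (rcoord (fc c) k) x =
      'D_1 (fun y => \sum_i (A i * rcoord (F i) j y + B i * rcoord (F i) j' y)) x.
    by apply: near_eq_derive; apply: filterS nx => y Dy; exact: E.
  exact: derive_val.
apply/matrixP => a b; rewrite ord1 summxE.
have kr := key (a, false) (fun i => complex.Re (c 0 i))
  (fun i => - complex.Im (c 0 i)) (a, false) (a, true).
have ki := key (a, true) (fun i => complex.Re (c 0 i))
  (fun i => complex.Im (c 0 i)) (a, true) (a, false).
apply/eqP; rewrite eq_complex cRe_sum cIm_sum; apply/andP; split; apply/eqP.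
- transitivity (rcoord (cderive (fc c)) (a, false) x) => //.
  rewrite kr => [|y Dy].
    by apply: eq_bigr => i _; rewrite [in RHS]mxE cRe_mul mulNr.
  rewrite /rcoord/= lin// summxE cRe_sum; apply: eq_bigr => i _.
  by rewrite [in LHS]mxE cRe_mul mulNr.
- transitivity (rcoord (cderive (fc c)) (a, true) x) => //.
  rewrite ki => [|y Dy].
    by apply: eq_bigr => i _; rewrite [in RHS]mxE cIm_mul.
  rewrite /rcoord/= lin// summxE cIm_sum; apply: eq_bigr => i _.
  by rewrite [in LHS]mxE cIm_mul.
Qed.

(** The Gram matrix of the Dirichlet form on the family. *)
Definition energy_mx : 'M[C]_r := \matrix_(i, j) cintegral D (fun x => cdot (P i x) (P j x)).

Lemma csqint_cderive c : csqint D (cderive (fc c)).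
Proof. by have [] := edge_energy Q_L1 xQ_L1 (Hfg c). Qed.

Lemma cdot_sum (a b : 'I_r -> C) (u v : 'I_r -> 'cV[C]_m) :
  cdot (\sum_i a i *: u i) (\sum_j b j *: v j) =
  \sum_i \sum_j (a i * Num.conj (b j)) * cdot (u i) (v j).
Proof.
rewrite /cdot; under eq_bigr do rewrite summxE mulr_suml.
rewrite exchange_big/=; apply: eq_bigr => i _.
under eq_bigr do rewrite summxE rmorph_sum mulr_sumr.
rewrite exchange_big/=; apply: eq_bigr => j _.
rewrite mulr_sumr; apply: eq_bigr => k _.
by rewrite !mxE rmorphM/= mulrACA.
Qed.

Lemma energy_mxE c c' : (c *m energy_mx *m c'^t*) 0 0 =
  cintegral D (fun x => cdot (cderive (fc c) x) (cderive (fc c') x)).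
Proof.
have iP i j : cint D (fun x => cdot (P i x) (P j x)).
  by apply: cint_cdot => //; exact: csqint_cderive.
have iPZ i j : cint D (fun x => (c 0 i * Num.conj (c' 0 j)) * cdot (P i x) (P j x)).
  by have [] := cintZ mD (c 0 i * Num.conj (c' 0 j)) (iP i j).
rewrite (@eq_cintegral _ D _
  (fun x => \sum_i \sum_j (c 0 i * Num.conj (c' 0 j)) * cdot (P i x) (P j x))); last first.
  by move=> x Dx; rewrite !cderive_lin// cdot_sum.
have iS i := @cint_sum _ _ mD _ (index_enum 'I_r) _ (iPZ i).
have [_ ->] := @cint_sum _ _ mD _ (index_enum 'I_r) _ (fun i => (iS i).1).
rewrite mxE; under eq_bigr do rewrite mxE mulr_suml.
rewrite exchange_big/=; apply: eq_bigr => i _; rewrite (iS i).2.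
apply: eq_bigr => j _; have [_ ->] := cintZ mD (c 0 i * Num.conj (c' 0 j)) (iP i j).
by rewrite !mxE mulrAC.
Qed.

Let d c := \int[mu]_(x in D) complex.Re (cdot (cderive (fc c) x) (cderive (fc c) x)).
Let beta c := - \int[mu]_(x in D) complex.Re (cdot (Qe x *m fc c x) (fc c x)).

Lemma energy_mx_Re c : complex.Re ((c *m energy_mx *m c^t*) 0 0) = d c.
Proof. by rewrite energy_mxE. Qed.

Lemma Im_cdot_self (u : 'cV[C]_m) : complex.Im (cdot u u) = 0.
Proof. by apply: ger0_Im; exact: (dotC_ge0 u). Qed.

Lemma energy_mx_real c : (c *m energy_mx *m c^t*) 0 0 = (d c)%:C.
Proof.
rewrite energy_mxE /cintegral; congr (_ +i* _).
rewrite (@eq_Rintegral _ _ _ _ _ (cst 0)); last by move=> x _; rewrite Im_cdot_self.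
by rewrite Rintegral_cst// mul0r.
Qed.

Lemma energy_mx_herm : energy_mx^t* = energy_mx.
Proof.
apply/matrixP => i j; rewrite !mxE.
transitivity (cintegral D (fun x => Num.conj (cdot (P j x) (P i x)))).
  by apply/esym/cintegral_conj => //; apply: cint_cdot => //; exact: csqint_cderive.
by apply: eq_cintegral => x _; exact: (dotCC (P j x) (P i x)).
Qed.

Lemma dirichlet_ge0 c : 0 <= d c.
Proof.
apply: Rintegral_ge0 => x _; rewrite Re_cdot_sqr sumr_ge0// => i _.
by rewrite addr_ge0// sqr_ge0.
Qed.

Lemma fcZ (t : R) c x : D x -> fc (t%:C *: c) x = t%:C *: fc c x.
Proof.
move=> Dx; rewrite !lin// scaler_sumr; apply: eq_bigr => i _.
by rewrite mxE scalerA.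
Qed.

Lemma betaZ (t : R) c : beta (t%:C *: c) = t ^+ 2 * beta c.
Proof.
have [_ isig _ _] := edge_energy Q_L1 xQ_L1 (Hfg c).
rewrite /beta mulrN -RintegralZl//; congr (- _).
have sc (u : 'cV[C]_m) i : (t%:C *: u) i 0 = t%:C * u i 0 by rewrite mxE.
apply: eq_Rintegral => x /set_mem Dx; rewrite fcZ// !cRe_sum mulr_sumr.
have cj (z : C) : Num.conj (t%:C * z) = t%:C * Num.conj z.
  by rewrite rmorphM; congr (_ * _); exact: conjc_real.
apply: eq_bigr => i _; rewrite -scalemxAr !sc cj.
by rewrite mulrACA -rmorphM/= -expr2 cRe_mul/= mul0r subr0.
Qed.

(** Were the Dirichlet energy 0, the pointwise bound would give f = 0, hence
    beta = 0. *)
Lemma energy_gt0 c : d c < beta c -> 0 < d c.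
Proof.
move=> db; rewrite lt_neqAle dirichlet_ge0 andbT; apply/eqP => d0.
have [_ _ _ H] := edge_energy Q_L1 xQ_L1 (Hfg c).
have f0 x : D x -> fc c x = 0.
  move=> Dx; have := H x Dx; rewrite -/(d c) -d0 mulr0 Re_cdot_sqr => S0.
  have : \sum_i (complex.Re (fc c x i 0) ^+ 2 + complex.Im (fc c x i 0) ^+ 2) == 0.
    rewrite eq_le S0 sumr_ge0// => i _; by rewrite addr_ge0// sqr_ge0.
  rewrite psumr_eq0 => [/allP Z|i _]; last by rewrite addr_ge0// sqr_ge0.
  apply/matrixP => i j; rewrite ord1 mxE; apply/eqP; rewrite eq_complex/=.
  by have := Z i (mem_index_enum i); rewrite paddr_eq0 ?sqr_ge0// !sqrf_eq0.
have : beta c = 0.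
  rewrite /beta (@eq_Rintegral _ _ _ _ _ (cst 0)); last first.
    move=> x /set_mem Dx; rewrite f0// mulmx0 Re_cdot_sqr big1// => i _.
    by rewrite mxE/= expr0n addr0.
  by rewrite Rintegral_cst// mul0r oppr0.
by move=> b0; move: db; rewrite b0 -d0 ltxx.
Qed.

Let Phi x := x * complex.Re (\tr (neg_part (Qe x))).
Let W x := \sum_i \sum_j (`|complex.Re (Qe x i j)| + `|complex.Im (Qe x i j)|).

Lemma Phi_bounds x : D x -> Qe x \is hermsymmx -> 0 <= Phi x <= m%:R * (x * W x).
Proof.
move=> Dx Qh; have x0 := edge_set_gt0 Dx.
have := tr_neg_part_ge0 Qh; rewrite lecE => /andP[_ /= t0].
have := tr_neg_part_le Qh; rewrite lecE => /andP[_ /= tle].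
rewrite /Phi mulr_ge0 ?(ltW x0)//= mulrCA ler_wpM2l ?(ltW x0)//.
rewrite (le_trans tle)//.
have -> : (m%:R : C) = (m%:R : R)%:C by rewrite rmorph_nat.
rewrite cRe_mul/= mul0r subr0 ler_wpM2l// cRe_sum ler_sum// => i _.
rewrite cRe_sum ler_sum// => j _.
case: (Qe x i j) => a b; rewrite normc_def/= -[leRHS]ger0_norm ?addr_ge0//.
rewrite -sqrtr_sqr ler_wsqrtr// sqrrD !real_normK ?num_real//.
by rewrite lerD2r lerDl mulrn_wge0// mulr_ge0.
Qed.

(** Evaluation at x has norm at most sqrt x for the Dirichlet form: Bessel's
    inequality applies to the values w_i(x), and [neg_part_trace_ge] sums them
    against the negative part of Q(x). *)
Lemma pointwise_trace k (w : 'I_k -> 'rV[C]_r) x : D x -> Qe x \is hermsymmx ->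
  (forall i j, (w i *m energy_mx *m (w j)^t*) 0 0 = (i == j)%:R) ->
  \sum_i - complex.Re (cdot (Qe x *m fc (w i) x) (fc (w i) x)) <= Phi x.
Proof.
move=> Dx Qh wM; have x0 := edge_set_gt0 Dx.
pose ev : 'M[C]_(m, r) := \matrix_(a, i) F i x a 0.
have evE c : ev *m c^T = fc c x.
  rewrite lin//; apply/matrixP => a b; rewrite ord1 mxE summxE.
  by apply: eq_bigr => i _; rewrite !mxE mulrC.
have evM c : dotC (ev *m c^T) (ev *m c^T) <= x%:C * (c *m energy_mx *m c^t*) 0 0.
  rewrite evE energy_mx_real -rmorphM/=.
  have -> : dotC (fc c x) (fc c x) = (complex.Re (cdot (fc c x) (fc c x)))%:C.
    have := Im_cdot_self (fc c x); rewrite -/(cdot _ _).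
    by change (dotC (fc c x) (fc c x)) with (cdot (fc c x) (fc c x)); case: (cdot _ _) => a b /= ->.
  by rewrite lecR; have [_ _ _] := edge_energy Q_L1 xQ_L1 (Hfg c); exact.
have x0' : 0 <= x%:C :> C by rewrite ler0c ltW.
have := neg_part_trace_ge Qh (bessel x0' evM wM).
rewrite lecE => /andP[_]; rewrite cRe_sum cRe_mul/= mul0r subr0.
apply: le_trans; apply: ler_sum => i _; rewrite evE.
by rewrite -[dotC _ _]/(cdot _ _); case: (cdot _ _).
Qed.

(** Integrate [pointwise_trace]; on the left each w i contributes more than 1. *)
Lemma beta_bounded k (w : 'I_k -> 'rV[C]_r) :
  (forall i j, (w i *m energy_mx *m (w j)^t*) 0 0 = (i == j)%:R) ->
  (forall i, 1 < beta (w i)) ->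
  k%:R <= \int[mu]_(x in D) Phi x.
Proof.
move=> wM wb.
have isig i : mu.-integrable D (EFin \o (fun x =>
    - complex.Re (cdot (Qe x *m fc (w i) x) (fc (w i) x)))).
  have [_ H _ _] := edge_energy Q_L1 xQ_L1 (Hfg (w i)).
  by have := integrableN H; apply: eq_integrable.
have [ih hE] := Rintegral_sum (index_enum 'I_k) mD isig.
have iw : mu.-integrable D (EFin \o (fun x => m%:R * (x * W x))).
  by have := integrableZl mD m%:R (integrable_xW xQ_L1); apply: eq_integrable.
have : \int[mu]_(x in D) (\sum_i - complex.Re (cdot (Qe x *m fc (w i) x) (fc (w i) x)))
    <= \int[mu]_(x in D) Phi x.
  apply: (ae_le_Rintegral mD ih iw).
  apply: (@filterS _ _ (ae_filter_ringOfSetsType mu) _ _ _ Q_herm) => x Qh Dx.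
  have /andP[P0 PW] := Phi_bounds Dx (Qh Dx).
  by split => //; exact: pointwise_trace (Qh Dx) wM.
apply: le_trans; rewrite hE.
have -> : k%:R = \sum_(i < k) (1 : R) by rewrite sumr_const card_ord.
apply: ler_sum => i _; apply: (le_trans (ltW (wb i))).
rewrite /beta -[leLHS]mulN1r -RintegralZl//; last first.
  by have [] := edge_energy Q_L1 xQ_L1 (Hfg (w i)).
by under eq_Rintegral do rewrite mulN1r.
Qed.

(** The functionals l are the Dirichlet inner products with the members of a
    maximal family as in [greedy_orthonormal]. *)
Lemma edge_bound : exists k (l : 'I_k -> 'cV[C]_r),
  (k%:Z <= Num.floor (\int[mu]_(x in D) Phi x)) /\
  forall c, (forall i, c *m l i = 0) ->
    0 <= complex.Re (cintegral D (fun x => cdot (gc c x) (fc c x))).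
Proof.
pose N := `|Num.floor (\int[mu]_(x in D) Phi x)|%N.
have T0 : 0 <= \int[mu]_(x in D) Phi x.
  by have := @beta_bounded 0 (fun=> 0); apply => [[]|[]].
have NE : N%:Z = Num.floor (\int[mu]_(x in D) Phi x).
  by rewrite /N gez0_abs// floor_ge0.
have bd k (w : 'I_k -> 'rV[C]_r) :
    (forall i j, (w i *m energy_mx *m (w j)^t*) 0 0 = (i == j)%:R) ->
    (forall i, 1 < beta (w i)) -> (k <= N)%N.
  by move=> w1 w2; rewrite -lez_nat NE Num.Theory.floor_ge_int -pmulrn; exact: beta_bounded w1 w2.
have pos c : complex.Re ((c *m energy_mx *m c^t*) 0 0) < beta c ->
    0 < complex.Re ((c *m energy_mx *m c^t*) 0 0).
  by rewrite energy_mx_Re; exact: energy_gt0.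
have [k [w [kN Hw]]] := greedy_orthonormal energy_mx_herm betaZ pos bd.
exists k, (fun i => energy_mx *m (w i)^t*); split; first by rewrite -NE lez_nat.
move=> c cl; have := Hw c _; rewrite energy_mx_Re => H.
have {}H : beta c <= d c.
  by apply: H => i; rewrite -mulmxA cl mxE.
have [_ _ En _] := edge_energy Q_L1 xQ_L1 (Hfg c).
rewrite /cintegral/=; move: En H; rewrite /beta /d; lra.
Qed.

End EdgeFamily.

(** * The Hilbert space of square integrable functions *)

Section L2space.
Variables (R : realType) (m : nat) (G : metric_graph R).
Local Notation C := R[i].
Local Notation mu := (@lebesgue_measure R).
Implicit Types f g h : gfun m G.

Lemma edge_set_measurable (e : edge G) : measurable (edge_set e : set (measurableTypeR R)).
Proof. by have oD : open (edge_set e) := @edge_set_open _ _ e; exact: open_measurable. Qed.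
Let mE := edge_set_measurable.

Lemma L2_csqint f : L2 f <-> forall e, csqint (edge_set e) (f e).
Proof.
split=> [H e|H e]; first by have [H1 H2] := H e; apply: csqintP.
split; first by move=> i; have [] := H e i.
have [i1 _] := cint_cdot (mE e) (H e) (H e).
have : (\int[mu]_(x in edge_set e) `|complex.Re (cdot (f e x) (f e x))|%:E < +oo)%E.
  by case/integrableP : i1.
apply: le_lt_trans; apply: ge0_ae_le_integral.
- move=> x _; rewrite lee_fin Re_cdot_sqr sumr_ge0// => i _.
  by rewrite addr_ge0// sqr_ge0.
- by move=> x _; rewrite lee_fin.
- by apply: aeW => x _; rewrite lee_fin ler_norm.
Qed.

Lemma csqint_lin (D : set R) (a : C) (f g : R -> 'cV[C]_m) :
  measurable (D : set (measurableTypeR R)) ->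
  csqint D f -> csqint D g -> csqint D (fun x => a *: f x + g x).
Proof.
move=> mD cf cg i.
have [[mf1 mf2] [f1 f2]] := cf i; have [[mg1 mg2] [g1 g2]] := cg i.
pose sq (u : R -> R) := measurable_fun D u /\ mu.-integrable D (EFin \o (fun x => u x ^+ 2)).
have sqD u v : sq u -> sq v -> sq (fun x => u x + v x).
  move=> [mu_ iu] [mv iv]; split; first exact: measurable_funD.
  have iuv := integrable_prod mD mu_ mv iu iv.
  have [i1 _] := integrable_linear2 mD 1 2 iu iuv.
  have [i2 _] := integrable_linear2 mD 1 1 i1 iv.
  by apply: eq_integrable i2 => // x _ /=; congr EFin; ring.
have sqZ c u : sq u -> sq (fun x => c * u x).
  move=> [mu_ iu]; split; first exact: measurable_funM.
  have [i1 _] := integrable_linear2 mD (c ^+ 2) 0 iu iu.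
  by apply: eq_integrable i1 => // x _ /=; congr EFin; ring.
have E x : (a *: f x + g x) i 0 = a * f x i 0 + g x i 0 by rewrite !mxE.
have [mr ir] : sq (fun x => complex.Re ((a *: f x + g x) i 0)).
  under eq_fun do rewrite E cRe_add cRe_mul -mulNr.
  by apply: (sqD) => //; apply: (sqD); exact: (sqZ).
have [mi ii] : sq (fun x => complex.Im ((a *: f x + g x) i 0)).
  under eq_fun do rewrite E cIm_add cIm_mul.
  by apply: (sqD) => //; apply: (sqD); exact: (sqZ).
by split; split.
Qed.

Lemma L2_lin a f g : L2 f -> L2 g -> L2 (fun e x => a *: f e x + g e x).
Proof.
move=> /L2_csqint Hf /L2_csqint Hg; apply/L2_csqint => e.
exact: csqint_lin.
Qed.

Lemma L2_0 : L2 (fun _ _ => 0 : 'cV[C]_m) (G := G).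
Proof.
apply/L2_csqint => e i; split.
  by split; rewrite /=; under eq_fun do rewrite mxE; exact: measurable_cst.
have i0 := @integrable0 _ _ _ mu (edge_set e).
by split; apply: eq_integrable i0 => // x _ /=; rewrite mxE/= expr0n.
Qed.

Lemma gae_eq_refl f : gae_eq f f.
Proof. by move=> e; apply: aeW. Qed.

Lemma gae_eq_sym f g : gae_eq f g -> gae_eq g f.
Proof.
by move=> H e; apply: (@filterS _ _ (ae_filter_ringOfSetsType mu) _ _ _ (H e)) => x Hx Dx; rewrite Hx.
Qed.

Lemma gae_eq_trans f g h : gae_eq f g -> gae_eq g h -> gae_eq f h.
Proof.
move=> H K e; apply: (@filterS2 _ _ (ae_filter_ringOfSetsType mu) _ _ _ _ (H e) (K e)).
by move=> x Hx Kx Dx; rewrite Hx// Kx.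
Qed.

Lemma gae_eq_lin a f g f' g' : gae_eq f f' -> gae_eq g g' ->
  gae_eq (fun e x => a *: f e x + g e x) (fun e x => a *: f' e x + g' e x).
Proof.
move=> H K e; apply: (@filterS2 _ _ (ae_filter_ringOfSetsType mu) _ _ _ _ (H e) (K e)).
by move=> x Hx Kx Dx; rewrite Hx// Kx.
Qed.

Lemma inner_ae f f' g g' : L2 f -> L2 f' -> L2 g -> L2 g' ->
  gae_eq f f' -> gae_eq g g' -> inner f g = inner f' g'.
Proof.
move=> /L2_csqint Hf /L2_csqint Hf' /L2_csqint Hg /L2_csqint Hg' E E'.
apply: eq_bigr => e _.
have [r i] := cint_cdot (mE e) (Hf e) (Hg e).
have [r' i'] := cint_cdot (mE e) (Hf' e) (Hg' e).
have ae : {ae mu, forall x, edge_set e x -> cdot (f e x) (g e x) = cdot (f' e x) (g' e x)}.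
  apply: (@filterS2 _ _ (ae_filter_ringOfSetsType mu) _ _ _ _ (E e) (E' e)).
  by move=> x Hx Kx Dx; rewrite Hx// Kx.
rewrite /cintegral; congr (_ +i* _); rewrite /Rintegral; congr fine; apply: ae_eq_integral => //.
- by case/integrableP : r.
- by case/integrableP : r'.
- by apply: (@filterS _ _ (ae_filter_ringOfSetsType mu) _ _ _ ae) => x Hx Dx /=; rewrite Hx.
- by case/integrableP : i.
- by case/integrableP : i'.
- by apply: (@filterS _ _ (ae_filter_ringOfSetsType mu) _ _ _ ae) => x Hx Dx /=; rewrite Hx.
Qed.

Lemma Re_inner f g : complex.Re (inner f g) =
  \sum_e complex.Re (cintegral (edge_set e) (fun x => cdot (f e x) (g e x))).
Proof. by rewrite cRe_sum. Qed.

Lemma Re_cdot_ge0 (u : 'cV[C]_m) : 0 <= complex.Re (cdot u u).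
Proof.
by rewrite Re_cdot_sqr sumr_ge0// => i _; rewrite addr_ge0// sqr_ge0.
Qed.

Lemma inner_self_eq0 f : L2 f -> complex.Re (inner f f) = 0 ->
  gae_eq f (fun _ _ => 0).
Proof.
move=> /L2_csqint Hf /eqP; rewrite Re_inner psumr_eq0 => [/allP H e|e _]; last first.
  by apply: Rintegral_ge0 => x _; exact: Re_cdot_ge0.
have /eqP := H e (mem_index_enum e); rewrite /cintegral/= /Rintegral => I0.
have [r _] := cint_cdot (mE e) (Hf e) (Hf e).
have fin := integrable_fin_num (mE e) r.
have : (\int[mu]_(x in edge_set e) `|(complex.Re (cdot (f e x) (f e x)))%:E|)%E = 0%E.
  rewrite -[RHS]/(0%:E) -I0 fineK//; apply: eq_integral => x _ /=.
  by rewrite ger0_norm// Re_cdot_ge0.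
have mf : measurable_fun (edge_set e : set (measurableTypeR R))
    (EFin \o (fun x => complex.Re (cdot (f e x) (f e x)))) by case/integrableP : r.
move=> /(ae_eq_integral_abs _ (mE e) mf) ae0.
apply: (@filterS _ _ (ae_filter_ringOfSetsType mu) _ _ _ ae0) => x Hx Dx.
have [/eqP] := Hx Dx; rewrite Re_cdot_sqr psumr_eq0 => [/allP Z|i _]; last first.
  by rewrite addr_ge0// sqr_ge0.
apply/matrixP => i j; rewrite ord1 mxE; apply/eqP; rewrite eq_complex/=.
by have := Z i (mem_index_enum i); rewrite paddr_eq0 ?sqr_ge0// !sqrf_eq0.
Qed.

End L2space.

(** * Negative spectral subspaces *)

Section SpectralSubspace.
Variables (R : realType) (m : nat) (G : metric_graph R).
Local Notation C := R[i].
Variables (T : gfun m G -> gfun m G -> Prop) (E : set R -> gfun m G -> gfun m G).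
Hypothesis HE : spectral_measure T E.
Implicit Types f g h : gfun m G.

Definition gcomb (I : Type) (s : seq I) (c : I -> C) (F : I -> gfun m G) : gfun m G :=
  fun e x => \sum_(i <- s) c i *: F i e x.

Lemma gcomb_nil I (c : I -> C) F : gcomb [::] c F = fun _ _ => 0.
Proof. by apply/funext => e; apply/funext => x; rewrite /gcomb big_nil. Qed.

Lemma gcomb_cons I i s (c : I -> C) F :
  gcomb (i :: s) c F = fun e x => c i *: F i e x + gcomb s c F e x.
Proof. by apply/funext => e; apply/funext => x; rewrite /gcomb big_cons. Qed.

Lemma L2_gcomb I (s : seq I) c (F : I -> gfun m G) : (forall i, L2 (F i)) -> L2 (gcomb s c F).
Proof.
move=> HF; elim: s => [|i s IH]; first by rewrite gcomb_nil; exact: L2_0.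
by rewrite gcomb_cons; exact: L2_lin.
Qed.

Lemma gae_eq_gcomb I (s : seq I) c (F F' : I -> gfun m G) :
  (forall i, gae_eq (F i) (F' i)) -> gae_eq (gcomb s c F) (gcomb s c F').
Proof.
move=> HF; elim: s => [|i s IH]; first by rewrite !gcomb_nil; exact: gae_eq_refl.
by rewrite !gcomb_cons; exact: gae_eq_lin.
Qed.

Variable B : set R.
Hypothesis mB : measurable B.

Lemma spectral_0 : gae_eq (E B (fun _ _ => 0)) (fun _ _ => 0).
Proof.
have H := spectral_linear HE (-1) mB (@L2_0 R m G) (@L2_0 R m G).
have E0 : (fun (e : edge G) (x : R) => -1 *: 0 + 0) = (fun _ _ => 0 : 'cV[C]_m).
  by apply/funext => e; apply/funext => x; rewrite scaler0 addr0.
rewrite E0 in H; apply: gae_eq_trans H _.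
by move=> e; apply: aeW => x _; rewrite scaleN1r addNr.
Qed.

Lemma spectral_gcomb I (s : seq I) c (F : I -> gfun m G) : (forall i, L2 (F i)) ->
  gae_eq (E B (gcomb s c F)) (gcomb s c (fun i => E B (F i))).
Proof.
move=> HF; elim: s => [|i s IH]; first by rewrite !gcomb_nil; exact: spectral_0.
rewrite !gcomb_cons.
have := spectral_linear HE (c i) mB (HF i) (L2_gcomb s c HF).
move=> /gae_eq_trans; apply; apply: gae_eq_lin => //; exact: gae_eq_refl.
Qed.

(** E(~` B) f = E(~` B) E(B) f = E(set0) f, and nu set0 = 0. *)
Lemma spectral_support f (nu : {measure set (measurableTypeR R) -> \bar R}) :
  L2 f -> gae_eq (E B f) f ->
  (forall A, measurable A -> nu A = (complex.Re (inner (E A f) f))%:E) ->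
  nu (~` B) = 0%E.
Proof.
move=> Hf EBf nuE; have mBC : measurable (~` B) by exact: measurableC.
have LB A : measurable A -> L2 (E A f) by move=> mA; exact: (spectral_L2 HE).
rewrite nuE//.
have -> : inner (E (~` B) f) f = inner (E set0 f) f.
  apply: inner_ae => //; [exact: LB|exact: LB| |exact: gae_eq_refl].
  have := spectral_setI HE mBC mB Hf; rewrite setICl => H0.
  apply: gae_eq_trans (gae_eq_sym H0); apply: (spectral_ae HE) => //; first exact: LB.
  exact: gae_eq_sym.
by rewrite -nuE// measure0.
Qed.

End SpectralSubspace.

Section NegativeWindow.
Variables (R : realType) (m : nat) (G : metric_graph R).
Local Notation C := R[i].
Variables (T : gfun m G -> gfun m G -> Prop) (E : set R -> gfun m G -> gfun m G).
Hypothesis HE : spectral_measure T E.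

(** Windows are bounded, so that their spectral subspaces lie in the domain of
    T. *)
Definition window (N : nat) : set R := `[- N%:R, 0[%classic.

Lemma window_measurable N : measurable (window N).
Proof. exact: measurable_itv. Qed.

(** The measure nu_f = <E(.) f, f> lives on the window, where x^2 <= N^2 and
    x < 0. So f is in the domain, and <T f, f>, the integral of x, is at most 0;
    it vanishes only if nu_f = 0, and nu_f has total mass |f|^2. *)
Lemma spectral_negative N f : L2 f -> gae_eq (E (window N) f) f ->
  exists g, T f g /\ exists t : R, [/\ inner g f = t%:C, t <= 0 &
    t = 0 -> gae_eq f (fun _ _ => 0)].
Proof.
move=> Hf EBf; have [nu [nuE dom quad]] := spectral_integral HE Hf.
have mB := window_measurable N.
pose B : set (measurableTypeR R) := window N.
have mBs : measurable B by exact: measurable_itv.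
have mBC : measurable (~` B) by exact: measurableC.
have nuBC : nu (~` B) = 0%E := spectral_support HE mB Hf EBf nuE.
have nuT : (nu setT < +oo)%E by rewrite nuE ?ltry.
have aeB : {ae nu, forall x, B x}.
  by exists (~` B); split.
have aeN : {ae nu, forall x, - N%:R <= x < 0}.
  apply: (@filterS _ _ (ae_filter_ringOfSetsType nu) _ _ _ aeB) => x.
  by rewrite /B /window /= in_itv/=.
have fincst (c : R) : 0 <= c -> (\int[nu]_(x in setT) c%:E < +oo)%E.
  move=> c0; rewrite integral_cst//= lte_mul_pinfty//.
have sqfin : (\int[nu]_x (x ^+ 2)%:E < +oo)%E.
  apply: le_lt_trans (fincst (N%:R ^+ 2) (sqr_ge0 _)); apply: ge0_ae_le_integral.
  - by move=> x _; rewrite lee_fin sqr_ge0.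
  - by move=> x _; rewrite lee_fin sqr_ge0.
  - apply: (@filterS _ _ (ae_filter_ringOfSetsType nu) _ _ _ aeN) => x /andP[Nx x0] _.
    by rewrite lee_fin -sqrrN ler_sqr ?nnegrE ?oppr_ge0 ?(ltW x0) ?ler0n// lerNl.
have [g Tfg] := dom.2 sqfin; exists g; split => //.
have mid : measurable_fun (setT : set (measurableTypeR R)) (EFin \o (@idfun R)).
  by apply/measurable_EFinP; exact: measurable_id.
have mabs : measurable_fun (setT : set (measurableTypeR R)) (fun x : R => `|(x%:E)|%E).
  exact: measurableT_comp mid.
have absfin : (\int[nu]_x `|x%:E| < +oo)%E.
  apply: le_lt_trans (fincst N%:R (ler0n _ _)); apply: ge0_ae_le_integral => //.
  apply: (@filterS _ _ (ae_filter_ringOfSetsType nu) _ _ _ aeN) => x /andP[Nx x0] _.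
  by rewrite lee_fin ler0_norm ?(ltW x0)// lerNl.
have abs0 : (0 <= \int[nu]_x `|x%:E|)%E by exact: integral_ge0.
have tE : \int[nu]_x x = - fine (\int[nu]_x `|x%:E|)%E.
  rewrite /Rintegral -fineN; congr fine.
  rewrite -integral_ge0N//.
  apply: ae_eq_integral => //; first exact: measurableT_comp mabs.
  apply: (@filterS _ _ (ae_filter_ringOfSetsType nu) _ _ _ aeN) => x /andP[Nx x0] _.
  by rewrite /= ltr0_norm// opprK.
exists (\int[nu]_x x); split; first exact: quad.
  by rewrite tE oppr_le0 fine_ge0.
rewrite tE => /eqP; rewrite oppr_eq0 fine_eq0 ?ge0_fin_numE// => /eqP a0.
have /(ae_eq_integral_abs _ measurableT mid) ae0 := a0.
have : nu setT = 0%E.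
  have [A [mA A0 sA]] : {ae nu, forall x : R, False}.
    apply: (@filterS2 _ _ (ae_filter_ringOfSetsType nu) _ _ _ _ aeN ae0) => x /andP[_ x0] H.
    by have [xx] := H I; rewrite xx ltxx in x0.
  by apply/eqP; rewrite -measure_le0 -A0 le_measure ?inE// => x _; exact: sA.
rewrite nuE// => -[i0]; apply: inner_self_eq0 => //; rewrite -[RHS]i0; congr complex.Re.
apply: inner_ae => //; [exact: (spectral_L2 HE)| |exact: gae_eq_refl].
exact/gae_eq_sym/(spectral_setT HE).
Qed.

Lemma window_setI N N' : (N <= N')%N -> window N `&` window N' = window N.
Proof.
move=> NN'; apply: setIidl; apply: subset_itvr.
by rewrite bnd_simp lerN2 ler_nat.
Qed.

Lemma window_kernel_antitone N N' f : (N <= N')%N -> L2 f ->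
  gae_eq (E (window N') f) (fun _ _ => 0) -> gae_eq (E (window N) f) (fun _ _ => 0).
Proof.
move=> NN' Hf E0.
have mN := window_measurable N; have mN' := window_measurable N'.
have := spectral_setI HE mN mN' Hf; rewrite window_setI// => H.
apply: gae_eq_trans H _; apply: gae_eq_trans (spectral_0 HE mN).
apply: (spectral_ae HE) => //; last exact: L2_0.
exact: (spectral_L2 HE).
Qed.

(** By continuity from below nu_f(]-oo, 0[) = 0, and this number is |f|^2. *)
Lemma window_kernel_trivial f : L2 f -> gae_eq (E `]-oo, 0[%classic f) f ->
  (forall N, gae_eq (E (window N) f) (fun _ _ => 0)) -> gae_eq f (fun _ _ => 0).
Proof.
move=> Hf Ef f0; have [nu [nuE _ _]] := spectral_integral HE Hf.
have inner0 g : gae_eq g (fun _ _ => 0) -> L2 g -> complex.Re (inner g f) = 0.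
  move=> g0 Hg.
  have -> : inner g f = inner (fun _ _ => 0) f.
    by apply: inner_ae => //; [exact: L2_0|exact: gae_eq_refl].
  rewrite Re_inner big1// => e _; rewrite /cintegral/=.
  rewrite (@eq_Rintegral _ _ _ _ _ (cst 0)) => [|x _].
    by rewrite Rintegral_cst ?mul0r//; exact: edge_set_measurable.
  by rewrite cRe_sum big1// => i _; rewrite mxE mul0r.
pose W N : set (measurableTypeR R) := window N.
have mW N : measurable (W N) by exact: window_measurable.
have nuW N : nu (W N) = 0%E.
  have LW : L2 (E (W N) f).
    by apply: (spectral_L2 HE) => //; exact: window_measurable.
  by rewrite nuE ?(inner0 _ (f0 N) LW)//; exact: mW.
have cup : \bigcup_N W N = `]-oo, 0[%classic.
  apply/seteqP; split=> [x [N _]|x]; rewrite /W /window /= !in_itv/=.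
    by move=> /andP[].
  move=> x0; exists (Num.bound (- x)) => //=; rewrite in_itv/= x0 andbT lerNl.
  by rewrite ltW// archi_boundP// oppr_ge0 ltW.
have cv := @nondecreasing_cvg_mu _ _ _ nu W mW (bigcup_measurable (fun N _ => mW N)) _.
have nd : {homo W : p q / (p <= q)%N >-> (p <= q)%O}.
  move=> p q pq; apply/subsetPset; apply: subset_itvr.
  by rewrite bnd_simp lerN2 ler_nat.
have nu0 : nu (\bigcup_N W N) = 0%E.
  rewrite -(cvg_lim _ (cv nd))//; apply: lim_near_cst => //.
  by apply: nearW => N; exact: nuW.
have mneg : measurable (`]-oo, 0[%classic : set R) by exact: measurable_itv.
have := nu0; rewrite cup nuE// => -[i0].
apply: inner_self_eq0 => //; rewrite -[RHS]i0; congr complex.Re.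
apply: inner_ae => //; [exact: (spectral_L2 HE)|exact: gae_eq_sym|exact: gae_eq_refl].
Qed.

Variables (n : nat) (s : 'I_n -> gfun m G).
Hypotheses (s_L2 : forall i, L2 (s i))
  (s_neg : forall i, gae_eq (E `]-oo, 0[%classic (s i)) (s i))
  (s_indep : lin_indep s).
Local Notation comb c := (gcomb (index_enum 'I_n) c s).

Lemma window_kernel_lin N (a : C) (c c' : 'I_n -> C) :
  gae_eq (E (window N) (comb c)) (fun _ _ => 0) ->
  gae_eq (E (window N) (comb c')) (fun _ _ => 0) ->
  gae_eq (E (window N) (comb (fun i => a * c i + c' i))) (fun _ _ => 0).
Proof.
move=> c0 c0'.
have -> : comb (fun i => a * c i + c' i) = (fun e x => a *: comb c e x + comb c' e x).
  apply/funext => e; apply/funext => x; rewrite /gcomb scaler_sumr -big_split/=.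
  by apply: eq_bigr => i _; rewrite scalerDl scalerA.
have H := spectral_linear HE a (window_measurable N)
  (L2_gcomb (index_enum _) c s_L2) (L2_gcomb (index_enum _) c' s_L2).
apply: gae_eq_trans H _; apply: gae_eq_trans (gae_eq_lin a c0 c0') _.
by move=> e; apply: aeW => x _; rewrite scaler0 addr0.
Qed.

Lemma comb_neg c : gae_eq (E `]-oo, 0[%classic (comb c)) (comb c).
Proof.
have mneg : measurable (`]-oo, 0[%classic : set R) by exact: measurable_itv.
apply: gae_eq_trans (spectral_gcomb HE mneg (index_enum _) c s_L2) _.
exact: gae_eq_gcomb.
Qed.

(** The combinations killed by E(window N) form spaces that decrease with N and
    have intersection 0, so they are 0 for some N. The proof is by induction
    on the number k of functions s_i that are combined. *)
Lemma window_injective : exists N, forall c : 'I_n -> C,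
  gae_eq (E (window N) (comb c)) (fun _ _ => 0) -> forall i, c i = 0.
Proof.
suff H k : (k <= n)%N -> exists N, forall c : 'I_n -> C,
    (forall i : 'I_n, (k <= i)%N -> c i = 0) ->
    gae_eq (E (window N) (comb c)) (fun _ _ => 0) -> forall i, c i = 0.
  have [N HN] := H n (leqnn n).
  by exists N => c; apply: HN => i; rewrite leqNgt ltn_ord.
elim: k => [_|k IH kn].
  by exists 0%N => c c0 _ i; exact: c0.
have [N HN] := IH (ltnW kn); apply: contrapT => nex.
pose ik := Ordinal kn.
(* as no window works for k.+1 functions, each later one kills a combination,
   in which s_k occurs by the choice of N, here with coefficient 1 *)
have key N' : (N <= N')%N -> exists c : 'I_n -> C,
    [/\ forall i : 'I_n, (k < i)%N -> c i = 0, c ik = 1 &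
     gae_eq (E (window N') (comb c)) (fun _ _ => 0)].
  move=> NN'; apply: contrapT => nc; apply: nex; exists N' => c csupp c0.
  have [ck0|ck0] := eqVneq (c ik) 0.
    apply: HN => [i ki|]; last first.
      by apply: window_kernel_antitone NN' _ c0; exact: L2_gcomb.
    have [->//|ik'] := eqVneq i ik; apply: csupp; rewrite ltn_neqAle ki andbT.
    by apply: contra ik' => /eqP kE; apply/eqP/val_inj.
  exfalso; apply: nc; exists (fun i => ((c ik)^-1 - 1) * c i + c i); split.
  - by move=> i ki; rewrite /= (csupp i ki) mulr0 addr0.
  - by rewrite mulrBl mul1r subrK mulVf.
  - exact: window_kernel_lin.
have [c1 [c1s c1k c10]] := key N (leqnn N).
(* such a combination is unique, since E(window N) is injective on the first k
   functions; hence it does not depend on the window *)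
have all0 N' : (N <= N')%N -> gae_eq (E (window N') (comb c1)) (fun _ _ => 0).
  move=> NN'; have [c [cs ck c0]] := key N' NN'.
  have c0N := window_kernel_antitone NN' (L2_gcomb _ _ s_L2) c0.
  have dN := window_kernel_lin (-1) c0N c10.
  suff -> : c1 = c by [].
  apply/funext => i.
  have : -1 * c i + c1 i = 0.
    apply: (HN (fun i => -1 * c i + c1 i)) => // {}i ki.
    have [->|ik'] := eqVneq i ik; first by rewrite ck c1k mulN1r addNr.
    have {}ki : (k < i)%N.
      rewrite ltn_neqAle ki andbT.
      by apply: contra ik' => /eqP kE; apply/eqP/val_inj.
    by rewrite cs// c1s// mulr0 addr0.
  by rewrite mulN1r => /eqP; rewrite addrC subr_eq0 => /eqP.
have comb0 : gae_eq (comb c1) (fun _ _ => 0).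
  apply: window_kernel_trivial; [exact: L2_gcomb|exact: comb_neg|move=> N'].
  apply: (@window_kernel_antitone _ (maxn N N')); [exact: leq_maxr|exact: L2_gcomb|].
  by apply: all0; exact: leq_maxl.
have := @s_indep c1 comb0 ik; rewrite c1k => /eqP.
by rewrite oner_eq0.
Qed.

End NegativeWindow.

(** * Negative directions on the graph *)

Section Limits.
Variables (R : realType) (m : nat).
Local Notation C := R[i].
Local Notation mu := (@lebesgue_measure R).

Lemma ccvg_sum (F : set_system R) (I : Type) (s : seq I) (a : I -> C)
    (h : I -> R -> 'cV[C]_m) (l : I -> 'cV[C]_m) : Filter F ->
  (forall i, ccvg F (h i) (l i)) ->
  ccvg F (fun x => \sum_(i <- s) a i *: h i x) (\sum_(i <- s) a i *: l i).
Proof.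
move=> FF hl j; split.
- have E (w : I -> 'cV[C]_m) : complex.Re ((\sum_(i <- s) a i *: w i) j 0) =
      \sum_(i <- s) (complex.Re (a i) * complex.Re (w i j 0) +
        (- complex.Im (a i)) * complex.Im (w i j 0)).
    rewrite summxE cRe_sum; apply: eq_bigr => i _.
    by rewrite mxE cRe_mul mulNr.
  rewrite E; under eq_cvg do rewrite E.
  apply: (@cvg_fun_sum _ _ _ (fun i x => complex.Re (a i) * complex.Re (h i x j 0) +
    (- complex.Im (a i)) * complex.Im (h i x j 0))) => i.
  by have [h1 h2] := hl i j; exact: cvgD (cvgM (cvg_cst _) h1) (cvgM (cvg_cst _) h2).
- have E (w : I -> 'cV[C]_m) : complex.Im ((\sum_(i <- s) a i *: w i) j 0) =
      \sum_(i <- s) (complex.Re (a i) * complex.Im (w i j 0) +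
        complex.Im (a i) * complex.Re (w i j 0)).
    rewrite summxE cIm_sum; apply: eq_bigr => i _.
    by rewrite mxE cIm_mul.
  rewrite E; under eq_cvg do rewrite E.
  apply: (@cvg_fun_sum _ _ _ (fun i x => complex.Re (a i) * complex.Im (h i x j 0) +
    complex.Im (a i) * complex.Re (h i x j 0))) => i.
  by have [h1 h2] := hl i j; exact: cvgD (cvgM (cvg_cst _) h2) (cvgM (cvg_cst _) h1).
Qed.

Lemma ccvg_near (F : set_system R) (h k : R -> 'cV[C]_m) (l : 'cV[C]_m) : Filter F ->
  (\forall x \near F, h x = k x) -> ccvg F h l -> ccvg F k l.
Proof.
move=> FF hk Hl j; have [h1 h2] := Hl j; split.
  by apply: cvg_trans h1; apply: near_eq_cvg; apply: filterS hk => x ->.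
by apply: cvg_trans h2; apply: near_eq_cvg; apply: filterS hk => x ->.
Qed.

(** If h - k did not vanish at x, it would not vanish on an interval around x,
    and intervals have positive measure. *)
Lemma continuous_ae_eq (D : set R) (h k : R -> R) : open D ->
  (forall x, D x -> {for x, continuous h}) ->
  (forall x, D x -> {for x, continuous k}) ->
  {ae mu, forall x, D x -> h x = k x} -> forall x, D x -> h x = k x.
Proof.
move=> oD ch ck [N [mN N0 sN]] x Dx; apply/eqP; rewrite -subr_eq0; apply/negPn/negP => hkx.
have c : {for x, continuous (fun y => h y - k y)}.
  exact: (continuousB (ch x Dx) (ck x Dx)).
have : \forall y \near x, D y /\ h y - k y != 0.
  apply: filterI; first by apply: open_nbhs_nbhs; split.
  have : \forall y \near x, `|(h x - k x) - (h y - k y)| < `|h x - k x|.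
    by move/cvgrPdist_lt: c; apply; rewrite normr_gt0.
  apply: filterS => y; apply: contraTneq => ->.
  by rewrite subr0 ltxx.
move=> /nbhs_ballP[d /= d0 Hd].
have sub : `]x - d, x + d[%classic `<=` N.
  move=> y; rewrite /= in_itv/= => /andP[y1 y2]; apply: sN => /= H.
  have [|Dy] := Hd y; first by rewrite /ball/= ltr_distlC y1.
  by rewrite subr_eq0 H// eqxx.
pose J : set (measurableTypeR R) := `]x - d, x + d[%classic.
have : (mu J <= mu N)%E.
  by apply: le_measure; rewrite ?inE//; exact: measurable_itv.
rewrite N0 leNgt => /negP; apply.
rewrite /J lebesgue_measure_itv/= lte_fin; have -> : x - d < x + d by lra.
by rewrite -EFinD lte_fin; lra.
Qed.

Lemma AC_loc_ccvg (D : set R) (h : R -> 'cV[C]_m) : open D -> AC_loc D h ->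
  forall x, D x -> ccvg (nbhs x) h (h x).
Proof.
move=> oD ach x Dx i.
have c k := abs_continuous_loc_continuous oD (rcoord_AC ach k) Dx.
by split; [exact: (c (i, false))|exact: (c (i, true))].
Qed.

Lemma ccvg_ae_eq (D : set R) (h k : R -> 'cV[C]_m) : open D ->
  (forall x, D x -> ccvg (nbhs x) h (h x)) ->
  (forall x, D x -> ccvg (nbhs x) k (k x)) ->
  {ae mu, forall x, D x -> h x = k x} -> forall x, D x -> h x = k x.
Proof.
move=> oD ch ck ae x Dx.
have H j : rcoord h j x = rcoord k j x.
  apply: (continuous_ae_eq oD _ _ _ Dx) => [y Dy|y Dy|].
  - exact: (@rcoord_cvg _ _ _ _ _ (ch y Dy) j).
  - exact: (@rcoord_cvg _ _ _ _ _ (ck y Dy) j).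
  - apply: (@filterS _ _ (ae_filter_ringOfSetsType mu) _ _ _ ae) => y Hy Dy.
    by rewrite /rcoord Hy.
apply/matrixP => i z; rewrite ord1; apply/eqP; rewrite eq_complex.
by apply/andP; split; apply/eqP; [exact: (H (i, false))|exact: (H (i, true))].
Qed.

End Limits.

Section Count.
Variables (R : realType) (m : nat) (G : metric_graph R).
Local Notation C := R[i].
Local Notation mu := (@lebesgue_measure R).
Variables (Q : edge G -> R -> 'M[C]_m) (alpha : vertex G -> 'M[C]_m)
  (E : set R -> gfun m G -> gfun m G).
Hypotheses
  (Q_herm : forall e, {ae @lebesgue_measure R, forall x,
       edge_set e x -> Q e x \is hermsymmx})
  (Q_L1 : forall e, L1_mx (edge_set e) (Q e))
  (xQ_L1 : forall e, L1_mx (edge_set e) (fun x => x%:C *: Q e x))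
  (HE : spectral_measure (hamiltonian alpha Q) E).
Variables (n : nat) (s : 'I_n -> gfun m G).
Hypotheses (s_L2 : forall i, L2 (s i))
  (s_neg : forall i, gae_eq (E `]-oo, 0[%classic (s i)) (s i))
  (s_indep : lin_indep s).

Let oD (e : edge G) : open (edge_set e).
Proof. exact: edge_set_open. Qed.

(** For each u a representative f0 u in the domain is chosen for the image of
    sum_i u_i s_i under E(window N). These choices are made independently;
    pointwise linearity in u comes from continuity, which upgrades equality
    almost everywhere. *)
Lemma negative_family : exists f0 g : 'rV[C]_n -> gfun m G,
  [/\ forall u, A_max Q (f0 u) (g u), forall u, vertex_condition alpha (f0 u),
    forall u, u != 0 -> complex.Re (inner (g u) (f0 u)) < 0 &
    forall u e x, edge_set e x ->
      f0 u e x = \sum_i u 0 i *: f0 (delta_mx 0 i) e x].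
Proof.
have [N HN] := window_injective HE s_L2 s_neg s_indep.
pose fN (u : 'rV[C]_n) := E (window N) (gcomb (index_enum 'I_n) (fun i => u 0 i) s).
have mW : measurable (@window R N) by exact: window_measurable.
have combL2 (u : 'rV[C]_n) : L2 (gcomb (index_enum 'I_n) (fun i => u 0 i) s).
  exact: L2_gcomb.
have fNL2 u : L2 (fN u) by apply: (spectral_L2 HE).
have fNE u : gae_eq (E (window N) (fN u)) (fN u).
  by have := spectral_setI HE mW mW (combL2 u); rewrite setIid => /gae_eq_sym.
have /choice[F HF] : forall u, exists p : gfun m G * gfun m G,
    [/\ gae_eq (fN u) p.1, A_max Q p.1 p.2, vertex_condition alpha p.1 &
      u != 0 -> complex.Re (inner p.2 p.1) < 0].
  move=> u; have [g [[_ [f [ff Af vf]]] [t [gt t0 tz]]]] := spectral_negative HE (fNL2 u) (fNE u).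
  exists (f, g); split => //= u0; have [L2f _ _ L2g _] := Af.
  have -> : inner g f = inner g (fN u).
    by apply: inner_ae => //; [exact: gae_eq_refl|exact: gae_eq_sym].
  rewrite gt /= lt_neqAle t0 andbT; apply/eqP => tE.
  move/eqP: u0; apply; apply/matrixP => i j; rewrite ord1 mxE.
  exact: HN (tz tE) j.
exists (fun u => (F u).1), (fun u => (F u).2); split => [u|u|u|u e x Dx].
- by have [] := HF u.
- by have [] := HF u.
- by have [] := HF u.
have aeF : gae_eq (F u).1 (gcomb (index_enum 'I_n) (fun i => u 0 i)
    (fun i => (F (delta_mx 0 i)).1)).
  have [uF _ _ _] := HF u; apply: gae_eq_trans (gae_eq_sym uF) _.
  apply: gae_eq_trans (spectral_gcomb HE mW _ _ s_L2) _.
  apply: gae_eq_gcomb => i; have [dF _ _ _] := HF (delta_mx 0 i).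
  apply: gae_eq_trans dF; rewrite /fN.
  suff -> : gcomb (index_enum 'I_n) (fun j => (delta_mx 0 i : 'rV[C]_n) 0 j) s = s i.
    exact: gae_eq_refl.
  apply/funext => e'; apply/funext => y; rewrite /gcomb (bigD1 i)//= big1 => [|j ji].
    by rewrite mxE !eqxx scale1r addr0.
  by rewrite mxE eqxx/= (negPf ji) scale0r.
have AC w : AC_loc (edge_set e) ((F w).1 e) by have [_ [] ] := HF w.
have cF w y : edge_set e y -> ccvg (nbhs y) ((F w).1 e) ((F w).1 e y).
  by move=> Dy; exact: (@AC_loc_ccvg _ _ (edge_set e) _ (@oD e) (AC w) y Dy).
apply: (@ccvg_ae_eq _ _ (edge_set e) ((F u).1 e)
  (fun x => \sum_i u 0 i *: (F (delta_mx 0 i)).1 e x) (@oD e) _ _ _ x Dx) => [y Dy|y Dy|].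
- exact: cF.
- by apply: ccvg_sum => i; exact: cF.
- exact: aeF e.
Qed.

Lemma edge_near_src (e : edge G) : \forall x \near (0:R)^'+, edge_set e x.
Proof.
have [B [DB _ _]] := edge_set_exhaustion e.
near=> x; apply: (edge_set_down (DB 0%N)); first by near: x; exact: nbhs_right_gt.
by near: x; apply: nbhs_right_ltW; exact: edge_set_gt0 (DB 0%N).
Unshelve. all: by end_near. Qed.

Lemma edge_near_far (e : edge G) v l : far e = Some (v, l) ->
  \forall x \near l^'-, edge_set e x.
Proof.
move=> fe; have l0 := length_gt0 fe; rewrite /edge_set fe.
near=> x; rewrite /= in_itv/=; apply/andP; split.
  by near: x; exact: nbhs_left_gt.
by near: x; exact: nbhs_left_lt.
Unshelve. all: by end_near. Qed.

Local Notation T e := (\int[mu]_(x in edge_set e)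
  (x * complex.Re (\tr (neg_part (Q e x))))).

(** Two successive families of linear conditions: zero values at the vertices,
    which select the rows of K, then on each edge the functionals of
    [edge_bound], which select the rows of K'. A row of K' would produce a
    function with <g, f> both negative and nonnegative. *)
Lemma negative_dimension_le : exists k : edge G -> nat,
  (forall e, (k e)%:Z <= Num.floor (T e)) /\ (n <= \sum_e k e + m * #|vertex G|)%N.
Proof.
have [f0 [g [Af vf neg lin]]] := negative_family.
have /choice[cv Hcv] : forall p : 'I_n * vertex G, exists c : 'cV[C]_m,
    forall e, end_value (f0 (delta_mx 0 p.1)) e p.2 c.
  by move=> [i v]; have [c [d [Hc _ _]]] := vf (delta_mx 0 i) v; exists c.
pose l (p : vertex G * 'I_m) : 'cV[C]_n := \col_i cv (i, p.1) p.2 0.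
have [r [K [freeK nr Kl]]] := kernel_rows l.
have cv0 (w : 'rV[C]_r) v : \sum_i (w *m K) 0 i *: cv (i, v) = 0.
  apply/matrixP => a b; rewrite ord1 summxE mxE.
  transitivity ((w *m K *m l (v, a)) 0 0); last by rewrite -mulmxA Kl mulmx0 mxE.
  by rewrite mxE; apply: eq_bigr => i _; rewrite !mxE.
have ccvg_sub (F : set_system R) (FF : Filter F) (u : 'rV[C]_n) (h : 'I_n -> R -> 'cV[C]_m)
    (k : R -> 'cV[C]_m) (c : 'I_n -> 'cV[C]_m) :
    (\forall x \near F, k x = \sum_i u 0 i *: h i x) ->
    (forall i, ccvg F (h i) (c i)) -> ccvg F k (\sum_i u 0 i *: c i).
  move=> kh hc; have := ccvg_sum (index_enum 'I_n) (fun i => u 0 i) FF hc.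
  by apply: ccvg_near; apply: filterS kh => x ->.
have dir e (w : 'rV[C]_r) : dirichlet_edge e (Q e) (f0 (w *m K) e) (g (w *m K) e).
  set u := w *m K; have [L2f ACf ACf' L2g gE] := Af u.
  split => //.
  - exact: (L2_csqint _).1 L2f e.
  - exact: (L2_csqint _).1 L2g e.

  - rewrite -(cv0 w (src e)).
    apply: (ccvg_sub 0^'+ _ u (fun i => f0 (delta_mx 0 i) e)).
      by have := edge_near_src e; apply: filterS => x Dx; exact: lin.
    by move=> i; have [H _] := Hcv (i, src e) e; exact: H.
  - have [c [d [_ Hd _]]] := vf u (src e); exists (d e).
    by have [H _] := Hd e; exact: H.
  - move=> v L fe; split.
      rewrite -(cv0 w v).
      apply: (ccvg_sub L^'- _ u (fun i => f0 (delta_mx 0 i) e)).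
        by have := edge_near_far fe; apply: filterS => x Dx; exact: lin.
      by move=> i; have [_ H] := Hcv (i, v) e; exact: H.
    have [c [d [_ Hd _]]] := vf u v; exists (d e).
    by have [_ H] := Hd e; exact: H.
have linK e (c : 'rV[C]_r) x : edge_set e x ->
    f0 (c *m K) e x = \sum_i c 0 i *: f0 (delta_mx 0 i *m K) e x.
  move=> Dx; rewrite lin//; under eq_bigr do rewrite mxE scaler_suml.
  rewrite exchange_big/=; apply: eq_bigr => i _.
  rewrite [in RHS]lin// scaler_sumr; apply: eq_bigr => j _.
  by rewrite -rowE mxE scalerA.
have /choice[kl Hkl] : forall e, exists kl : {k : nat & 'I_k -> 'cV[C]_r},
    ((tag kl)%:Z <= Num.floor (T e)) /\
    forall c, (forall i, c *m tagged kl i = 0) ->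
      0 <= complex.Re (cintegral (edge_set e) (fun x => cdot (g (c *m K) e x) (f0 (c *m K) e x))).
  move=> e; have [k [le [Hk Hl]]] := edge_bound (Q_herm e) (@Q_L1 e) (@xQ_L1 e) (dir e) (@linK e).
  by exists (existT _ k le).
exists (fun e => tag (kl e)); split => [e|]; first by have [] := Hkl e.
have [r' [K' [freeK' rr' K'l]]] := @kernel_rows _ r {e : edge G & 'I_(tag (kl e))}
  (fun p => tagged (kl (tag p)) (tagged p)).
have r'0 : r' = 0%N.
  case: r' K' freeK' rr' K'l => // r' K' freeK' _ K'l; exfalso.
  pose c := row ord0 K'; pose u := c *m K.
  have u0 : u != 0.
    rewrite /u mulmx_free_eq0// /c rowE mulmx_free_eq0//.
    apply/eqP => /matrixP/(_ 0 ord0); rewrite !mxE !eqxx => /eqP.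
    by rewrite oner_eq0.
  have := neg u u0; rewrite ltNge Re_inner => /negP; apply.
  apply: sumr_ge0 => e _; have [_] := Hkl e; apply => i.
  have := K'l (Tagged (fun e => 'I_(tag (kl e))) i) => /= H.
  by rewrite /c -row_mul H row0.
have cardE : #|{: {e : edge G & 'I_(tag (kl e))}}| = (\sum_e tag (kl e))%N.
  rewrite card_tagged sumnE big_map big_enum/=.
  by apply: eq_bigr => e _; rewrite card_ord.
rewrite (leq_trans nr)// card_prod card_ord mulnC leq_add2r.
by rewrite (leq_trans rr')// r'0 add0n cardE.
Qed.

End Count.

Theorem theorem5p4 (R : realType) (m : nat) (G : metric_graph R)
    (Q : edge G -> R -> 'M[R[i]]_m) (alpha : vertex G -> 'M[R[i]]_m)
    (m_gt0 : (0 < m)%N)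
    (Q_herm : forall e, {ae @lebesgue_measure R, forall x,
       edge_set e x -> Q e x \is hermsymmx})
    (Q_L1 : forall e, L1_mx (edge_set e) (Q e))
    (xQ_L1 : forall e, L1_mx (edge_set e) (fun x => x%:C *: Q e x))
    (alpha_herm : forall v, alpha v \is hermsymmx)
    (E : set R -> gfun m G -> gfun m G)
    (E_spectral : spectral_measure (hamiltonian alpha Q) E) :
  (kappa_minus E <=
    ((\sum_(e : edge G) Num.floor
        (\int[@lebesgue_measure R]_(x in edge_set e)
           (x * complex.Re (\tr (neg_part (Q e x))))))%:~R
     + (m * #|vertex G|)%:R)%:E)%E.
Proof.
apply: ge_ereal_sup => _ [n [s s_in s_indep] <-].
have [k [kT nk]] := negative_dimension_le Q_herm Q_L1 xQ_L1 E_spectral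
  (fun i => (s_in i).1) (fun i => (s_in i).2) s_indep.
rewrite lee_fin (le_trans (_ : _ <= (\sum_e k e + m * #|vertex G|)%:R))//.
  by rewrite ler_nat.
rewrite natrD lerD2r -[leLHS]/((\sum_e k e)%N%:~R) ler_int -natz natr_sum.
by apply: ler_sum => e _; rewrite natz.
Qed.
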